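(* For every $f\in F$, the word length of $f$ with respect to the generating set $\{x_0,x_1\}$ equals $\ell(f)=\ell_0(f)+\ell_1(f)$, where $\ell_0(f)$ is the sum of the weights of all spaces in the support of the reduced forest diagram $\mathfrak f$ of $f$, and $\ell_1(f)$ is the total number of carets (top and bottom) of $\mathfrak f$.
   Context: Thompson's group $F$ is realized as the group of all orientation-preserving piecewise-linear homeomorphisms $f$ of $\mathbb R$ with finitely many breakpoints, all breakpoints having dyadic rational coordinates, all slopes integral powers of $2$, and with $f(t)=t-m$ for all sufficiently negative $t$ and $f(t)=t-n$ for all sufficiently positive $t$, for some integers $m,n$. Products are compositions of functions: $fg=f\circ g$. The generators are $x_0(t)=t-1$ and $x_1(t)=t$ for $t\le 0$, $x_1(t)=t/2$ for $0\le t\le 2$, $x_1(t)=t-1$ for $t\ge 2$. Forest diagrams: a binary forest is a sequence $(T_i)_{i\in\mathbb Z}$ of finite rooted binary trees (every node has $0$ or $2$ children; internal nodes are called carets; a trivial tree is a single leaf), all but finitely many trivial, together with a pointer marking $T_0$. Tree $T_i$ represents the interval $[i,i+1]$, each caret represents halving the interval of its node, and the leaves of the forest give a dyadic subdivision of $\mathbb R$. A forest diagram for $f$ is a pair of binary forests, the bottom (domain) forest with subdivision $\mathcal D$ and the top (range) forest with subdivision $\mathcal R$, such that $f$ maps each interval of $\mathcal D$ linearly onto an interval of $\mathcal R$; this matches the leaves of the two forests by an order-preserving bijection, so the two forests share one linearly ordered set of leaves (columns). A reduction deletes an opposing pair of carets, i.e. a top caret and a bottom caret both of whose children are leaves and which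 have the same two (matched) leaves. A forest diagram is reduced if no reduction is possible; every element of $F$ has a unique reduced forest diagram. The support of a forest diagram is the smallest set of consecutive columns containing all leaves of nontrivial trees of either forest and the leaves of the two trees marked by the two pointers. A space is a gap between two consecutive columns; the spaces in the support are the gaps between consecutive columns of the support. Labels: in each of the two forests separately (using that forest's own pointer), a space is interior if the leaves on both sides of it belong to the same tree and exterior otherwise; it lies immediately to the left of a caret $c$ of that forest if the leaf immediately to its right is the leftmost leaf descending from $c$. Each space of the support receives a label in each forest: $L$ if it is exterior and to the left of the tree marked by the pointer; otherwise $N$ if it lies immediately to the left of some caret; otherwise $R$ if it is exterior (hence to the right of the marked tree); otherwise $I$ (interior). A space thus has a label pair (top label, bottom label). Weights, by (top, bottom): $(L,L)=2$, $(L,N)=1$, $(L,R)=1$, $(L,I)=1$; $(N,L)=1$, $(N,N)=2$, $(N,R)=2$, $(N,I)=2$; $(R,L)=1$, $(R,N)=2$, $(R,R)=2$, $(R,I)=0$; $(I,L)=1$, $(I,N)=2$, $(I,R)=0$, $(I,I)=0$. *)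

(* Defs.v *)
From Stdlib Require Import Reals ZArith List.
Import ListNotations.
Open Scope R_scope.

Definition dyadic (x : R) : Prop := exists (a : Z) (k : nat), x = IZR a / 2 ^ k.

Fixpoint pieces_ok (f : R -> R) (bs : list R) : Prop :=
  match bs with
  | [] => True
  | x :: rest =>
      dyadic x /\ dyadic (f x) /\
      match rest with
      | [] => True
      | y :: _ =>
          x < y /\
          (exists z : Z, forall t, x <= t <= y -> f t = f x + powerRZ 2 z * (t - x))
      end /\ pieces_ok f rest
  end.

Definition in_F (f : R -> R) : Prop :=
  exists (b0 : R) (bs : list R) (m n : Z),
    pieces_ok f (b0 :: bs) /\
    (forall t, t <= b0 -> f t = t - IZR m) /\
    (forall t, last (b0 :: bs) b0 <= t -> f t = t - IZR n).

Definition x0 (t : R) : R := t - 1.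
Definition x0inv (t : R) : R := t + 1.
Definition x1 (t : R) : R :=
  if Rle_dec t 0 then t else if Rle_dec t 2 then t / 2 else t - 1.
Definition x1inv (t : R) : R :=
  if Rle_dec t 0 then t else if Rle_dec t 1 then 2 * t else t + 1.

Inductive letter := X0 | X0inv | X1 | X1inv.

Definition letter_fun (g : letter) : R -> R :=
  match g with X0 => x0 | X0inv => x0inv | X1 => x1 | X1inv => x1inv end.

Fixpoint eval_word (w : list letter) : R -> R :=
  match w with
  | [] => fun t => t
  | g :: w' => fun t => letter_fun g (eval_word w' t)
  end.

Definition word_length (f : R -> R) (n : nat) : Prop :=
  (exists w, length w = n /\ eval_word w = f) /\
  (forall w, eval_word w = f -> (n <= length w)%nat).

Inductive tree := Leaf | Node (l r : tree).

Fixpoint subtree (t : tree) (p : list bool) : option tree :=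
  match p with
  | [] => Some t
  | b :: p' =>
      match t with
      | Leaf => None
      | Node l r => subtree (if b then r else l) p'
      end
  end.

Fixpoint ncarets (t : tree) : nat :=
  match t with Leaf => 0%nat | Node l r => S (ncarets l + ncarets r) end.

Fixpoint leftmost_path (t : tree) : list bool :=
  match t with Leaf => [] | Node l _ => false :: leftmost_path l end.

(* A forest: tree T i represents [i, i+1]; the pointer marks T 0. *)
Definition forest := Z -> tree.

Definition finite_forest (T : forest) : Prop :=
  exists N : nat, forall i : Z, (Z.of_nat N < Z.abs i)%Z -> T i = Leaf.

Fixpoint path_left (p : list bool) : R :=
  match p with
  | [] => 0
  | b :: p' => (if b then / 2 else 0) + path_left p' / 2
  end.
Definition node_left (i : Z) (p : list bool) : R := IZR i + path_left p.
Definition node_right (i : Z) (p : list bool) : R := node_left i p + / 2 ^ length p.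

Definition leaf_of (T : forest) (i : Z) (p : list bool) : Prop := subtree (T i) p = Some Leaf.

Record diagram := Diagram { top : forest ; bot : forest }.

Definition is_diagram_for (f : R -> R) (d : diagram) : Prop :=
  finite_forest (top d) /\ finite_forest (bot d) /\
  forall i p, leaf_of (bot d) i p ->
    let a := node_left i p in let b := node_right i p in
    (exists j q, leaf_of (top d) j q /\ node_left j q = f a /\ node_right j q = f b) /\
    (forall t, a <= t <= b -> f t = f a + (t - a) * (f b - f a) / (b - a)).

Definition matched (f : R -> R) (i : Z) (p : list bool) (j : Z) (q : list bool) : Prop :=
  f (node_left i p) = node_left j q /\ f (node_right i p) = node_right j q.

Definition reducible (f : R -> R) (d : diagram) : Prop :=
  exists i p j q,
    subtree (bot d i) p = Some (Node Leaf Leaf) /\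
    subtree (top d j) q = Some (Node Leaf Leaf) /\
    matched f i (p ++ [false]) j (q ++ [false]) /\
    matched f i (p ++ [true]) j (q ++ [true]).

Definition reduced_diagram (f : R -> R) (d : diagram) : Prop :=
  is_diagram_for f d /\ ~ reducible f d.

(* Columns are identified with bottom leaves (i,p).  A column is special if
   its leaf lies in a nontrivial tree or in the pointer tree, in either forest. *)
Definition special_column (f : R -> R) (d : diagram) (i : Z) (p : list bool) : Prop :=
  leaf_of (bot d) i p /\
  (bot d i <> Leaf \/ i = 0%Z \/
   exists j q, leaf_of (top d) j q /\ matched f i p j q /\ (top d j <> Leaf \/ j = 0%Z)).

(* Spaces are identified with the bottom-coordinate point x separating two
   consecutive columns; x is in the support iff some special column lies to
   its left and some special column lies to its right. *)
Definition support_space (f : R -> R) (d : diagram) (x : R) : Prop :=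
  (exists i p, leaf_of (bot d) i p /\ node_right i p = x) /\
  (exists i p, special_column f d i p /\ node_right i p <= x) /\
  (exists i p, special_column f d i p /\ x <= node_left i p).

Inductive label := LL | NN | RR | II.

Definition is_label (T : forest) (y : R) (lab : label) : Prop :=
  forall i p k r,
    leaf_of T i p -> node_right i p = y ->
    leaf_of T k r -> node_left k r = y ->
    let ext := i <> k in
    let left_of_ptr := (ext /\ (k <= 0)%Z) in
    let left_of_caret :=
      exists (k' : Z) c l s, subtree (T k') c = Some (Node l s) /\
        (k', c ++ leftmost_path (Node l s)) = (k, r) in
    match lab with
    | LL => left_of_ptr
    | NN => ~ left_of_ptr /\ left_of_caret
    | RR => ~ left_of_ptr /\ ~ left_of_caret /\ ext
    | II => ~ left_of_ptr /\ ~ left_of_caret /\ ~ ext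
    end.

Definition weight (t b : label) : nat :=
  match t, b with
  | LL, LL => 2 | LL, NN => 1 | LL, RR => 1 | LL, II => 1
  | NN, LL => 1 | NN, NN => 2 | NN, RR => 2 | NN, II => 2
  | RR, LL => 1 | RR, NN => 2 | RR, RR => 2 | RR, II => 0
  | II, LL => 1 | II, NN => 2 | II, RR => 0 | II, II => 0
  end.

(* The space at bottom point x sits at top point f x. *)
Definition space_weight (f : R -> R) (d : diagram) (x : R) (w : nat) : Prop :=
  exists lt lb, is_label (top d) (f x) lt /\ is_label (bot d) x lb /\ w = weight lt lb.

Definition ell0 (f : R -> R) (d : diagram) (n : nat) : Prop :=
  exists s : list (R * nat),
    NoDup (map fst s) /\
    (forall x, In x (map fst s) <-> support_space f d x) /\
    Forall (fun xw => space_weight f d (fst xw) (snd xw)) s /\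
    n = list_sum (map snd s).

Definition ell1 (d : diagram) (n : nat) : Prop :=
  exists N : nat,
    (forall i : Z, (Z.of_nat N < Z.abs i)%Z -> top d i = Leaf /\ bot d i = Leaf) /\
    n = list_sum (map (fun k : nat =>
          let i := (Z.of_nat k - Z.of_nat N)%Z in (ncarets (top d i) + ncarets (bot d i))%nat)
          (seq 0 (2 * N + 1))).

(* Main.v *)
Require Import Defs.
From Stdlib Require Import Reals ZArith List Lra Lia Bool.
From Stdlib Require Import FunctionalExtensionality Classical ClassicalEpsilon.
Import ListNotations.
Open Scope R_scope.

(** A forest diagram is flattened to the list of its columns, each column being a pair of
    matched dyadic intervals.  Every caret corresponds to a unique interior space, so the
    length is a sum over the spaces of the support of a weight that depends only on the
    column to the right of the space.  Left multiplication by [x0] and [x1] moves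
    the top pointer, respectively joins the two top trees at the pointer; each changes the
    weight of one space only (up to a cancellation or a change of the support), and
    by at most one, so the word length is at least [ell f].  Conversely, a case analysis
    on the two spaces next to the top pointer finds, for every [f] but the identity, a
    generator that decreases the length.  The reduced diagram exists because its columns are
    the maximal dyadic intervals mapped linearly onto dyadic intervals. *)

(** A leaf is stored as a numerator and a depth, which is the same data as its address in the
    forest: an integer left end marks the leftmost leaf of a tree, and positive depth with an even
    numerator marks a left child. This is why the label of a space can be read off the leaf to its
    right alone, and why a generator acts on columns by integer arithmetic on the range half. In
    each of these cases exactly one space appears or disappears, and its weight with carets included
    is one. The length [ell] is a relation between functions and numbers; both bounds are proved for
    every value that it relates to [f], so the result holds for every reduced diagram. *)

(** * Dyadic fractions, dyadic intervals and the labels of spaces *)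

Definition P (m : nat) : Z := (2 ^ Z.of_nat m)%Z.

Lemma P_0 : P 0 = 1%Z.
Proof. reflexivity. Qed.

Lemma P_S m : P (S m) = (2 * P m)%Z.
Proof. unfold P. rewrite Nat2Z.inj_succ, Z.pow_succ_r; lia. Qed.

Lemma P_pos m : (0 < P m)%Z.
Proof. unfold P. apply Z.pow_pos_nonneg; lia. Qed.

Lemma IZR_P m : IZR (P m) = 2 ^ m.
Proof. unfold P. rewrite <- pow_IZR. reflexivity. Qed.

Lemma pow2_pos m : 0 < 2 ^ m.
Proof. apply pow_lt; lra. Qed.

Definition frac (a : Z) (m : nat) : R := IZR a / 2 ^ m.

Lemma frac_0 z : frac z 0 = IZR z.
Proof. unfold frac. simpl. field. Qed.

Lemma frac_sub a m b k :
  frac a m - frac b k = IZR (a * P k - b * P m) / (2 ^ m * 2 ^ k).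
Proof.
  unfold frac. rewrite minus_IZR, !mult_IZR, !IZR_P.
  pose proof (pow2_pos m); pose proof (pow2_pos k). field. lra.
Qed.

(** Cross multiplication turns comparisons of dyadic reals into integer inequalities, which [lia]
    and [nia] can handle. *)
Lemma frac_lt a m b k : frac a m < frac b k <-> (a * P k < b * P m)%Z.
Proof.
  pose proof (frac_sub b k a m) as E.
  assert (H : 0 < 2 ^ k * 2 ^ m) by (apply Rmult_lt_0_compat; apply pow2_pos).
  set (d := 2 ^ k * 2 ^ m) in *. split; intros L.
  - assert (0 < IZR (b * P m - a * P k)).
    { replace (IZR (b * P m - a * P k)) with ((frac b k - frac a m) * d)
        by (rewrite E; field; lra).
      apply Rmult_lt_0_compat; lra. }
    apply lt_IZR in H0. lia.
  - assert (0 < IZR (b * P m - a * P k)) by (apply IZR_lt; lia).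
    assert (0 < frac b k - frac a m) by (rewrite E; apply Rdiv_lt_0_compat; lra).
    lra.
Qed.

Lemma frac_le a m b k : frac a m <= frac b k <-> (a * P k <= b * P m)%Z.
Proof.
  pose proof (frac_lt b k a m) as H. split; intros L.
  - apply Z.le_ngt. intros N. apply H in N. lra.
  - apply Rnot_lt_le. intros N. apply H in N. lia.
Qed.

Lemma frac_eq a m b k : frac a m = frac b k <-> (a * P k = b * P m)%Z.
Proof.
  pose proof (frac_le a m b k) as H1. pose proof (frac_le b k a m) as H2.
  split; intros L.
  - assert (a * P k <= b * P m)%Z by (apply H1; lra).
    assert (b * P m <= a * P k)%Z by (apply H2; lra). lia.
  - assert (frac a m <= frac b k) by (apply H1; lia).
    assert (frac b k <= frac a m) by (apply H2; lia). lra.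
Qed.

(* [Dint a m] is the interval [a / 2^m, (a + 1) / 2^m]. *)
Record dint := Dint { num : Z; dep : nat }.

Definition dl (d : dint) : R := frac (num d) (dep d).
Definition dr (d : dint) : R := frac (num d + 1) (dep d).

Lemma dl_lt_dr d : dl d < dr d.
Proof. apply frac_lt. pose proof (P_pos (dep d)). nia. Qed.

Lemma dl_le_int d z : dl d <= IZR z <-> (num d <= z * P (dep d))%Z.
Proof. rewrite <- frac_0. unfold dl. rewrite frac_le, P_0. lia. Qed.
Lemma int_le_dl d z : IZR z <= dl d <-> (z * P (dep d) <= num d)%Z.
Proof. rewrite <- frac_0. unfold dl. rewrite frac_le, P_0. lia. Qed.
Lemma dr_le_int d z : dr d <= IZR z <-> (num d + 1 <= z * P (dep d))%Z.
Proof. rewrite <- frac_0. unfold dr. rewrite frac_le, P_0. lia. Qed.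
Lemma dl_eq_int d z : dl d = IZR z <-> (num d = z * P (dep d))%Z.
Proof. rewrite <- frac_0. unfold dl. rewrite frac_eq, P_0. lia. Qed.
Lemma dr_eq_int d z : dr d = IZR z <-> (num d + 1 = z * P (dep d))%Z.
Proof. rewrite <- frac_0. unfold dr. rewrite frac_eq, P_0. lia. Qed.
Lemma dr_eq_dl d e : dr d = dl e <-> ((num d + 1) * P (dep e) = num e * P (dep d))%Z.
Proof. apply frac_eq. Qed.

(** Over the common denominator [2 ^ dep d] the two ends have consecutive numerators, so no integer
    fits strictly between them. *)
Lemma dl_lt_int_dr d z : dl d < IZR z -> dr d <= IZR z.
Proof.
  intros H. apply dr_le_int.
  assert (~ (z * P (dep d) <= num d)%Z) by (rewrite <- int_le_dl; lra). lia.
Qed.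

(* [whole], [lab] and [inner] describe the space immediately to the left of the leaf [d]. *)
Definition whole (d : dint) : bool := (num d mod P (dep d) =? 0)%Z.

Definition lab (d : dint) : label :=
  if whole d && (num d <=? 0)%Z then LL
  else if (dep d =? 0)%nat then RR
  else if Z.even (num d) then NN else II.

Definition inner (d : dint) : nat := if whole d then 0 else 1.

(** Positive depth means that the leaf belongs to a nontrivial tree; at depth zero only the tree
    marked by the pointer counts. *)
Definition special (d : dint) : bool := (0 <? dep d)%nat || (num d =? 0)%Z.

Lemma whole_iff d : whole d = true <-> exists z, num d = (z * P (dep d))%Z.
Proof.
  unfold whole. pose proof (P_pos (dep d)). rewrite Z.eqb_eq. split.
  - intros H0. apply Z.mod_divide in H0; [|lia]. destruct H0 as [z Hz]. eauto.
  - intros [z ->]. apply Z.mod_mul. lia.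
Qed.

Lemma whole_true d z : num d = (z * P (dep d))%Z -> whole d = true.
Proof. intros H. apply whole_iff. eauto. Qed.

Lemma whole_dep0 d : dep d = 0%nat -> whole d = true.
Proof. intros H. apply (whole_true d (num d)). rewrite H, P_0. lia. Qed.

Lemma whole_false d z :
  (z * P (dep d) < num d < (z + 1) * P (dep d))%Z -> whole d = false.
Proof.
  intros H. destruct (whole d) eqn:E; auto. apply whole_iff in E as [y Hy].
  pose proof (P_pos (dep d)).
  assert (z < y)%Z by nia. assert (y < z + 1)%Z by nia. lia.
Qed.

Lemma whole_shift d z : whole (Dint (num d + z * P (dep d)) (dep d)) = whole d.
Proof.
  apply eq_true_iff_eq. rewrite !whole_iff. simpl. split; intros [y Hy].
  - exists (y - z)%Z. lia.
  - exists (y + z)%Z. lia.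
Qed.

Lemma even_mulP z m : (0 < m)%nat -> Z.even (z * P m) = true.
Proof.
  intros H. destruct m; [lia|]. rewrite P_S, Z.even_mul, Z.even_mul. simpl.
  apply orb_true_r.
Qed.

Lemma even_shift b z m : (0 < m)%nat -> Z.even (b + z * P m) = Z.even b.
Proof. intros H. rewrite Z.even_add, even_mulP by auto. now destruct (Z.even b). Qed.

Lemma lab_LL d z : num d = (z * P (dep d))%Z -> (z <= 0)%Z -> lab d = LL.
Proof.
  intros H Hz. unfold lab. rewrite (whole_true _ _ H).
  pose proof (P_pos (dep d)). replace (num d <=? 0)%Z with true; auto.
  symmetry. apply Z.leb_le. nia.
Qed.

(** The space is exterior and right of the pointer tree. If the tree after it is nontrivial, its
    leftmost leaf is a left child, which gives N; a trivial tree has no caret and gives R. *)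
Lemma lab_pos d z : num d = (z * P (dep d))%Z -> (0 < z)%Z ->
  lab d = if (dep d =? 0)%nat then RR else NN.
Proof.
  intros H Hz. unfold lab. pose proof (P_pos (dep d)).
  replace (num d <=? 0)%Z with false by (symmetry; apply Z.leb_gt; nia).
  rewrite andb_false_r. destruct (dep d =? 0)%nat eqn:E; auto.
  apply Nat.eqb_neq in E. rewrite H, even_mulP by lia. reflexivity.
Qed.

Lemma lab_inner d : whole d = false -> lab d = if Z.even (num d) then NN else II.
Proof.
  intros H. unfold lab. rewrite H. simpl.
  destruct (dep d =? 0)%nat eqn:E; auto. apply Nat.eqb_eq in E.
  rewrite whole_dep0 in H; congruence.
Qed.

Lemma inner_dep d : whole d = false -> (0 < dep d)%nat.
Proof.
  intros H. destruct (dep d) eqn:E; [|lia]. rewrite whole_dep0 in H; congruence.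
Qed.

Lemma lab_LL_iff d : lab d = LL <-> exists z, num d = (z * P (dep d))%Z /\ (z <= 0)%Z.
Proof.
  split.
  - unfold lab. destruct (whole d) eqn:E; simpl.
    + destruct (Z.leb_spec (num d) 0).
      * intros _. apply whole_iff in E as [z Hz]. exists z. split; auto.
        pose proof (P_pos (dep d)). nia.
      * now destruct (dep d =? 0)%nat, (Z.even (num d)).
    + now destruct (dep d =? 0)%nat, (Z.even (num d)).
  - intros (z & H1 & H2). eapply lab_LL; eauto.
Qed.

Lemma lab_RR_iff d : lab d = RR <-> dep d = 0%nat /\ (0 < num d)%Z.
Proof.
  split.
  - unfold lab. destruct (dep d =? 0)%nat eqn:E.
    + apply Nat.eqb_eq in E. rewrite (whole_dep0 _ E). simpl.
      destruct (Z.leb_spec (num d) 0); [discriminate|auto].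
    + now destruct (whole d && (num d <=? 0)%Z), (Z.even (num d)).
  - intros (E & H). rewrite (lab_pos d (num d)); auto.
    + now rewrite E.
    + rewrite E, P_0. lia.
Qed.

Lemma lab_II_iff d : lab d = II <-> whole d = false /\ Z.odd (num d) = true.
Proof.
  rewrite <- Z.negb_even. split.
  - destruct (whole d) eqn:E.
    + apply whole_iff in E as [z Hz]. destruct (Z_le_gt_dec z 0).
      * rewrite (lab_LL d z); auto. discriminate.
      * rewrite (lab_pos d z) by (auto; lia). now destruct (dep d =? 0)%nat.
    + rewrite lab_inner by auto. destruct (Z.even (num d)); simpl; auto; discriminate.
  - intros [H1 H2]. rewrite lab_inner by auto. now destruct (Z.even (num d)).
Qed.

Lemma lab_NN d : lab d = NN -> (0 < dep d)%nat /\ Z.even (num d) = true.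
Proof.
  unfold lab. destruct (whole d && (num d <=? 0)%Z); [discriminate|].
  destruct (dep d =? 0)%nat eqn:E; [discriminate|]. apply Nat.eqb_neq in E.
  destruct (Z.even (num d)); [split; auto; lia|discriminate].
Qed.

(** An integer translation keeps integrality and, at positive depth, parity. Only the comparison
    with the pointer could change, and each alternative excludes that: the space stays on its side
    of the pointer or is interior. *)
Lemma lab_shift d z : (num d <= 0 /\ num d + z * P (dep d) <= 0 \/
   0 < num d /\ 0 < num d + z * P (dep d) \/ whole d = false)%Z ->
  lab (Dint (num d + z * P (dep d)) (dep d)) = lab d.
Proof.
  intros H. pose proof (whole_shift d z) as Hw. unfold lab. rewrite Hw. simpl.
  replace (whole d && (num d + z * P (dep d) <=? 0)%Z)
    with (whole d && (num d <=? 0)%Z).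
  - destruct (dep d) eqn:E; auto. simpl. rewrite <- E, even_shift by lia. reflexivity.
  - destruct H as [H|[H|H]].
    + f_equal. transitivity true; [|symmetry]; apply Z.leb_le; lia.
    + f_equal. transitivity false; [|symmetry]; apply Z.leb_gt; lia.
    + now rewrite H.
Qed.

Lemma inner_shift d z : inner (Dint (num d + z * P (dep d)) (dep d)) = inner d.
Proof. unfold inner. now rewrite whole_shift. Qed.

(** * Columns and lists of columns *)

Record col := Col { dom : dint; ran : dint }.

Definition W (c : col) : nat :=
  (weight (lab (ran c)) (lab (dom c)) + inner (ran c) + inner (dom c))%nat.

Definition total (l : list col) : nat := list_sum (map W l).

Definition cspecial (c : col) : bool := special (dom c) || special (ran c).

Fixpoint chain (x y : R) (l : list col) (x' y' : R) : Prop :=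
  match l with
  | [] => x = x' /\ y = y'
  | c :: l => dl (dom c) = x /\ dl (ran c) = y /\ chain (dr (dom c)) (dr (ran c)) l x' y'
  end.

Definition affine (f : R -> R) (a b : R) : Prop :=
  forall t, a <= t <= b -> f t = f a + (t - a) * ((f b - f a) / (b - a)).

Definition maps (f : R -> R) (c : col) : Prop :=
  f (dl (dom c)) = dl (ran c) /\ f (dr (dom c)) = dr (ran c) /\
  affine f (dl (dom c)) (dr (dom c)).

(** Outside the list [f] is an integer translation on either side, which amounts to infinitely many
    trivial columns. The list is therefore only a window, whose ends can be moved over trivial
    columns. *)
Definition rep (f : R -> R) (l : list col) (i j i' j' : Z) : Prop :=
  chain (IZR i) (IZR j) l (IZR i') (IZR j') /\ Forall (maps f) l /\
  (forall t, t <= IZR i -> f t = t - IZR i + IZR j) /\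
  (forall t, IZR i' <= t -> f t = t - IZR i' + IZR j').

Lemma total_app l l' : total (l ++ l') = (total l + total l')%nat.
Proof. unfold total. now rewrite map_app, list_sum_app. Qed.

Lemma total_cons c l : total (c :: l) = (W c + total l)%nat.
Proof. reflexivity. Qed.

Lemma total_map s l : Forall (fun c => W (s c) = W c) l -> total (map s l) = total l.
Proof.
  unfold total. rewrite map_map. intros H. f_equal. apply map_ext_Forall. exact H.
Qed.

Lemma chain_app x y l l' x' y' :
  chain x y (l ++ l') x' y' <-> exists u v, chain x y l u v /\ chain u v l' x' y'.
Proof.
  revert x y. induction l as [|c l IH]; simpl; intros x y.
  - split.
    + intros H. exists x, y. auto.
    + intros (u & v & [-> ->] & H). exact H.
  - rewrite IH. split.
    + intros (H1 & H2 & u & v & H3 & H4). exists u, v. auto.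
    + intros (u & v & (H1 & H2 & H3) & H4). eauto 6.
Qed.

Lemma chain_bounds x y l x' y' : chain x y l x' y' ->
  x <= x' /\ y <= y' /\
  Forall (fun c => x <= dl (dom c) /\ dr (dom c) <= x' /\ y <= dl (ran c) /\ dr (ran c) <= y') l.
Proof.
  revert x y. induction l as [|c l IH]; simpl; intros x y.
  - intros [-> ->]. repeat split; auto; lra.
  - intros (H1 & H2 & H). apply IH in H as (Hx & Hy & H).
    pose proof (dl_lt_dr (dom c)). pose proof (dl_lt_dr (ran c)).
    repeat split; try lra. constructor; [lra|].
    eapply Forall_impl; [|exact H]. simpl. intros; lra.
Qed.

(* An integer is never interior to a dyadic interval of length at most 1. *)
Lemma chain_split_ran x j l x' y' z : chain x (IZR j) l x' y' ->
  (j <= z)%Z -> IZR z < y' ->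
  exists A c B, l = A ++ c :: B /\ dl (ran c) = IZR z /\
    chain x (IZR j) A (dl (dom c)) (IZR z) /\
    chain (dr (dom c)) (dr (ran c)) B x' y'.
Proof.
  intros H Hj. apply IZR_le in Hj. revert H Hj. generalize (IZR j) as y.
  revert x. induction l as [|c l IH]; simpl; intros x y H Hj Hy.
  - destruct H. lra.
  - destruct H as (H1 & H2 & H). destruct (Req_dec y (IZR z)) as [E|E].
    + subst y. exists [], c, l. simpl. auto 6.
    + destruct (IH _ _ H) as (A & c' & B & -> & H3 & H4 & H5); auto.
      { apply dl_lt_int_dr. lra. }
      exists (c :: A), c', B. simpl. auto 7.
Qed.

Lemma affine_comp f g a b : a < b -> f a < f b ->
  affine f a b -> affine g (f a) (f b) -> affine (fun t => g (f t)) a b.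
Proof.
  intros Hab Hf F G t Ht. rewrite (G (f t)).
  - rewrite (F t Ht). field. lra.
  (* [u] is the barycentric coordinate of [t]; the point [f t] has the same coordinate between [f a]
     and [f b]. *)
  - rewrite (F t Ht). set (u := (t - a) / (b - a)).
    replace ((t - a) * ((f b - f a) / (b - a))) with (u * (f b - f a))
      by (unfold u; field; lra).
    assert (0 <= u <= 1).
    { unfold u. split.
      - apply Rmult_le_pos; [lra|]. left. apply Rinv_0_lt_compat. lra.
      - apply (Rmult_le_reg_r (b - a)); [lra|]. unfold Rdiv.
        rewrite Rmult_assoc, Rinv_l; lra. }
    nra.
Qed.

Lemma affine_sub f a b a' b' : affine f a b -> a <= a' -> a' < b' -> b' <= b ->
  affine f a' b'.
Proof.
  intros F H1 H2 H3 t Ht. rewrite (F t), (F a'), (F b') by lra. field. lra.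
Qed.

(** The condition at the midpoint forces the two halves to have the same slope. *)
Lemma affine_glue f a b : a < b ->
  f ((a + b) / 2) = (f a + f b) / 2 ->
  affine f a ((a + b) / 2) -> affine f ((a + b) / 2) b -> affine f a b.
Proof.
  intros Hab Hm F G t Ht. destruct (Rle_dec t ((a + b) / 2)).
  - rewrite (F t), Hm by lra. field. lra.
  - rewrite (G t), Hm by lra. field. lra.
Qed.

Lemma affine_slope f a b k : (forall t, a <= t <= b -> f t = f a + k * (t - a)) ->
  a < b -> affine f a b.
Proof.
  intros H Hab t Ht. rewrite (H t), (H b) by lra. field. lra.
Qed.

(** * Moves on columns *)

Definition follows (g : R -> R) (s : dint -> dint) (d : dint) : Prop :=
  dl (s d) = g (dl d) /\ dr (s d) = g (dr d) /\ affine g (dl d) (dr d).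

Definition onran (s : dint -> dint) (c : col) : col := Col (dom c) (s (ran c)).

(** Left multiplication only touches the range coordinate: the domain intervals are kept and each
    range interval is replaced by its image. Reducedness and trimming may be lost and are treated
    separately. *)
Lemma rep_move f g s l i j i' j' k k' :
  rep f l i j i' j' -> Forall (fun c => follows g s (ran c)) l ->
  (forall t, t <= IZR j -> g t = t - IZR j + IZR k) ->
  (forall t, IZR j' <= t -> g t = t - IZR j' + IZR k') ->
  rep (fun t => g (f t)) (map (onran s) l) i k i' k'.
Proof.
  intros (C & M & Lf & Lf') G Lg Lg'. repeat split.
  (* With the new corners written as images of the old ones, the induction can run over arbitrary
     starting points. *)
  - replace (IZR k) with (g (IZR j)) by (rewrite Lg; lra).
    replace (IZR k') with (g (IZR j')) by (rewrite Lg'; lra).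
    clear Lg Lg' Lf Lf'. revert C. generalize (IZR i), (IZR j).
    induction l as [|c l IH]; simpl; intros x y.
    + intros [-> ->]; auto.
    + inversion_clear G. inversion_clear M. intros (H1' & H2' & H3'). subst.
      destruct H as (E1 & E2 & E3). rewrite E1, E2. auto.
  - apply Forall_map. revert G M. rewrite !Forall_forall. intros G M c Hc.
    destruct (G c Hc) as (E1 & E2 & E3). destruct (M c Hc) as (F1 & F2 & F3).
    unfold maps, onran; simpl. rewrite F1, F2, E1, E2. repeat split; auto.
    apply affine_comp; auto.
    + apply dl_lt_dr.
    + rewrite F1, F2. apply dl_lt_dr.
    + rewrite F1, F2. exact E3.
  - intros t Ht. rewrite Lg; rewrite Lf by auto; lra.
  - intros t Ht. rewrite Lg'; rewrite Lf' by auto; lra.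
Qed.

Definition unit (a b : Z) : col := Col (Dint a 0) (Dint b 0).

Lemma dl_unit a : dl (Dint a 0) = IZR a.
Proof. apply frac_0. Qed.
Lemma dr_unit a : dr (Dint a 0) = IZR a + 1.
Proof. unfold dr; simpl. now rewrite frac_0, plus_IZR. Qed.

Lemma maps_unit f a b :
  (forall t, IZR a <= t <= IZR a + 1 -> f t = t - IZR a + IZR b) -> maps f (unit a b).
Proof.
  intros H. unfold maps, unit; simpl. rewrite !dl_unit, !dr_unit.
  repeat split; try (rewrite H; lra).
  apply affine_slope with (k := 1); [|lra]. intros t Ht. rewrite !H; lra.
Qed.

Lemma rep_grow_right f l i j i' j' : rep f l i j i' j' ->
  rep f (l ++ [unit i' j']) i j (i' + 1) (j' + 1).
Proof.
  intros (C & M & L & L'). repeat split; auto.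
  - apply chain_app. exists (IZR i'), (IZR j'). split; auto. simpl.
    rewrite !dl_unit, !dr_unit, !plus_IZR. auto.
  - apply Forall_app; split; auto. constructor; auto. apply maps_unit.
    intros t Ht. apply L'. lra.
  - intros t. rewrite !plus_IZR. intros Ht. rewrite L'; lra.
Qed.

Lemma rep_grow_left f l i j i' j' : rep f l i j i' j' ->
  rep f (unit (i - 1) (j - 1) :: l) (i - 1) (j - 1) i' j'.
Proof.
  intros (C & M & L & L'). repeat split; auto.
  - apply dl_unit.
  - apply dl_unit.
  - simpl. rewrite !dr_unit, !minus_IZR.
    replace (IZR i - 1 + 1) with (IZR i) by lra.
    replace (IZR j - 1 + 1) with (IZR j) by lra. auto.
  - constructor; auto. apply maps_unit. rewrite !minus_IZR.
    intros t Ht. rewrite L; lra.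
  - intros t. rewrite !minus_IZR. intros Ht. rewrite L; lra.
Qed.

Lemma dint_unit d : dep d = 0%nat -> d = Dint (num d) 0.
Proof. destruct d; simpl; congruence. Qed.

Lemma plain_unit c : dep (dom c) = 0%nat -> dep (ran c) = 0%nat ->
  c = unit (num (dom c)) (num (ran c)).
Proof.
  intros H1 H2. destruct c as [d e]; simpl in *. unfold unit.
  now rewrite <- (dint_unit d), <- (dint_unit e).
Qed.

Lemma maps_unit_inv f a b t : maps f (unit a b) -> IZR a <= t <= IZR a + 1 ->
  f t = t - IZR a + IZR b.
Proof.
  intros (E1 & E2 & E3). unfold unit in *; simpl in *.
  rewrite !dl_unit, !dr_unit in *. intros H. rewrite E3 by auto.
  rewrite E1, E2. field. lra.
Qed.

(** On a unit column [f] is a translation, by the same integer as on the ray to its left, so the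
    column can be absorbed into that ray. *)
Lemma rep_drop_left f a b l i j i' j' : rep f (unit a b :: l) i j i' j' ->
  a = i /\ b = j /\ rep f l (i + 1) (j + 1) i' j'.
Proof.
  intros (C & M & L & L'). simpl in C. destruct C as (C1 & C2 & C).
  rewrite dl_unit in *. apply eq_IZR in C1, C2. subst a b. inversion_clear M.
  rewrite !dr_unit, <- !plus_IZR in C. repeat split; auto.
  intros t. rewrite !plus_IZR. intros Ht. destruct (Rle_dec t (IZR i)).
  - rewrite L; lra.
  - rewrite (maps_unit_inv _ _ _ _ H); lra.
Qed.

Lemma rep_drop_right f a b l i j i' j' : rep f (l ++ [unit a b]) i j i' j' ->
  (a = i' - 1)%Z /\ (b = j' - 1)%Z /\ rep f l i j (i' - 1) (j' - 1).
Proof.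
  intros (C & M & L & L'). apply chain_app in C as (u & v & C & Cl).
  simpl in Cl. destruct Cl as (C1 & C2 & C3 & C4).
  rewrite dl_unit, dr_unit in *. subst u v.
  rewrite <- plus_IZR in C3, C4. apply eq_IZR in C3, C4.
  apply Forall_app in M as [M M1]. inversion_clear M1.
  subst i' j'. rewrite !Z.add_simpl_r. repeat split; auto.
  intros t Ht. rewrite !plus_IZR in L'. destruct (Rle_dec t (IZR a + 1)).
  - rewrite (maps_unit_inv _ _ _ t H); lra.
  - rewrite L'; lra.
Qed.

Definition half0 (d : dint) : dint := Dint (2 * num d) (S (dep d)).
Definition half1 (d : dint) : dint := Dint (2 * num d + 1) (S (dep d)).

Lemma dl_half0 d : dl (half0 d) = dl d.
Proof. apply frac_eq. cbn [half0 half1 num dep]. rewrite P_S. ring. Qed.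
Lemma dr_half1 d : dr (half1 d) = dr d.
Proof. apply frac_eq. cbn [half0 half1 num dep]. rewrite P_S. ring. Qed.
Lemma dr_half0_dl_half1 d : dr (half0 d) = dl (half1 d).
Proof. reflexivity. Qed.
Lemma dl_half1 d : dl (half1 d) = (dl d + dr d) / 2.
Proof.
  unfold dl, dr, half1, frac; cbn [num dep pow].
  rewrite !plus_IZR, mult_IZR. pose proof (pow2_pos (dep d)). field. lra.
Qed.

Definition col0 (c : col) : col := Col (half0 (dom c)) (half0 (ran c)).
Definition col1 (c : col) : col := Col (half1 (dom c)) (half1 (ran c)).

Lemma maps_halves f c : maps f c <-> maps f (col0 c) /\ maps f (col1 c).
Proof.
  unfold maps, col0, col1; simpl.
  rewrite !dr_half0_dl_half1, !dl_half0, !dr_half1, !dl_half1.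
  pose proof (dl_lt_dr (dom c)). split.
  - intros (E1 & E2 & E).
    assert (Hm : f ((dl (dom c) + dr (dom c)) / 2) = (dl (ran c) + dr (ran c)) / 2).
    { rewrite E by lra. rewrite E1, E2. field. lra. }
    repeat split; auto; eapply affine_sub; eauto; lra.
  - intros ((E1 & E2 & E) & (F1 & F2 & F)). repeat split; auto.
    apply affine_glue; auto. rewrite E1, F2. exact E2.
Qed.

Lemma chain_halves x y A c B x' y' :
  chain x y (A ++ c :: B) x' y' <-> chain x y (A ++ col0 c :: col1 c :: B) x' y'.
Proof.
  rewrite !chain_app. simpl.
  rewrite !dr_half0_dl_half1, !dl_half0, !dr_half1.
  split; intros (u & v & H & H'); exists u, v; tauto.
Qed.

(** From right to left this is a reduction of the diagram, from left to right the insertion of an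
    opposing pair of carets. *)
Lemma rep_halves f A c B i j i' j' :
  rep f (A ++ c :: B) i j i' j' <-> rep f (A ++ col0 c :: col1 c :: B) i j i' j'.
Proof.
  unfold rep. rewrite chain_halves.
  rewrite !Forall_app, !Forall_cons_iff, maps_halves. tauto.
Qed.

(** * Reduced lists of columns and the states of the walk *)

(** In the list of columns an opposing pair of carets shows up as two columns that are the halves of
    a common column. *)
Definition opp (c c' : col) : Prop := exists e, c = col0 e /\ c' = col1 e.

Definition adj (l : list col) (c c' : col) : Prop := exists A B, l = A ++ c :: c' :: B.

Definition red (l : list col) : Prop := forall c c', adj l c c' -> ~ opp c c'.

Lemma adj_cons a l c c' : adj (a :: l) c c' <->
  (exists B, a = c /\ l = c' :: B) \/ adj l c c'.
Proof.
  split.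
  - intros ([|b A] & B & E); simpl in E; inversion E; subst.
    + left. eauto.
    + right. exists A, B. reflexivity.
  - intros [(B & -> & ->)|(A & B & ->)].
    + exists [], B. reflexivity.
    + exists (a :: A), B. reflexivity.
Qed.

Lemma adj_app A B c c' : adj (A ++ B) c c' <->
  adj A c c' \/ adj B c c' \/ (exists A' B', A = A' ++ [c] /\ B = c' :: B').
Proof.
  induction A as [|a A IH]; simpl.
  - split; [tauto|]. intros [(A & B' & E)|[H|(A' & B' & E & _)]]; auto.
    + now destruct A.
    + now destruct A'.
  - rewrite !adj_cons, IH. split.
    + intros [(B1 & -> & E)|[H|[H|(A' & B' & -> & ->)]]]; auto.
      * destruct A as [|a A]; simpl in E.
        -- right; right. exists [], B1. auto.
        -- inversion E; subst. left; left. eauto.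
      * right; right. exists (a :: A'), B'. auto.
    + intros [[(B1 & -> & ->)|H]|[H|(A' & B' & E & ->)]]; auto.
      * left. simpl. eauto.
      * destruct A' as [|a' A']; simpl in E; inversion E; subst.
        -- left. exists B'. auto.
        -- right; right; right. exists A', B'. auto.
Qed.

Lemma red_app_l A B : red (A ++ B) -> red A.
Proof. intros H c c' Ha. apply H, adj_app. auto. Qed.
Lemma red_app_r A B : red (A ++ B) -> red B.
Proof. intros H c c' Ha. apply H, adj_app. auto. Qed.
Lemma red_cons c l : red (c :: l) -> red l.
Proof. apply (red_app_r [c]). Qed.

Lemma adj_map s l c c' : adj (map s l) c c' ->
  exists e e', adj l e e' /\ c = s e /\ c' = s e'.
Proof.
  intros (A & B & E). apply map_eq_app in E as (A' & B' & -> & <- & E).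
  apply map_eq_cons in E as (e & B1 & -> & <- & E).
  apply map_eq_cons in E as (e' & B2 & -> & <- & <-).
  exists e, e'. split; auto. exists A', B2. reflexivity.
Qed.

Lemma red_map s l : (forall c c', adj l c c' -> opp (s c) (s c') -> opp c c') ->
  red l -> red (map s l).
Proof.
  intros H R c c' Ha. apply adj_map in Ha as (e & e' & Ha & -> & ->).
  intros Ho. apply (R e e' Ha). auto.
Qed.

(** Used to exclude columns with a unit interval on either side from every opposing pair. *)
Lemma opp_dep c c' : opp c c' ->
  (0 < dep (dom c))%nat /\ (0 < dep (ran c))%nat /\
  (0 < dep (dom c'))%nat /\ (0 < dep (ran c'))%nat.
Proof. intros (e & -> & ->). simpl. lia. Qed.

Lemma red_snoc_unit l a b : red l -> red (l ++ [unit a b]).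
Proof.
  intros H c c' Ha Ho. apply adj_app in Ha as [Ha|[Ha|(A' & B' & -> & E)]].
  - eapply H; eauto.
  - destruct Ha as ([|x [|y A]] & B & E); discriminate.
  - inversion E; subst. apply opp_dep in Ho. simpl in Ho. lia.
Qed.

Lemma red_cons_unit l a b : red l -> red (unit a b :: l).
Proof.
  intros H c c' Ha Ho. apply adj_cons in Ha as [(B & <- & ->)|Ha].
  - apply opp_dep in Ho. simpl in Ho. lia.
  - eapply H; eauto.
Qed.

(* The list consists exactly of the columns of the support. *)
Definition trimmed (l : list col) : Prop :=
  (forall c B, l = c :: B -> cspecial c = true) /\
  (forall A c, l = A ++ [c] -> cspecial c = true).

(** The inequalities put the two pointer trees inside the window; together with [trimmed] they make
    the window exactly the support. *)
Definition state (f : R -> R) (l : list col) (i j i' j' : Z) : Prop :=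
  rep f l i j i' j' /\ red l /\ trimmed l /\
  (i <= 0 < i')%Z /\ (j <= 0 < j')%Z.

(** The spaces of the support are the left ends of all columns but the first, whence the tail. *)
Definition ell (f : R -> R) (n : nat) : Prop :=
  exists l i j i' j', state f l i j i' j' /\ n = total (tl l).

(** * The generators on dyadic intervals *)

Definition shift (z : Z) (d : dint) : dint := Dint (num d + z * P (dep d)) (dep d).

Lemma dl_shift z d : dl (shift z d) = dl d + IZR z.
Proof.
  unfold dl, shift, frac; cbn [num dep]. rewrite plus_IZR, mult_IZR, IZR_P.
  pose proof (pow2_pos (dep d)). field. lra.
Qed.

Lemma dr_shift z d : dr (shift z d) = dr d + IZR z.
Proof.
  unfold dr, shift, frac; cbn [num dep]. rewrite !plus_IZR, mult_IZR, IZR_P.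
  pose proof (pow2_pos (dep d)). field. lra.
Qed.

Lemma shift_shift z d : shift (- z) (shift z d) = d.
Proof. destruct d as [b m]. unfold shift; simpl. f_equal. lia. Qed.

Lemma half0_shift z d : shift z (half0 d) = half0 (shift z d).
Proof. unfold shift, half0; cbn [num dep]. f_equal. rewrite P_S. ring. Qed.
Lemma half1_shift z d : shift z (half1 d) = half1 (shift z d).
Proof. unfold shift, half1; cbn [num dep]. f_equal. rewrite P_S. ring. Qed.

(* x1 on dyadic intervals: the two intervals [0,1] and [1,2] become the halves of [0,1]. *)
Definition join (d : dint) : dint :=
  if (num d <? 0)%Z then d
  else if (num d <? 2 * P (dep d))%Z then Dint (num d) (S (dep d))
  else shift (-1) d.

(** Inside [[0, 1]] the depth drops by one, which removes the root caret of the pointer tree. At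
    depth zero [pred] returns a dummy value, which [joined] excludes. *)
Definition unjoin (d : dint) : dint :=
  if (num d <? 0)%Z then d
  else if (num d <? P (dep d))%Z then Dint (num d) (pred (dep d))
  else shift 1 d.

Lemma follows_shift g z d : (forall t, dl d <= t <= dr d -> g t = t + IZR z) ->
  follows g (shift z) d.
Proof.
  intros H. pose proof (dl_lt_dr d). unfold follows. rewrite dl_shift, dr_shift.
  rewrite !H by lra. repeat split; auto.
  apply affine_slope with (k := 1); auto. intros t Ht. rewrite !H; lra.
Qed.

Lemma x0_shift t : x0 t = t + IZR (-1).
Proof. unfold x0. simpl. lra. Qed.

Lemma x0inv_shift t : x0inv t = t + IZR 1.
Proof. reflexivity. Qed.

Lemma x1_neg t : t <= 0 -> x1 t = t.
Proof. intros H. unfold x1. destruct (Rle_dec t 0); lra. Qed.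
Lemma x1_mid t : 0 <= t <= 2 -> x1 t = t / 2.
Proof. intros H. unfold x1. destruct (Rle_dec t 0), (Rle_dec t 2); lra. Qed.
Lemma x1_large t : 2 <= t -> x1 t = t - 1.
Proof. intros H. unfold x1. destruct (Rle_dec t 0), (Rle_dec t 2); lra. Qed.
Lemma x1inv_neg t : t <= 0 -> x1inv t = t.
Proof. intros H. unfold x1inv. destruct (Rle_dec t 0); lra. Qed.
Lemma x1inv_mid t : 0 <= t <= 1 -> x1inv t = 2 * t.
Proof. intros H. unfold x1inv. destruct (Rle_dec t 0), (Rle_dec t 1); lra. Qed.
Lemma x1inv_large t : 1 <= t -> x1inv t = t + 1.
Proof. intros H. unfold x1inv. destruct (Rle_dec t 0), (Rle_dec t 1); lra. Qed.

Lemma dl_deeper b m : dl (Dint b (S m)) = dl (Dint b m) / 2.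
Proof. unfold dl, frac; cbn [num dep pow]. pose proof (pow2_pos m). field. lra. Qed.
Lemma dr_deeper b m : dr (Dint b (S m)) = dr (Dint b m) / 2.
Proof. unfold dr, frac; cbn [num dep pow]. pose proof (pow2_pos m). field. lra. Qed.

Lemma follows_join d : follows x1 join d.
Proof.
  pose proof (dl_lt_dr d). unfold follows, join.
  destruct (Z.ltb_spec (num d) 0); [|destruct (Z.ltb_spec (num d) (2 * P (dep d)))].
  - assert (dr d <= 0) by (apply (dr_le_int d 0); lia).
    rewrite !x1_neg by lra. repeat split; auto.
    apply affine_slope with (k := 1); auto. intros t Ht. rewrite !x1_neg; lra.
  - assert (0 <= dl d) by (apply (int_le_dl d 0); lia).
    assert (dr d <= 2) by (apply (dr_le_int d 2); lia).
    rewrite dl_deeper, dr_deeper. destruct d as [b m]; simpl in *.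
    rewrite !x1_mid by lra. repeat split; auto.
    apply affine_slope with (k := / 2); auto. intros t Ht. rewrite !x1_mid; lra.
  - assert (2 <= dl d) by (apply (int_le_dl d 2); lia).
    apply (follows_shift x1 (-1)). intros t Ht. rewrite x1_large; simpl; lra.
Qed.

(* Excludes the interval [0, 1], which [x1inv] does not map to a single dyadic interval of
   length at most 1. *)
Definition joined (d : dint) : Prop := (0 < dep d)%nat \/ (num d <> 0)%Z.

Lemma follows_unjoin d : joined d -> follows x1inv unjoin d.
Proof.
  intros J. pose proof (dl_lt_dr d). unfold follows, unjoin.
  destruct (Z.ltb_spec (num d) 0); [|destruct (Z.ltb_spec (num d) (P (dep d)))].
  - assert (dr d <= 0) by (apply (dr_le_int d 0); lia).
    rewrite !x1inv_neg by lra. repeat split; auto.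
    apply affine_slope with (k := 1); auto. intros t Ht. rewrite !x1inv_neg; lra.
  - assert (0 <= dl d) by (apply (int_le_dl d 0); lia).
    assert (dr d <= 1) by (apply (dr_le_int d 1); lia).
    destruct d as [b m]; simpl in *. destruct m as [|m].
    { rewrite P_0 in *. destruct J as [J|J]; simpl in J; lia. }
    rewrite !x1inv_mid by lra. simpl pred.
    pose proof (dl_deeper b m). pose proof (dr_deeper b m).
    repeat split; try lra.
    apply affine_slope with (k := 2); auto. intros t Ht. rewrite !x1inv_mid; lra.
  - assert (1 <= dl d) by (apply (int_le_dl d 1); lia).
    apply (follows_shift x1inv 1). intros t Ht. rewrite x1inv_large; simpl; lra.
Qed.

Ltac ltb_cases := repeat match goal with
  | |- context [Z.ltb ?a ?b] => destruct (Z.ltb_spec a b)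
  end.

Lemma join_unjoin d : joined d -> join (unjoin d) = d.
Proof.
  intros J. destruct d as [b m]. unfold unjoin, joined, shift in *; cbn [num dep] in *.
  pose proof (P_pos m). destruct (Z.ltb_spec b 0); [|destruct (Z.ltb_spec b (P m))].
  - unfold join; cbn [num dep]. ltb_cases; auto; lia.
  - destruct m as [|m]. { rewrite P_0 in *. lia. }
    rewrite P_S in *. simpl pred. unfold join; cbn [num dep]. ltb_cases; auto; lia.
  - unfold join, shift; cbn [num dep]. ltb_cases; try lia. f_equal. lia.
Qed.

Lemma unjoin_join d : unjoin (join d) = d.
Proof.
  destruct d as [b m]. pose proof (P_pos m). unfold join, shift; cbn [num dep].
  destruct (Z.ltb_spec b 0); [|destruct (Z.ltb_spec b (2 * P m))];
    unfold unjoin, shift; cbn [num dep]; rewrite ?P_S; ltb_cases; auto; try lia.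
  f_equal. lia.
Qed.

(** The breakpoints of [x1] are the integers 0 and 2, never interior to a dyadic interval of this
    kind, so parent and child fall under the same branch. *)
Lemma join_half0 d : join (half0 d) = half0 (join d).
Proof.
  destruct d as [b m]. unfold join, half0, shift; cbn [num dep]. rewrite P_S.
  ltb_cases; try lia; cbn [num dep]; f_equal; lia.
Qed.
Lemma join_half1 d : join (half1 d) = half1 (join d).
Proof.
  destruct d as [b m]. unfold join, half1, shift; cbn [num dep]. rewrite P_S.
  ltb_cases; try lia; cbn [num dep]; f_equal; lia.
Qed.
Lemma unjoin_half0 d : joined d -> unjoin (half0 d) = half0 (unjoin d).
Proof.
  intros J. rewrite <- (join_unjoin d J) at 1. now rewrite <- join_half0, unjoin_join.
Qed.
Lemma unjoin_half1 d : joined d -> unjoin (half1 d) = half1 (unjoin d).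
Proof.
  intros J. rewrite <- (join_unjoin d J) at 1. now rewrite <- join_half1, unjoin_join.
Qed.

(** The common parent is moved back by the inverse translation, so the pair was already opposing
    before the move. *)
Lemma opp_shift z c c' : opp (onran (shift z) c) (onran (shift z) c') -> opp c c'.
Proof.
  intros ([d e] & E1 & E2). exists (Col d (shift (- z) e)).
  destruct c as [a b], c' as [a' b']. unfold onran, col0, col1 in *; cbn [dom ran] in *.
  pose proof (f_equal ran E1) as F1. pose proof (f_equal ran E2) as F2.
  apply (f_equal dom) in E1, E2. cbn [dom ran] in *. subst a a'.
  rewrite <- (shift_shift z b), <- (shift_shift z b'), F1, F2, half0_shift, half1_shift.
  auto.
Qed.

Lemma opp_unjoin c c' : joined (ran c) -> joined (ran c') ->
  opp (onran unjoin c) (onran unjoin c') -> opp c c'.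
Proof.
  intros J J' ([d e] & E1 & E2). exists (Col d (join e)).
  destruct c as [a b], c' as [a' b']. unfold onran, col0, col1 in *; cbn [dom ran] in *.
  pose proof (f_equal ran E1) as F1. pose proof (f_equal ran E2) as F2.
  apply (f_equal dom) in E1, E2. cbn [dom ran] in *. subst a a'.
  rewrite <- (join_unjoin b J), <- (join_unjoin b' J'), F1, F2, join_half0, join_half1.
  auto.
Qed.

Lemma joined_dec d : joined d \/ d = Dint 0 0.
Proof.
  destruct d as [b [|m]]; unfold joined; simpl; [|lia].
  destruct (Z.eq_dec b 0); [subst; auto|lia].
Qed.

(** Moving the common parent back fails only when its range interval is [[0, 1]], which is not the
    join of a single interval: its halves come from the two unit intervals [[0, 1]] and [[1, 2]]. *)
Lemma opp_join c c' : opp (onran join c) (onran join c') ->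
  opp c c' \/
  (ran c = Dint 0 0 /\ ran c' = Dint 1 0 /\ exists e, dom c = half0 e /\ dom c' = half1 e).
Proof.
  intros ([d e] & E1 & E2).
  destruct c as [a b], c' as [a' b']. unfold onran, col0, col1 in *; cbn [dom ran] in *.
  pose proof (f_equal ran E1) as F1. pose proof (f_equal ran E2) as F2.
  apply (f_equal dom) in E1, E2. cbn [dom ran] in *. subst a a'.
  rewrite <- (unjoin_join b), <- (unjoin_join b'), F1, F2.
  destruct (joined_dec e) as [J| ->].
  - left. exists (Col d (unjoin e)). rewrite unjoin_half0, unjoin_half1 by auto. auto.
  - right. repeat split; eauto.
Qed.

Lemma opp_join_units e : opp (onran join (Col (half0 e) (Dint 0 0)))
                             (onran join (Col (half1 e) (Dint 1 0))).
Proof. exists (Col e (Dint 0 0)). split; reflexivity. Qed.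

(** * Weights under the generators *)

Lemma W_ran s c : lab (s (ran c)) = lab (ran c) -> inner (s (ran c)) = inner (ran c) ->
  W (onran s c) = W c.
Proof. intros H1 H2. unfold W, onran; simpl. now rewrite H1, H2. Qed.

Lemma W_shift_neg z c :
  (num (ran c) <= 0)%Z -> (num (ran c) + z * P (dep (ran c)) <= 0)%Z ->
  W (onran (shift z) c) = W c.
Proof.
  intros H1 H2. apply W_ran; [|apply inner_shift]. apply lab_shift. auto.
Qed.

Lemma W_shift_pos z c :
  (0 < num (ran c))%Z -> (0 < num (ran c) + z * P (dep (ran c)))%Z ->
  W (onran (shift z) c) = W c.
Proof.
  intros H1 H2. apply W_ran; [|apply inner_shift]. apply lab_shift. auto.
Qed.

Lemma W_shift_inner z c : whole (ran c) = false -> W (onran (shift z) c) = W c.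
Proof.
  intros H. apply W_ran; [|apply inner_shift]. apply lab_shift. auto.
Qed.

(** The space at the integer 1 is the only one to change: it turns from exterior to interior. The
    space at 0 remains left of the pointer, spaces inside the two joined trees remain interior with
    the same parity, and those from 2 on are translated. *)
Lemma W_join c : num (ran c) <> P (dep (ran c)) -> W (onran join c) = W c.
Proof.
  intros H. destruct c as [d [b m]]; cbn [ran num dep] in *. pose proof (P_pos m).
  apply W_ran; cbn [ran]; unfold join; cbn [num dep].
  - destruct (Z.ltb_spec b 0); auto. destruct (Z.ltb_spec b (2 * P m)).
    + destruct (Z.eq_dec b 0) as [->|Hb].
      { rewrite !(lab_LL _ 0) by (cbn [num dep]; lia). reflexivity. }
      assert (F : whole (Dint b m) = false).
      { destruct (Z_lt_ge_dec b (P m)).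
        - apply whole_false with 0%Z. cbn [num dep]. lia.
        - apply whole_false with 1%Z. cbn [num dep]. lia. }
      rewrite (lab_inner (Dint b m) F), lab_inner; auto.
      apply whole_false with 0%Z. cbn [num dep]. rewrite P_S. lia.
    + apply (lab_shift (Dint b m) (-1)). cbn [num dep]. lia.
  - destruct (Z.ltb_spec b 0); auto. destruct (Z.ltb_spec b (2 * P m)).
    + unfold inner. destruct (Z.eq_dec b 0) as [->|Hb].
      { rewrite !(whole_true _ 0); auto; cbn [num dep]; lia. }
      assert (F : whole (Dint b m) = false).
      { destruct (Z_lt_ge_dec b (P m)).
        - apply whole_false with 0%Z. cbn [num dep]. lia.
        - apply whole_false with 1%Z. cbn [num dep]. lia. }
      rewrite F, (whole_false _ 0); auto. cbn [num dep]. rewrite P_S. lia.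
    + apply (inner_shift (Dint b m)).
Qed.

Lemma W_unjoin c : joined (ran c) ->
  num (unjoin (ran c)) <> P (dep (unjoin (ran c))) -> W (onran unjoin c) = W c.
Proof.
  intros J H. rewrite <- W_join by exact H. unfold onran; cbn [dom ran].
  rewrite join_unjoin by auto. now destruct c.
Qed.

Lemma special_join d : special d = true -> special (join d) = true.
Proof.
  destruct d as [b m]. unfold special, join; cbn [num dep]. intros H.
  ltb_cases; auto. unfold shift; cbn [num dep].
  destruct m; auto. simpl in *. apply Z.eqb_eq in H. lia.
Qed.

(** Removing the root caret can turn a leaf into an unmarked trivial tree only if the leaf is the
    right child of the root, [Dint 1 1]; a left child of the root becomes the marked tree. *)
Lemma special_unjoin d : special d = true -> joined d -> d <> Dint 1 1 ->
  special (unjoin d) = true.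
Proof.
  intros H J N. destruct d as [b m]. destruct m as [|m].
  - unfold special, joined in *; simpl in *. apply Z.eqb_eq in H. lia.
  - unfold special, unjoin, shift; cbn [num dep pred]. ltb_cases; auto.
    destruct m as [|m]; auto. change (P 1) with 2%Z in *. simpl.
    apply Z.eqb_eq. assert (b = 0 \/ b = 1)%Z as [->| ->] by lia; congruence.
Qed.

Lemma cspecial_onran s c : cspecial c = true ->
  (special (ran c) = true -> special (s (ran c)) = true) -> cspecial (onran s c) = true.
Proof.
  unfold cspecial, onran; simpl. intros H H1. apply orb_true_iff in H. apply orb_true_iff.
  tauto.
Qed.

Lemma cspecial_false_unit c : cspecial c = false -> c = unit (num (dom c)) (num (ran c)) /\
  num (dom c) <> 0%Z /\ num (ran c) <> 0%Z.
Proof.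
  unfold cspecial, special. intros H.
  apply orb_false_iff in H as [H1 H2]. apply orb_false_iff in H1 as [H1 H3].
  apply orb_false_iff in H2 as [H2 H4].
  apply Nat.ltb_ge in H1, H2. apply Z.eqb_neq in H3, H4.
  split; auto. apply plain_unit; lia.
Qed.

(** * The action of the generators on states *)

Lemma rep_split f l i j i' j' z : rep f l i j i' j' -> (j <= z < j')%Z ->
  exists A c B, l = A ++ c :: B /\
    num (ran c) = (z * P (dep (ran c)))%Z /\
    Forall (fun e => (num (ran e) + 1 <= z * P (dep (ran e)))%Z) A /\
    Forall (fun e => (z * P (dep (ran e)) < num (ran e))%Z) B /\
    ((j < z)%Z -> A <> []).
Proof.
  intros (C & _) [H1 H2]. apply IZR_lt in H2.
  destruct (chain_split_ran _ _ _ _ _ z C H1 H2) as (A & c & B & -> & E & CA & CB).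
  exists A, c, B. split; auto. split; [now apply dl_eq_int|]. split; [|split].
  - apply chain_bounds in CA as (_ & _ & F). eapply Forall_impl; [|exact F].
    simpl. intros e He. apply dr_le_int. lra.
  - pose proof (dl_lt_dr (ran c)).
    apply chain_bounds in CB as (_ & _ & F). eapply Forall_impl; [|exact F].
    simpl. intros e He. apply Z.lt_nge. intros N. apply dl_le_int in N. lra.
  - intros L ->. destruct CA as [_ CA]. apply eq_IZR in CA. lia.
Qed.

Lemma rep_split_tail f l i j i' j' z : rep f l i j i' j' -> (j < z < j')%Z ->
  exists a A c B, l = (a :: A) ++ c :: B /\
    num (ran c) = (z * P (dep (ran c)))%Z /\
    Forall (fun e => (num (ran e) + 1 <= z * P (dep (ran e)))%Z) (a :: A) /\
    Forall (fun e => (z * P (dep (ran e)) < num (ran e))%Z) B.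
Proof.
  intros R [H1 H2]. destruct (rep_split _ _ _ _ _ _ z R) as (A & c & B & E & H); [lia|].
  destruct H as (Hc & HA & HB & N). destruct A as [|a A]; [now elim N|].
  exists a, A, c, B. auto.
Qed.

Lemma rep_first f c l i j i' j' : rep f (c :: l) i j i' j' ->
  num (dom c) = (i * P (dep (dom c)))%Z /\ num (ran c) = (j * P (dep (ran c)))%Z.
Proof. intros ((C1 & C2 & _) & _). split; apply dl_eq_int; auto. Qed.

Lemma rep_last f A c i j i' j' : rep f (A ++ [c]) i j i' j' ->
  (num (dom c) + 1 = i' * P (dep (dom c)))%Z /\
  (num (ran c) + 1 = j' * P (dep (ran c)))%Z.
Proof.
  intros (C & _). apply chain_app in C as (u & v & _ & C). simpl in C.
  split; apply dr_eq_int; tauto.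
Qed.

Lemma rep_link f A c c' B i j i' j' : rep f (A ++ c :: c' :: B) i j i' j' ->
  ((num (dom c) + 1) * P (dep (dom c')) = num (dom c') * P (dep (dom c)))%Z /\
  ((num (ran c) + 1) * P (dep (ran c')) = num (ran c') * P (dep (ran c)))%Z.
Proof.
  intros (C & _). apply chain_app in C as (u & v & _ & C). simpl in C.
  split; apply dr_eq_dl; symmetry; tauto.
Qed.

Lemma rep_nil f i j i' j' : rep f [] i j i' j' -> i = i' /\ j = j'.
Proof. intros ((C1 & C2) & _). split; now apply eq_IZR. Qed.

Lemma special_zero d : num d = 0%Z -> special d = true.
Proof. intros H. unfold special. rewrite H. apply orb_true_r. Qed.

Lemma special_dep d : (0 < dep d)%nat -> special d = true.
Proof. intros H. unfold special. now rewrite (proj2 (Nat.ltb_lt _ _) H). Qed.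

Lemma cspecial_ran c : special (ran c) = true -> cspecial c = true.
Proof. intros H. unfold cspecial. rewrite H. apply orb_true_r. Qed.

Lemma trimmed_map (s : col -> col) l : (forall c B, l = c :: B -> cspecial (s c) = true) ->
  (forall A c, l = A ++ [c] -> cspecial (s c) = true) -> trimmed (map s l).
Proof.
  intros H1 H2. split.
  - intros c B E. apply map_eq_cons in E as (c' & B' & E & <- & _). eauto.
  - intros A c E. apply map_eq_app in E as (A' & B' & -> & _ & E).
    apply map_eq_cons in E as (c' & B1 & -> & <- & E).
    apply map_eq_nil in E as ->. eauto.
Qed.

Lemma last_split {T} (A : list T) c B A' e : A ++ c :: B = A' ++ [e] ->
  (B = [] /\ c = e /\ A = A') \/ exists B', B = B' ++ [e].
Proof.
  destruct (exists_last (l := c :: B)) as (B1 & x & E); [discriminate|].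
  rewrite E, app_assoc. intros H. apply app_inj_tail in H as [<- ->].
  destruct B1 as [|y B1]; simpl in E; injection E as <- ->.
  - left. now rewrite app_nil_r.
  - right. eauto.
Qed.

Lemma Forall_last {T} (Q : T -> Prop) A c : Forall Q (A ++ [c]) -> Q c.
Proof. rewrite Forall_app. intros [_ H]. now inversion H. Qed.

Lemma total_tl_app a A l : total (tl ((a :: A) ++ l)) = (total A + total l)%nat.
Proof. simpl. apply total_app. Qed.

Lemma tl_map {T U} (s : T -> U) l : tl (map s l) = map s (tl l).
Proof. now destruct l. Qed.

(** * The action of [x0] and its inverse *)

Lemma rep_x0 f l i j i' j' : rep f l i j i' j' ->
  rep (fun t => x0 (f t)) (map (onran (shift (-1))) l) i (j - 1) i' (j' - 1).
Proof.
  intros R. apply (rep_move f x0 (shift (-1)) l i j i' j'); auto.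
  - apply Forall_forall. intros c _. apply follows_shift. intros. apply x0_shift.
  - intros t _. unfold x0. rewrite minus_IZR. lra.
  - intros t _. unfold x0. rewrite minus_IZR. lra.
Qed.

Lemma rep_x0inv f l i j i' j' : rep f l i j i' j' ->
  rep (fun t => x0inv (f t)) (map (onran (shift 1)) l) i (j + 1) i' (j' + 1).
Proof.
  intros R. apply (rep_move f x0inv (shift 1) l i j i' j'); auto.
  - apply Forall_forall. intros c _. apply follows_shift. intros. apply x0inv_shift.
  - intros t _. unfold x0inv. rewrite plus_IZR. lra.
  - intros t _. unfold x0inv. rewrite plus_IZR. lra.
Qed.

Lemma red_shift z l : red l -> red (map (onran (shift z)) l).
Proof. apply red_map. intros c c' _. apply opp_shift. Qed.

Lemma rep_bounds f l i j i' j' : rep f l i j i' j' ->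
  Forall (fun c => i * P (dep (dom c)) <= num (dom c) /\
                   num (dom c) + 1 <= i' * P (dep (dom c)) /\
                   j * P (dep (ran c)) <= num (ran c) /\
                   num (ran c) + 1 <= j' * P (dep (ran c)))%Z l.
Proof.
  intros (C & _). apply chain_bounds in C as (_ & _ & F).
  eapply Forall_impl; [|exact F]. simpl. intros c H.
  rewrite <- !int_le_dl, <- !dr_le_int. tauto.
Qed.

(** Depth is preserved and the bottom forest does not move, so a column can leave the support only
    if the top pointer alone had put it there. *)
Lemma cspecial_shift z c : cspecial c = true ->
  cspecial (onran (shift z) c) = true \/ c = unit (num (dom c)) 0 /\ num (dom c) <> 0%Z.
Proof.
  intros H. destruct (cspecial (onran (shift z) c)) eqn:E; auto. right.
  apply cspecial_false_unit in E as (E & N & _).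
  unfold onran in *; cbn [dom ran] in *. split; auto.
  destruct c as [d [b m]]. unfold shift, unit in *; cbn [dom ran num dep] in *.
  injection E as E E1. subst m. f_equal; auto. f_equal.
  unfold cspecial in H. simpl in H. apply orb_true_iff in H as [H|H].
  - unfold special in H. rewrite E in H. simpl in H. apply Z.eqb_eq in H. contradiction.
  - unfold special in H. simpl in H. now apply Z.eqb_eq.
Qed.

(** Exterior spaces here sit at integers at most 0 and stay left of the pointer; all others lie
    inside a tree. *)
Lemma W_x0_below c : (num (ran c) + 1 <= 1 * P (dep (ran c)))%Z ->
  W (onran (shift (-1)) c) = W c.
Proof.
  intros H. pose proof (P_pos (dep (ran c))). destruct (Z_le_gt_dec (num (ran c)) 0).
  - apply W_shift_neg; lia.
  - apply W_shift_inner, whole_false with 0%Z. lia.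
Qed.

Lemma W_x0_above c : (1 * P (dep (ran c)) < num (ran c))%Z ->
  W (onran (shift (-1)) c) = W c.
Proof. intros H. pose proof (P_pos (dep (ran c))). apply W_shift_pos; lia. Qed.

Lemma W_x0inv_below c : (num (ran c) + 1 <= 0 * P (dep (ran c)))%Z ->
  W (onran (shift 1) c) = W c.
Proof.
  intros H. pose proof (P_pos (dep (ran c))).
  destruct (Z_le_gt_dec (num (ran c)) (- P (dep (ran c)))).
  - apply W_shift_neg; lia.
  - apply W_shift_inner, whole_false with (-1)%Z. lia.
Qed.

Lemma W_x0inv_above c : (0 * P (dep (ran c)) < num (ran c))%Z ->
  W (onran (shift 1) c) = W c.
Proof. intros H. pose proof (P_pos (dep (ran c))). apply W_shift_pos; lia. Qed.

Lemma W_LR a b : (0 < a)%Z -> (b <= 0)%Z -> W (unit a b) = 1%nat.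
Proof.
  intros Ha Hb. unfold W, unit, inner; cbn [dom ran].
  rewrite !whole_dep0 by auto.
  rewrite (lab_LL (Dint b 0) b), (lab_pos (Dint a 0) a) by (cbn [num dep]; rewrite ?P_0; lia).
  reflexivity.
Qed.

(** The top label is R or N, and the weights of [(R, L)] and [(N, L)] are both one. *)
Lemma W_RL c z : (num (dom c) = z * P (dep (dom c)))%Z -> (z <= 0)%Z ->
  num (ran c) = P (dep (ran c)) -> W c = 1%nat.
Proof.
  intros H1 H2 H3. unfold W, inner.
  rewrite (whole_true _ z H1), (whole_true (ran c) 1), (lab_LL _ z H1 H2),
    (lab_pos (ran c) 1) by lia.
  now destruct (dep (ran c) =? 0)%nat.
Qed.

Lemma cspecial_unit a b : a <> 0%Z -> b <> 0%Z -> cspecial (unit a b) = false.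
Proof.
  intros Ha Hb. unfold cspecial, special; simpl.
  now rewrite (proj2 (Z.eqb_neq _ _) Ha), (proj2 (Z.eqb_neq _ _) Hb).
Qed.

(** The pointer leaves the last top tree of the window, so the support grows by one trivial column.
    Its space has labels [(L, R)] and weight one. *)
Lemma state_x0_end f l i j i' : state f l i j i' 1 ->
  ell (fun t => x0 (f t)) (S (total (tl l))).
Proof.
  intros (R & Hr & (T1 & T2) & Hi & Hj).
  destruct l as [|a A]. { apply rep_nil in R. lia. }
  exists (map (onran (shift (-1))) ((a :: A) ++ [unit i' 1])), i, (j - 1)%Z, (i' + 1)%Z, 1%Z.
  split; [split; [|split; [|split; [|lia]]]|].
  - pose proof (rep_x0 _ _ _ _ _ _ (rep_grow_right _ _ _ _ _ _ R)) as R'. exact R'.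
  - apply red_shift, red_snoc_unit, Hr.
  - apply trimmed_map.
    + intros c B E. injection E as -> E.
      destruct (cspecial_shift (-1) c (T1 _ _ eq_refl)) as [Hs|[Hs N]]; auto.
      (* If the first column lost its specialness, it would be trivial, over a negative bottom tree,
         and would reach the end 1 of the range. It would then be the whole list, which misses the
         bottom pointer. *)
      exfalso. pose proof R as R1. rewrite Hs in R1.
      apply rep_drop_left in R1 as (E1 & E2 & R1).
      destruct A as [|a' A].
      * apply rep_nil in R1. lia.
      * apply rep_bounds in R1. inversion_clear R1. pose proof (P_pos (dep (ran a'))).
        subst j. lia.
    + intros A' c E. apply app_inj_tail in E as [_ <-]. now apply cspecial_ran.
  - cbn [app tl map]. rewrite map_app, total_app, total_map.
    + cbn [map]. rewrite total_cons.
      change (onran (shift (-1)) (unit i' 1)) with (unit i' 0).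
      rewrite W_LR by lia. unfold total at 3. simpl. lia.
    + apply rep_bounds in R. inversion_clear R. eapply Forall_impl; [|exact H0].
      simpl. intros c Hc. apply W_x0_below. tauto.
Qed.

(** Among the columns that remain, only [c], whose range starts at 1, sees its label change. When
    [a] is no longer special it is followed directly by [c], and the space between them leaves the
    support. *)
Lemma state_x0_mid f l i j i' j' : state f l i j i' j' -> (1 < j')%Z ->
  exists a A c B, l = (a :: A) ++ c :: B /\
    num (ran c) = P (dep (ran c)) /\
    exists n, ell (fun t => x0 (f t)) n /\
    (cspecial (onran (shift (-1)) a) = true ->
      (n + W c = total (tl l) + W (onran (shift (-1)) c))%nat) /\
    (cspecial (onran (shift (-1)) a) = false -> total (tl l) = S n).
Proof.
  intros (R & Hr & (T1 & T2) & Hi & Hj) Hj'.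
  destruct (rep_split_tail _ _ _ _ _ _ 1 R) as (a & A & c & B & -> & Hc & HA & HB); [lia|].
  exists a, A, c, B. split; auto. split; [lia|].
  pose proof (rep_x0 _ _ _ _ _ _ R) as R'.
  set (s := onran (shift (-1))) in *.
  assert (Hlast : forall A' e, c :: B = A' ++ [e] -> cspecial (s e) = true).
  { intros A' e E. assert (Hs : cspecial e = true).
    { apply (T2 ((a :: A) ++ A')). now rewrite <- app_assoc, E. }
    apply (last_split []) in E as [(-> & -> & _)|[B' ->]].
    - apply cspecial_ran, special_zero. unfold s, onran, shift; cbn [ran num]. lia.
    - apply Forall_last in HB. destruct (cspecial_shift (-1) e Hs) as [H|[H N]]; auto.
      rewrite H in HB. simpl in HB. lia. }
  assert (Hsum : forall l', Forall (fun e => num (ran e) + 1 <= 1 * P (dep (ran e)))%Z l' ->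
     total (map s l') = total l').
  { intros l' H. apply total_map. eapply Forall_impl; [|exact H]. apply W_x0_below. }
  assert (HsumB : total (map s B) = total B).
  { apply total_map. eapply Forall_impl; [|exact HB]. apply W_x0_above. }
  destruct (cspecial_shift (-1) a (T1 _ _ eq_refl)) as [Ha|[Ha N]].
  - exists (total (tl (map s ((a :: A) ++ c :: B)))). split; [|split].
    + do 5 eexists. split; [|reflexivity]. split; [exact R'|].
      split; [now apply red_shift|]. split; [|lia]. apply trimmed_map.
      * intros e B' E. injection E as <- _. exact Ha.
      * intros A' e E. apply last_split in E as [(-> & -> & _)|[B' ->]].
        -- now apply (Hlast []).
        -- now apply (Hlast (c :: B')).
    + intros _. rewrite tl_map, !total_tl_app. cbn [app tl map].
      rewrite map_app, total_app. cbn [map]. rewrite !total_cons, HsumB, Hsum.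
      * lia.
      * now inversion HA.
    + fold s in Ha. congruence.
  - pose proof R as R1. rewrite Ha in R1. apply rep_drop_left in R1 as (E1 & E2 & R1).
    subst j. destruct A as [|a' A].
    2:{ exfalso. apply rep_bounds in R1. inversion_clear R1. inversion_clear HA.
        inversion_clear H2. pose proof (P_pos (dep (ran a'))). lia. }
    cbn [app] in R1. apply rep_x0 in R1. fold s in R1.
    exists (total (tl (map s (c :: B)))). split; [|split].
    + do 5 eexists. split; [|reflexivity]. split; [exact R1|].
      split; [now apply red_shift, (red_cons a)|]. split; [|lia]. apply trimmed_map.
      * intros e B' E. injection E as <- _.
        apply cspecial_ran, special_zero. unfold s, onran, shift; cbn [ran num]. lia.
      * exact Hlast.
    + intros H. unfold s in H. rewrite Ha in H.
      change (cspecial (unit (num (dom a)) (-1)) = true) in H.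
      rewrite cspecial_unit in H by lia. discriminate.
    + intros _. rewrite tl_map. cbn [app tl]. rewrite total_cons, HsumB.
      (* The dropped column lies over a negative bottom tree, so the domain of [c] starts at
         [i + 1], which is at most zero: the lost space has weight one. *)
      rewrite (W_RL c (i + 1)); [lia| |lia|lia].
      now apply rep_first in R1 as [L _].
Qed.

(** The pointer leaves the first top tree of the window, so a trivial column is added on the left.
    The new space is the one before the old first column; its bottom label is L, its top label R or
    N. *)
Lemma state_x0inv_end f l i i' j' : state f l i 0 i' j' ->
  ell (fun t => x0inv (f t)) (S (total (tl l))).
Proof.
  intros (R & Hr & (T1 & T2) & Hi & Hj).
  destruct l as [|a A]. { apply rep_nil in R. lia. }
  exists (map (onran (shift 1)) (unit (i - 1) (-1) :: a :: A)), (i - 1)%Z, 0%Z, i', (j' + 1)%Z.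
  split; [split; [|split; [|split; [|lia]]]|].
  - exact (rep_x0inv _ _ _ _ _ _ (rep_grow_left _ _ _ _ _ _ R)).
  - apply red_shift, red_cons_unit, Hr.
  - apply trimmed_map.
    + intros c B E. injection E as <- E. now apply cspecial_ran.
    + intros A' c E. apply (last_split []) in E as [(E & _ & _)|[B' E]]; [discriminate|].
      destruct (cspecial_shift 1 c (T2 _ _ E)) as [Hs|[Hs N]]; auto.
      exfalso. pose proof R as R1. rewrite E, Hs in R1.
      apply rep_drop_right in R1 as (E1 & E2 & R1).
      destruct B' as [|b' B'].
      * apply rep_nil in R1. lia.
      * apply rep_bounds in R1. inversion_clear R1. pose proof (P_pos (dep (ran b'))).
        lia.
  - pose proof (rep_first _ _ _ _ _ _ _ R) as [F1 F2].
    pose proof R as R1. apply (rep_split _ _ _ _ _ _ 0) in R1; [|lia].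
    destruct R1 as (A' & c & B & E & Hc & HA & HB & _).
    destruct A' as [|a' A'].
    2:{ injection E as <- _. inversion_clear HA. lia. }
    injection E as <- <-. cbn [map tl]. rewrite total_cons, total_map.
    + rewrite (W_RL _ i); [lia|exact F1|lia|]. unfold onran, shift; cbn [ran num dep]. lia.
    + eapply Forall_impl; [|exact HB]. apply W_x0inv_above.
Qed.

(** Now the support can shrink at its right end: the last column may have been there for the top
    pointer alone. Its space had labels [(L, R)], hence weight one. *)
Lemma state_x0inv_mid f l i j i' j' : state f l i j i' j' -> (j < 0)%Z ->
  exists a A c B, l = (a :: A) ++ c :: B /\
    num (ran c) = 0%Z /\
    exists n, ell (fun t => x0inv (f t)) n /\
    ((forall A' e, l = A' ++ [e] -> cspecial (onran (shift 1) e) = true) ->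
      (n + W c = total (tl l) + W (onran (shift 1) c))%nat) /\
    ((exists A' e, l = A' ++ [e] /\ cspecial (onran (shift 1) e) = false) ->
      total (tl l) = S n).
Proof.
  intros (R & Hr & (T1 & T2) & Hi & Hj) Hj'.
  destruct (rep_split_tail _ _ _ _ _ _ 0 R) as (a & A & c & B & -> & Hc & HA & HB); [lia|].
  exists a, A, c, B. split; auto. split; [lia|].
  pose proof (rep_x0inv _ _ _ _ _ _ R) as R'.
  set (s := onran (shift 1)) in *.
  assert (Hfirst : cspecial (s a) = true).
  { destruct (cspecial_shift 1 a (T1 _ _ eq_refl)) as [H|[H N]]; auto.
    inversion_clear HA. rewrite H in H0. simpl in H0. lia. }
  assert (HsumA : total (map s A) = total A).
  { apply total_map. inversion_clear HA. eapply Forall_impl; [|exact H0].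
    apply W_x0inv_below. }
  assert (HsumB : forall l', Forall (fun e => 0 * P (dep (ran e)) < num (ran e))%Z l' ->
     total (map s l') = total l').
  { intros l' H. apply total_map. eapply Forall_impl; [|exact H]. apply W_x0inv_above. }
  destruct (exists_last (l := (a :: A) ++ c :: B)) as (A' & e & E); [discriminate|].
  destruct (cspecial_shift 1 e (T2 _ _ E)) as [He|[He N]].
  - exists (total (tl (map s ((a :: A) ++ c :: B)))). split; [|split].
    + do 5 eexists. split; [|reflexivity]. split; [exact R'|].
      split; [now apply red_shift|]. split; [|lia]. apply trimmed_map.
      * intros e' B' E'. injection E' as <- _. exact Hfirst.
      * intros A'' e' E'. rewrite E in E'. now apply app_inj_tail in E' as [_ <-].
    + intros _. rewrite tl_map, !total_tl_app. cbn [app tl map].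
      rewrite map_app, total_app. cbn [map]. rewrite !total_cons, HsumA, HsumB; auto.
      lia.
    + intros (A'' & e' & E' & F). rewrite E in E'.
      apply app_inj_tail in E' as [_ <-]. fold s in He. congruence.
  - pose proof R as R1. rewrite E, He in R1. apply rep_drop_right in R1 as (E1 & E2 & R1).
    assert (j' = 1)%Z by lia. subst j'.
    assert (Hlast : B = [] /\ c = e /\ a :: A = A').
    { apply last_split in E as [H|[B' ->]]; auto.
      apply Forall_last in HB. rewrite He in HB. simpl in HB. lia. }
    destruct Hlast as (-> & -> & <-). apply rep_x0inv in R1. fold s in R1.
    exists (total (tl (map s (a :: A)))). split; [|split].
    + do 5 eexists. split; [|reflexivity]. split; [exact R1|].
      split; [now eapply red_shift, red_app_l, Hr|]. split; [|lia]. apply trimmed_map.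
      * intros e' B' E'. injection E' as <- _. exact Hfirst.
      * intros A'' e' E'. apply cspecial_ran.
        rewrite E' in R1. rewrite map_app in R1. apply rep_last in R1 as [_ R1].
        fold (ran (s e')). destruct (dep (ran (s e'))) eqn:Ed.
        -- apply special_zero. rewrite P_0 in R1. lia.
        -- apply special_dep. lia.
    + intros H. specialize (H _ _ eq_refl). rewrite He in H. unfold s in H.
      change (cspecial (unit (num (dom e)) 1) = true) in H.
      rewrite cspecial_unit in H by lia. discriminate.
    + intros _. rewrite tl_map, total_tl_app. cbn [tl]. rewrite total_cons, HsumA.
      rewrite He, W_LR by lia. unfold total at 2. simpl. lia.
Qed.

(** * The action of [x1] and its inverse *)

Lemma rep_x1 f l i j i' j' : rep f l i j i' j' -> (j <= 0)%Z -> (2 <= j')%Z ->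
  rep (fun t => x1 (f t)) (map (onran join) l) i j i' (j' - 1).
Proof.
  intros R H1 H2. apply IZR_le in H1, H2. apply (rep_move f x1 join l i j i' j'); auto.
  - apply Forall_forall. intros c _. apply follows_join.
  - intros t Ht. rewrite x1_neg; lra.
  - intros t Ht. rewrite minus_IZR, x1_large; lra.
Qed.

Lemma rep_x1inv f l i j i' j' : rep f l i j i' j' -> (j <= 0)%Z -> (1 <= j')%Z ->
  Forall (fun c => joined (ran c)) l ->
  rep (fun t => x1inv (f t)) (map (onran unjoin) l) i j i' (j' + 1).
Proof.
  intros R H1 H2 J. apply IZR_le in H1, H2.
  apply (rep_move f x1inv unjoin l i j i' j'); auto.
  - eapply Forall_impl; [|exact J]. intros c. apply follows_unjoin.
  - intros t Ht. rewrite x1inv_neg; lra.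
  - intros t Ht. rewrite plus_IZR, x1inv_large; lra.
Qed.

Lemma cspecial_join c : cspecial c = true -> cspecial (onran join c) = true.
Proof. intros H. apply cspecial_onran; auto. apply special_join. Qed.

(** Against the top label L the weight only depends on whether the bottom label is L, that is, on
    the left end, which halving preserves. *)
Lemma W_half0 e : W (Col (half0 e) (Dint 0 0)) = W (Col e (Dint 0 0)).
Proof.
  unfold W; cbn [dom ran]. rewrite (lab_LL (Dint 0 0) 0) by (simpl; lia).
  assert (Hin : inner (half0 e) = inner e).
  { unfold inner. f_equal. replace (whole (half0 e)) with (whole e); auto.
    apply eq_true_iff_eq. rewrite !whole_iff. cbn [half0 num dep]. rewrite P_S.
    split; intros [z Hz]; exists z; lia. }
  rewrite Hin. f_equal. f_equal.
  assert (HL : lab (half0 e) = LL <-> lab e = LL).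
  { rewrite !lab_LL_iff. cbn [half0 num dep]. rewrite P_S.
    split; intros (z & Hz & Hz'); exists z; split; auto; lia. }
  destruct (lab (half0 e)), (lab e); auto; intuition discriminate.
Qed.

(** The labels are [(R, I)], of weight zero; the one comes from the bottom caret that joins the two
    halves. *)
Lemma W_half1 e : W (Col (half1 e) (Dint 1 0)) = 1%nat.
Proof.
  unfold W; cbn [dom ran]. rewrite (lab_pos (Dint 1 0) 1) by (cbn; lia).
  assert (Hf : whole (half1 e) = false).
  { destruct (whole (half1 e)) eqn:E; auto. apply whole_iff in E as [z Hz].
    cbn [half1 num dep] in Hz. rewrite P_S in Hz. lia. }
  rewrite lab_inner by auto. unfold inner. rewrite Hf.
  cbn [half1 num dep]. rewrite Z.add_comm, Z.even_add_mul_2. reflexivity.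
Qed.

(* The merge of the first two trees produces an opposing pair, which is then cancelled. *)
Lemma state_x1_merge f A e B i j i' j' :
  let l := A ++ Col (half0 e) (Dint 0 0) :: Col (half1 e) (Dint 1 0) :: B in
  rep f l i j i' j' -> red l -> (forall c B', l = c :: B' -> cspecial c = true) ->
  (forall A' c, l = A' ++ [c] -> cspecial (onran join c) = true) ->
  (i <= 0 < i')%Z -> (j <= 0)%Z -> (1 < j')%Z ->
  exists n, ell (fun t => x1 (f t)) n /\ total (tl l) = S n.
Proof.
  intros l R Hr T1 T2 Hi Hj Hj'.
  set (c := Col (half0 e) (Dint 0 0)) in *. set (c' := Col (half1 e) (Dint 1 0)) in *.
  set (m := Col e (Dint 0 0)).
  assert (HA : Forall (fun e => num (ran e) < 0)%Z A).
  { pose proof R as (C & _). apply chain_app in C as (u & v & C & C'). simpl in C'.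
    destruct C' as (_ & C' & _). apply chain_bounds in C as (_ & _ & F).
    eapply Forall_impl; [|exact F]. intros x Hx. cbv beta in Hx.
    assert (dr (ran x) <= IZR 0) by (rewrite <- dl_unit; lra).
    apply dr_le_int in H. lia. }
  assert (HB : Forall (fun e => 2 * P (dep (ran e)) <= num (ran e))%Z B).
  { pose proof R as (C & _). apply chain_app in C as (u & v & C & C').
    cbn [chain c c' ran dom] in C'. destruct C' as (_ & _ & _ & _ & C').
    apply chain_bounds in C' as (_ & _ & F).
    eapply Forall_impl; [|exact F]. intros x Hx. cbv beta in Hx.
    rewrite dr_unit in Hx.
    assert (IZR 2 <= dl (ran x)) by (replace (IZR 2) with (IZR 1 + 1) by lra; lra).
    now apply int_le_dl in H. }
  assert (Wm : W c = W m) by apply W_half0.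
  assert (Wc' : W c' = 1%nat) by apply W_half1.
  set (s := onran join) in *.
  assert (HsA : total (map s A) = total A).
  { apply total_map. eapply Forall_impl; [|exact HA]. intros x Hx. apply W_join.
    pose proof (P_pos (dep (ran x))). cbv beta in Hx. lia. }
  assert (HsB : total (map s B) = total B).
  { apply total_map. eapply Forall_impl; [|exact HB]. intros x Hx. apply W_join.
    pose proof (P_pos (dep (ran x))). cbv beta in Hx. lia. }
  (* The merged column has a unit range interval, so it opposes no neighbour and a single
     cancellation suffices. *)
  assert (Hred : red (map s A ++ [m] ++ map s B)).
  { intros d d' Ha Ho.
    assert (RA : red (map s A)).
    { apply red_map; [|eapply red_app_l; exact Hr]. intros x x' Hx Hox.
      apply opp_join in Hox as [Hox|(E & _)]; auto. exfalso.
      destruct Hx as (A1 & A2 & ->). apply Forall_app in HA as [_ HA].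
      inversion_clear HA. rewrite E in H. simpl in H. lia. }
    assert (RB : red (map s B)).
    { apply red_map; [|eapply (red_app_r (A ++ [c; c'])); rewrite <- app_assoc; exact Hr].
      intros x x' Hx Hox.
      apply opp_join in Hox as [Hox|(E & _)]; auto. exfalso.
      destruct Hx as (A1 & A2 & ->). apply Forall_app in HB as [_ HB].
      inversion_clear HB. rewrite E in H. simpl in H. lia. }
    apply opp_dep in Ho as Hd.
    apply adj_app in Ha as [Ha|[Ha|(A' & B' & E & E')]].
    - eapply RA; eauto.
    - simpl in Ha. apply adj_cons in Ha as [(B1 & <- & _)|Ha].
      + simpl in Hd. lia.
      + eapply RB; eauto.
    - injection E' as <- _. simpl in Hd. lia. }
  apply (rep_x1 _ _ _ _ _ _) in R; [|auto|lia]. fold s in R. unfold l in R.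
  rewrite map_app in R. cbn [map] in R.
  (* The join turns the two columns into the halves of [m]. *)
  change (s c) with (col0 m) in R. change (s c') with (col1 m) in R.
  apply rep_halves in R.
  exists (total (tl (map s A ++ m :: map s B))). split.
  - do 5 eexists. split; [|reflexivity]. split; [exact R|]. split; [exact Hred|].
    split; [split|lia].
    + intros d B' E. destruct A as [|a A].
      * injection E as <- _. now apply cspecial_ran.
      * injection E as <- _. now eapply cspecial_join, T1.
    + intros A' d E. apply last_split in E as [(_ & <- & _)|[B' E]].
      * now apply cspecial_ran.
      * destruct (exists_last (l := B)) as (B1 & x & ->).
        { intros ->. destruct B'; discriminate. }
        rewrite map_app in E. apply app_inj_tail in E as [_ <-].
        apply (T2 (A ++ c :: c' :: B1)). unfold l. now rewrite <- app_assoc.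
  - unfold l. destruct A as [|a A]; cbn [app tl map].
    + rewrite total_cons, HsB. lia.
    + rewrite !total_app. cbn [map] in HsA. rewrite !total_cons in *.
      replace (W (s a)) with (W a) in HsA; [lia|]. symmetry. apply W_join.
      inversion_clear HA. pose proof (P_pos (dep (ran a))). lia.
Qed.

(** The last column is asked to be special only after the join, so that the lemma also covers a
    window just extended by a trivial column. *)
Lemma state_x1_plain f l i j i' j' :
  rep f l i j i' j' -> red (map (onran join) l) ->
  (forall c B, l = c :: B -> cspecial c = true) ->
  (forall A c, l = A ++ [c] -> cspecial (onran join c) = true) ->
  (i <= 0 < i')%Z -> (j <= 0)%Z -> (1 < j')%Z ->
  exists a A c B, l = (a :: A) ++ c :: B /\
    num (ran c) = P (dep (ran c)) /\
    exists n, ell (fun t => x1 (f t)) n /\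
    (n + W c = total (tl l) + W (onran join c))%nat.
Proof.
  intros R Hr T1 T2 Hi Hj Hj'.
  destruct (rep_split_tail _ _ _ _ _ _ 1 R) as (a & A & c & B & -> & Hc & HA & HB); [lia|].
  exists a, A, c, B. split; auto. split; [lia|].
  apply rep_x1 in R; [|lia|lia]. set (s := onran join) in *.
  exists (total (tl (map s ((a :: A) ++ c :: B)))). split.
  - do 5 eexists. split; [|reflexivity]. split; [exact R|]. split; [exact Hr|].
    split; [|lia]. apply trimmed_map; [|exact T2].
    intros x B' E. unfold s. eapply cspecial_join, T1, E.
  - rewrite tl_map, !total_tl_app. cbn [app tl map].
    rewrite map_app, total_app. cbn [map]. rewrite !total_cons.
    rewrite (total_map s A), (total_map s B); [lia| |].
    + eapply Forall_impl; [|exact HB]. intros x Hx. apply W_join. cbv beta in Hx. lia.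
    + inversion_clear HA. eapply Forall_impl; [|exact H0]. intros x Hx. apply W_join.
      cbv beta in Hx. lia.
Qed.

(** There is no second top tree to join, so a trivial column is appended first. It becomes the right
    child of the new root, with labels [(I, R)] of weight zero and one new caret. *)
Lemma state_x1_end f l i j i' : state f l i j i' 1 ->
  ell (fun t => x1 (f t)) (S (total (tl l))).
Proof.
  intros (R & Hr & (T1 & T2) & Hi & Hj).
  destruct l as [|a0 A0]. { apply rep_nil in R. lia. }
  pose proof (rep_grow_right _ _ _ _ _ _ R) as R1.
  assert (Hred : red (map (onran join) ((a0 :: A0) ++ [unit i' 1]))).
  { apply red_map; [|now apply red_snoc_unit]. intros c c' Ha Ho.
    apply opp_join in Ho as [Ho|(E & E' & e & _ & F)]; auto. exfalso.
    apply adj_app in Ha as [Ha|[Ha|(A' & B' & _ & E1)]].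
    - destruct Ha as (A & B & Ha). rewrite Ha in R. apply rep_bounds in R.
      apply Forall_app in R as [_ R]. inversion_clear R. inversion_clear H0.
      rewrite E' in H1. simpl in H1. lia.
    - destruct Ha as ([|x [|y A]] & B & Ha); discriminate.
    - injection E1 as <- _. discriminate. }
  destruct (state_x1_plain _ _ _ _ _ _ R1 Hred) as (a & A & c & B & E & Hc & n & Hn & Hs);
    try lia.
  - intros c B E. injection E as <- _. eauto.
  - intros A c E. apply app_inj_tail in E as [_ <-]. now apply cspecial_ran.
  - assert (Hlast : B = [] /\ c = unit i' 1 /\ a :: A = a0 :: A0).
    { symmetry in E. pose proof E as E0. apply last_split in E0 as [E0|[B' ->]]; auto.
      exfalso.
      rewrite app_comm_cons, app_assoc in E. apply app_inj_tail in E as [E _].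
      rewrite <- E in R. apply rep_bounds, Forall_app in R as [_ R].
      inversion_clear R. lia. }
    destruct Hlast as (-> & -> & E'). injection E' as -> ->.
    rewrite total_tl_app, total_cons in Hs.
    replace (W (onran join (unit i' 1))) with 1%nat in Hs.
    + simpl tl. replace (S (total A0)) with n; auto. unfold total at 2 in Hs. simpl in Hs. lia.
    + unfold W, onran, inner; cbn [dom ran unit].
      rewrite (lab_pos (Dint i' 0) i'), (whole_dep0 (Dint i' 0)) by (cbn; lia). reflexivity.
Qed.

(** A new opposing pair can only arise from two trivial top trees over sibling bottom leaves;
    otherwise the joined list is still reduced. *)
Lemma state_x1_mid f l i j i' j' : state f l i j i' j' -> (1 < j')%Z ->
  (exists A e B n, l = A ++ Col (half0 e) (Dint 0 0) :: Col (half1 e) (Dint 1 0) :: B /\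
     ell (fun t => x1 (f t)) n /\ total (tl l) = S n) \/
  (red (map (onran join) l) /\
   exists a A c B n, l = (a :: A) ++ c :: B /\ num (ran c) = P (dep (ran c)) /\
     ell (fun t => x1 (f t)) n /\ (n + W c = total (tl l) + W (onran join c))%nat).
Proof.
  intros (R & Hr & (T1 & T2) & Hi & Hj) Hj'.
  assert (T2' : forall A c, l = A ++ [c] -> cspecial (onran join c) = true).
  { intros A c E. eapply cspecial_join, T2, E. }
  destruct (classic (exists A e B,
    l = A ++ Col (half0 e) (Dint 0 0) :: Col (half1 e) (Dint 1 0) :: B))
    as [(A & e & B & ->)|N].
  - left. destruct (state_x1_merge f A e B i j i' j') as (n & H); auto; try lia.
    exists A, e, B, n. auto.
  - right. assert (Hred : red (map (onran join) l)).
    { apply red_map; auto. intros c c' (A & B & E) Ho.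
      apply opp_join in Ho as [Ho|(E1 & E2 & e & E3 & E4)]; auto.
      elim N. exists A, e, B. rewrite E. destruct c, c'; simpl in *. now subst. }
    split; auto.
    destruct (state_x1_plain _ _ _ _ _ _ R Hred T1 T2') as (a & A & c & B & H & H1 & n & H2);
      try lia.
    exists a, A, c, B, n. tauto.
Qed.

(** A trivial pointer tree has no root caret to remove, so an opposing pair is inserted and its top
    caret removed. What remains is one new bottom caret, whose space has labels [(R, I)]. *)
Lemma state_x1inv_split f A d B i j i' j' :
  state f (A ++ Col d (Dint 0 0) :: B) i j i' j' ->
  ell (fun t => x1inv (f t)) (S (total (tl (A ++ Col d (Dint 0 0) :: B)))).
Proof.
  intros (R & Hr & (T1 & T2) & Hi & Hj). set (m := Col d (Dint 0 0)) in *.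
  assert (HA : Forall (fun e => num (ran e) < 0)%Z A).
  { pose proof R as (C & _). apply chain_app in C as (u & v & C & C'). simpl in C'.
    destruct C' as (_ & C' & _). apply chain_bounds in C as (_ & _ & F).
    eapply Forall_impl; [|exact F]. intros x Hx. cbv beta in Hx.
    assert (dr (ran x) <= IZR 0) by (rewrite <- dl_unit; lra).
    apply dr_le_int in H. lia. }
  assert (HB : Forall (fun e => P (dep (ran e)) <= num (ran e))%Z B).
  { pose proof R as (C & _). apply chain_app in C as (u & v & C & C').
    cbn [chain m ran dom] in C'. destruct C' as (_ & _ & C').
    apply chain_bounds in C' as (_ & _ & F).
    eapply Forall_impl; [|exact F]. intros x Hx. cbv beta in Hx.
    rewrite dr_unit in Hx. assert (IZR 1 <= dl (ran x)) by lra.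
    apply int_le_dl in H. lia. }
  assert (JA : Forall (fun e => joined (ran e)) A).
  { eapply Forall_impl; [|exact HA]. intros x Hx. cbv beta in Hx. right. lia. }
  assert (JB : Forall (fun e => joined (ran e)) B).
  { eapply Forall_impl; [|exact HB]. intros x Hx. cbv beta in Hx. right.
    pose proof (P_pos (dep (ran x))). lia. }
  assert (RA : red A) by (eapply red_app_l; eauto).
  assert (RB : red B) by (eapply (red_app_r (A ++ [m])); rewrite <- app_assoc; eauto).
  apply rep_halves, rep_x1inv in R; try lia.
  2:{ apply Forall_app; split; auto. repeat constructor; auto; left; simpl; lia. }
  rewrite map_app in R. cbn [map] in R. set (s := onran unjoin) in *.
  assert (Hu : forall l, Forall (fun e => joined (ran e)) l -> red l -> red (map s l)).
  { intros l Hl Hrl. apply red_map; auto. intros c c' (A1 & B1 & ->).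
    apply Forall_app in Hl as [_ Hl]. inversion_clear Hl. inversion_clear H0.
    apply opp_unjoin; auto. }
  change (s (col0 m)) with (Col (half0 d) (Dint 0 0)) in R.
  change (s (col1 m)) with (Col (half1 d) (Dint 1 0)) in R.
  set (c := Col (half0 d) (Dint 0 0)) in *. set (c' := Col (half1 d) (Dint 1 0)) in *.
  assert (Hc : dep (ran c) = 0%nat) by reflexivity.
  assert (Hc' : dep (ran c') = 0%nat) by reflexivity.
  assert (HsA : Forall (fun e => W (s e) = W e) A).
  { rewrite Forall_forall in *. intros x Hx. apply W_unjoin; auto.
    specialize (HA x Hx). unfold unjoin. ltb_cases; [|lia..].
    pose proof (P_pos (dep (ran x))). lia. }
  assert (HsB : Forall (fun e => W (s e) = W e) B).
  { rewrite Forall_forall in *. intros x Hx. apply W_unjoin; auto.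
    specialize (HB x Hx). pose proof (P_pos (dep (ran x))).
    unfold unjoin. ltb_cases; try lia. unfold shift; cbn [num dep]. lia. }
  replace (S (total (tl (A ++ m :: B)))) with (total (tl (map s A ++ c :: c' :: map s B))).
  - do 5 eexists. split; [|reflexivity]. split; [exact R|]. split; [|split; [split|lia]].
    + intros e e' Ha Ho. apply opp_dep in Ho as Hd.
      apply adj_app in Ha as [Ha|[Ha|(A' & B' & _ & E)]].
      * exact (Hu A JA RA _ _ Ha Ho).
      * apply adj_cons in Ha as [(B1 & <- & _)|Ha]; [lia|].
        apply adj_cons in Ha as [(B1 & <- & _)|Ha]; [lia|].
        exact (Hu B JB RB _ _ Ha Ho).
      * injection E as <- _. lia.
    + intros e B' E. destruct A as [|a A].
      * injection E as <- _. now apply cspecial_ran.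
      * injection E as <- _. inversion_clear HA. inversion_clear JA.
        apply cspecial_onran; [now apply (T1 a (A ++ m :: B))|].
        intros Hs. apply special_unjoin; auto. intros E. rewrite E in H. simpl in H. lia.
    + intros A' e E. destruct B as [|b B1 _] using rev_ind.
      * change (map s A ++ [c; c'] = A' ++ [e]) in E.
        change [c; c'] with ([c] ++ [c']) in E. rewrite app_assoc in E.
        apply app_inj_tail in E as [_ <-]. reflexivity.
      * rewrite map_app, !app_comm_cons, app_assoc in E.
        apply app_inj_tail in E as [_ <-].
        apply Forall_last in HB. apply Forall_last in JB.
        apply cspecial_onran.
        -- apply (T2 (A ++ m :: B1)). now rewrite <- app_assoc.
        -- intros Hs. apply special_unjoin; auto. intros E. rewrite E in HB.
           change (2 <= 1)%Z in HB. lia.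
  - assert (Wm : W c = W m) by apply W_half0.
    assert (Wc' : W c' = 1%nat) by apply W_half1.
    destruct A as [|a A]; cbn [app tl map].
    + rewrite total_cons, total_map by auto. lia.
    + inversion_clear HsA. rewrite !total_app, !total_cons, !total_map by auto. lia.
Qed.

(** The root caret of the pointer tree is removed, and [c] starts its right subtree. If the last
    column leaves the support, its space had labels [(I, R)]: weight zero plus the removed caret. *)
Lemma state_x1inv_joined f l i j i' j' : state f l i j i' j' ->
  Forall (fun c => joined (ran c)) l ->
  exists a A c B, l = (a :: A) ++ c :: B /\
    num (unjoin (ran c)) = P (dep (unjoin (ran c))) /\
    exists n, ell (fun t => x1inv (f t)) n /\
    ((forall A' e, l = A' ++ [e] -> cspecial (onran unjoin e) = true) ->
      (n + W c = total (tl l) + W (onran unjoin c))%nat) /\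
    ((exists A' e, l = A' ++ [e] /\ cspecial (onran unjoin e) = false) ->
      total (tl l) = S n).
Proof.
  intros (R & Hr & (T1 & T2) & Hi & Hj) J.
  pose proof (rep_x1inv _ _ _ _ _ _ R) as R'. specialize (R' ltac:(lia) ltac:(lia) J).
  set (s := onran unjoin) in *.
  destruct (rep_split_tail _ _ _ _ _ _ 1 R') as (a' & A' & c' & B' & E & Hc & HA & HB); [lia|].
  apply map_eq_app in E as (A1 & B1 & -> & EA & EB).
  apply map_eq_cons in EA as (a & A & -> & <- & <-).
  apply map_eq_cons in EB as (c & B & -> & <- & <-).
  exists a, A, c, B. split; auto. cbn [s onran ran] in Hc. split; [lia|].
  assert (JA : Forall (fun e => joined (ran e)) A).
  { apply Forall_app in J as [J _]. now inversion J. }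
  assert (JB : Forall (fun e => joined (ran e)) B).
  { apply Forall_app in J as [_ J]. now inversion J. }
  assert (HsA : total (map s A) = total A).
  { apply total_map. inversion_clear HA.
    rewrite Forall_forall in *. intros x Hx. apply W_unjoin; auto.
    specialize (H0 _ (in_map s _ _ Hx)). cbn [s onran ran] in H0. lia. }
  assert (HsB : total (map s B) = total B).
  { apply total_map.
    rewrite Forall_forall in *. intros x Hx. apply W_unjoin; auto.
    specialize (HB _ (in_map s _ _ Hx)). cbn [s onran ran] in HB. lia. }
  assert (Hu : forall l, Forall (fun e => joined (ran e)) l -> red l -> red (map s l)).
  { intros l Hl Hrl. apply red_map; auto. intros x x' (A1 & B1 & ->).
    apply Forall_app in Hl as [_ Hl]. inversion_clear Hl. inversion_clear H0.
    apply opp_unjoin; auto. }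
  assert (Hfirst : cspecial (s a) = true).
  { pose proof (T1 _ _ eq_refl) as Ha. apply cspecial_onran; auto.
    intros Hs. apply special_unjoin; auto.
    - apply Forall_app in J as [J _]. now inversion J.
    - intros E. pose proof (rep_first _ _ _ _ _ _ _ R) as [_ F]. rewrite E in F.
      cbn [num dep] in F. change (P 1) with 2%Z in F. lia. }
  destruct (exists_last (l := (a :: A) ++ c :: B)) as (A' & e & E); [discriminate|].
  destruct (cspecial (s e)) eqn:He.
  - exists (total (tl (map s ((a :: A) ++ c :: B)))). split; [|split].
    + do 5 eexists. split; [|reflexivity]. split; [exact R'|].
      split; [now apply Hu|]. split; [|lia]. apply trimmed_map.
      * intros e' B' E'. injection E' as <- _. exact Hfirst.
      * intros A'' e' E'. rewrite E in E'. now apply app_inj_tail in E' as [_ <-].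
    + intros _. rewrite tl_map, !total_tl_app. cbn [app tl map].
      rewrite map_app, total_app. cbn [map]. rewrite !total_cons, HsA, HsB. lia.
    + intros (A'' & e' & E' & F). rewrite E in E'.
      apply app_inj_tail in E' as [_ <-]. congruence.
  - pose proof (T2 _ _ E) as Hs. apply cspecial_false_unit in He as (Eu & N1 & N2).
    assert (Je : joined (ran e)) by (rewrite E in J; now apply Forall_last in J).
    (* Any other range interval would have kept the column special. *)
    assert (Ee : ran e = Dint 1 1).
    { apply NNPP. intros N. assert (F : cspecial (s e) = true).
      { apply cspecial_onran; auto. intros H. now apply special_unjoin. }
      rewrite Eu, cspecial_unit in F by auto. discriminate. }
    assert (Es : s e = unit (num (dom e)) 1).
    { rewrite Eu. unfold s, onran; cbn [dom ran]. now rewrite Ee. }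
    assert (Hlast : B = [] /\ c = e /\ a :: A = A').
    { apply last_split in E as [H|[B' ->]]; auto. rewrite map_app in HB.
      apply Forall_last in HB. rewrite Es in HB. simpl in HB. lia. }
    destruct Hlast as (-> & -> & <-).
    pose proof R' as R1. rewrite map_app in R1. cbn [map] in R1. rewrite Es in R1.
    apply rep_drop_right in R1 as (E1 & E2 & R1).
    change (num (dom (s e))) with (num (dom e)) in N1.
    exists (total (tl (map s (a :: A)))). split; [|split].
    + do 5 eexists. split; [|reflexivity]. split; [exact R1|].
      split; [|split; [|lia]].
      { apply Hu; [now apply Forall_app in J|]. eapply red_app_l, Hr. }
      apply trimmed_map.
      * intros e' B' E'. injection E' as <- _. exact Hfirst.
      * intros A'' e' E'. apply cspecial_ran.
        change (s a :: map s A) with (map s (a :: A)) in R1.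
        rewrite E', map_app in R1. apply rep_last in R1 as [_ R1].
        fold (ran (s e')). rewrite <- E2 in R1. destruct (dep (ran (s e'))) eqn:Ed.
        -- apply special_zero. rewrite P_0 in R1. lia.
        -- apply special_dep. lia.
    + intros H. specialize (H _ _ eq_refl). rewrite Es, cspecial_unit in H by lia.
      discriminate.
    + intros _. rewrite tl_map, total_tl_app. cbn [tl]. rewrite total_cons, HsA.
      replace (W e) with 1%nat; [unfold total at 2; simpl; lia|].
      assert (Ed : dom e = Dint (i' - 1) 0).
      { apply (f_equal dom) in Es. cbn [unit dom s onran] in Es. now rewrite Es, E1. }
      unfold W, inner. rewrite Ee, Ed.
      rewrite (lab_pos (Dint (i' - 1) 0) (i' - 1)), (whole_dep0 (Dint (i' - 1) 0))
        by (cbn [num dep]; rewrite ?P_0; lia).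
      reflexivity.
Qed.

(** * Word length *)

(** Range left ends increase strictly along the list. This identifies columns that come from
    separate splittings of one list. *)
Lemma chain_ran_inj x y l x' y' c c' : chain x y l x' y' -> In c l -> In c' l ->
  dl (ran c) = dl (ran c') -> c = c'.
Proof.
  revert x y. induction l as [|e l IH]; simpl; intros x y H Hc Hc' E; [easy|].
  destruct H as (H1 & H2 & H). pose proof (dl_lt_dr (ran e)).
  pose proof (chain_bounds _ _ _ _ _ H) as (_ & _ & F). rewrite Forall_forall in F.
  destruct Hc as [<-|Hc], Hc' as [<-|Hc']; auto.
  - apply F in Hc'. lra.
  - apply F in Hc. lra.
  - eapply IH; eauto.
Qed.

Lemma rep_ran_inj f l i j i' j' z c c' : rep f l i j i' j' -> In c l -> In c' l ->
  num (ran c) = (z * P (dep (ran c)))%Z -> num (ran c') = (z * P (dep (ran c')))%Z ->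
  c = c'.
Proof.
  intros (C & _) H H' E E'. apply dl_eq_int in E, E'.
  eapply chain_ran_inj; eauto. congruence.
Qed.

Lemma rep_before f a A c B i j i' j' z : rep f ((a :: A) ++ c :: B) i j i' j' ->
  num (ran c) = (z * P (dep (ran c)))%Z -> (j < z)%Z.
Proof.
  intros (C & _) E. apply dl_eq_int in E. apply chain_app in C as (u & v & C & C').
  destruct C' as (_ & C' & _). destruct C as (_ & C1 & C).
  apply chain_bounds in C as (_ & C & _). pose proof (dl_lt_dr (ran a)).
  apply lt_IZR. lra.
Qed.

(** An odd numerator over a power of two is in lowest terms, so any equal fraction has at least that
    denominator. *)
Lemma odd_dep_le a k b m : Z.odd a = true -> (a * P k = b * P m)%Z -> (m <= k)%nat.
Proof.
  intros H E. apply Nat.nlt_ge. intros L.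
  assert (F : P m = (P (m - k) * P k)%Z).
  { unfold P. rewrite <- Z.pow_add_r by lia. f_equal. lia. }
  rewrite F in E. destruct (m - k)%nat as [|r] eqn:D; [lia|]. rewrite P_S in E.
  pose proof (P_pos k).
  assert (a = 2 * (b * P r))%Z by (apply (Z.mul_reg_r _ _ (P k)); lia).
  subst a. rewrite Z.odd_mul in H. discriminate.
Qed.

Lemma siblings d d' :
  ((num d + 1) * P (dep d') = num d' * P (dep d))%Z ->
  Z.even (num d) = true -> (0 < dep d)%nat -> dep d = dep d' ->
  exists e, d = half0 e /\ d' = half1 e.
Proof.
  destruct d as [b m], d' as [b' m']; cbn [num dep]. intros E He Hm <-.
  apply Z.mul_reg_r in E; [|pose proof (P_pos m); lia].
  apply Z.even_spec in He as [q Hq]. destruct m as [|m]; [lia|].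
  exists (Dint q m). unfold half0, half1; cbn [num dep]. split; f_equal; lia.
Qed.

Lemma lab_RR_or_NN d z : num d = (z * P (dep d))%Z -> (0 < z)%Z ->
  dep d = 0%nat /\ lab d = RR \/ (0 < dep d)%nat /\ lab d = NN.
Proof.
  intros H Hz. rewrite (lab_pos d z H Hz). destruct (dep d); simpl; auto.
  right. split; auto. lia.
Qed.

Lemma W_whole c z : num (ran c) = (z * P (dep (ran c)))%Z ->
  W c = (weight (lab (ran c)) (lab (dom c)) + inner (dom c))%nat.
Proof. intros H. unfold W, inner at 1. rewrite (whole_true _ z H). lia. Qed.

Lemma W_x0_pointer c : num (ran c) = P (dep (ran c)) ->
  W (onran (shift (-1)) c) = (weight LL (lab (dom c)) + inner (dom c))%nat.
Proof.
  intros H. rewrite (W_whole _ 0).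
  - unfold onran at 1; cbn [ran]. rewrite (lab_LL _ 0); auto; try lia.
    unfold shift; cbn [num dep]. lia.
  - unfold onran, shift; cbn [ran num dep]. lia.
Qed.

Lemma W_x0inv_pointer c : num (ran c) = 0%Z ->
  W (onran (shift 1) c) =
    (weight (if (dep (ran c) =? 0)%nat then RR else NN) (lab (dom c)) + inner (dom c))%nat.
Proof.
  intros H. rewrite (W_whole _ 1).
  - unfold onran at 1; cbn [ran]. rewrite (lab_pos _ 1); auto; try lia.
    unfold shift; cbn [num dep]. lia.
  - unfold onran, shift; cbn [ran num dep]. lia.
Qed.

Lemma W_x1_pointer c : num (ran c) = P (dep (ran c)) ->
  W (onran join c) =
    (weight (if (dep (ran c) =? 0)%nat then II else NN) (lab (dom c)) + 1 + inner (dom c))%nat.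
Proof.
  intros H. unfold W, onran; cbn [dom ran]. unfold join. pose proof (P_pos (dep (ran c))).
  ltb_cases; try lia.
  assert (F : whole (Dint (num (ran c)) (S (dep (ran c)))) = false).
  { apply whole_false with 0%Z. cbn [num dep]. rewrite P_S. lia. }
  rewrite lab_inner by auto. unfold inner at 1. rewrite F. cbn [num]. rewrite H.
  destruct (dep (ran c)) as [|m]; [reflexivity|].
  rewrite <- (Z.mul_1_l (P (S m))), even_mulP by lia. reflexivity.
Qed.

Lemma W_x1inv_pointer c : joined (ran c) ->
  num (unjoin (ran c)) = P (dep (unjoin (ran c))) ->
  let m := dep (unjoin (ran c)) in
  W c = (weight (if (m =? 0)%nat then II else NN) (lab (dom c)) + 1 + inner (dom c))%nat /\
  W (onran unjoin c) =
    (weight (if (m =? 0)%nat then RR else NN) (lab (dom c)) + inner (dom c))%nat.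
Proof.
  intros J H m. split.
  - pose proof (W_x1_pointer (onran unjoin c) H) as E. unfold onran in E; cbn [dom ran] in E.
    rewrite join_unjoin in E by auto. now destruct c.
  - rewrite (W_whole _ 1) by (unfold onran; cbn [ran]; lia). unfold onran; cbn [dom ran].
    rewrite (lab_pos _ 1) by lia. reflexivity.
Qed.

Lemma joined_or_split l :
  Forall (fun c => joined (ran c)) l \/ exists A d B, l = A ++ Col d (Dint 0 0) :: B.
Proof.
  induction l as [|c l IH]; auto. destruct (joined_dec (ran c)) as [J|J].
  - destruct IH as [IH|(A & d & B & ->)]; auto. right. exists (c :: A), d, B. auto.
  - right. exists [], (dom c), l. rewrite <- J. now destruct c.
Qed.

Lemma last_cases (s : col -> col) l :
  (exists A e, l = A ++ [e] /\ cspecial (s e) = false) \/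
  (forall A e, l = A ++ [e] -> cspecial (s e) = true).
Proof.
  destruct (classic (exists A e, l = A ++ [e] /\ cspecial (s e) = false)) as [H|H]; auto.
  right. intros A e E. destruct (cspecial (s e)) eqn:Es; auto. elim H. eauto.
Qed.

Definition inv (g : letter) : letter :=
  match g with X0 => X0inv | X0inv => X0 | X1 => X1inv | X1inv => X1 end.

Lemma x1_x1inv t : x1 (x1inv t) = t.
Proof.
  unfold x1, x1inv. destruct (Rle_dec t 0), (Rle_dec t 1);
    repeat match goal with |- context [Rle_dec ?a ?b] => destruct (Rle_dec a b) end; lra.
Qed.

Lemma x1inv_x1 t : x1inv (x1 t) = t.
Proof.
  unfold x1, x1inv. destruct (Rle_dec t 0), (Rle_dec t 2);
    repeat match goal with |- context [Rle_dec ?a ?b] => destruct (Rle_dec a b) end; lra.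
Qed.

Lemma inv_letter g t : letter_fun (inv g) (letter_fun g t) = t.
Proof.
  destruct g; simpl; try apply x1_x1inv; try apply x1inv_x1; unfold x0, x0inv; lra.
Qed.

(** A change of the support, a cancellation or an insertion costs exactly one. In the remaining
    cases two entries of the weight table with the same bottom label are compared, and with the
    created or removed caret they differ by at most one. *)
Lemma ell_letter f n g : ell f n ->
  exists n', ell (fun t => letter_fun g (f t)) n' /\ (n <= S n')%nat.
Proof.
  intros (l & i & j & i' & j' & S & ->). destruct g; simpl letter_fun.
  - pose proof S as (_ & _ & _ & _ & Hj). destruct (Z.eq_dec j' 1) as [->|N].
    { eexists. split; [eapply state_x0_end; eauto|lia]. }
    destruct (state_x0_mid _ _ _ _ _ _ S) as (a & A & c & B & -> & Hc & n & Hn & H1 & H2);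
      [lia|].
    exists n. split; auto. destruct (cspecial (onran (shift (-1)) a)).
    + specialize (H1 eq_refl). rewrite (W_whole c 1), W_x0_pointer in H1 by lia.
      destruct (lab (ran c)), (lab (dom c)); cbn [weight Nat.eqb] in H1; lia.
    + specialize (H2 eq_refl). lia.
  - pose proof S as (_ & _ & _ & _ & Hj). destruct (Z.eq_dec j 0) as [->|N].
    { eexists. split; [eapply state_x0inv_end; eauto|lia]. }
    destruct (state_x0inv_mid _ _ _ _ _ _ S) as (a & A & c & B & E & Hc & n & Hn & H1 & H2);
      [lia|].
    exists n. split; auto.
    destruct (last_cases (onran (shift 1)) l) as [H|H].
    + specialize (H2 H). lia.
    + specialize (H1 H). rewrite (W_whole c 0), W_x0inv_pointer, (lab_LL (ran c) 0) in H1 by lia.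
      destruct (dep (ran c) =? 0)%nat, (lab (dom c)); cbn [weight Nat.eqb] in H1; lia.
  - pose proof S as (_ & _ & _ & _ & Hj). destruct (Z.eq_dec j' 1) as [->|N].
    { eexists. split; [eapply state_x1_end; eauto|lia]. }
    destruct (state_x1_mid _ _ _ _ _ _ S)
      as [(A & e & B & n & _ & Hn & H)|(_ & a & A & c & B & n & E & Hc & Hn & H)];
      [lia| |]; exists n; (split; [auto|]); [lia|].
    rewrite (W_whole c 1), W_x1_pointer, (lab_pos (ran c) 1) in H by lia.
    destruct (dep (ran c) =? 0)%nat, (lab (dom c)); cbn [weight] in H; lia.
  - destruct (joined_or_split l) as [J|(A & d & B & ->)].
    + destruct (state_x1inv_joined _ _ _ _ _ _ S J)
        as (a & A & c & B & E & Hc & n & Hn & H1 & H2).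
      exists n. split; auto. destruct (last_cases (onran unjoin) l) as [H|H].
      * specialize (H2 H). lia.
      * specialize (H1 H). destruct (W_x1inv_pointer c) as [W1 W2]; auto.
        { rewrite E in J. apply Forall_app in J as [_ J]. now inversion J. }
        rewrite W1, W2 in H1.
        destruct (dep (unjoin (ran c)) =? 0)%nat, (lab (dom c)); cbn [weight Nat.eqb] in H1; lia.
    + eexists. split; [eapply state_x1inv_split; eauto|lia].
Qed.

(** * Descent to the identity *)

Lemma ell_zero_id f : state f [unit 0 0] 0 0 1 1 -> f = fun t => t.
Proof.
  intros ((_ & M & L & L') & _). apply functional_extensionality. intros t.
  destruct (Rle_dec t 0); [rewrite L; lra|]. destruct (Rle_dec 1 t); [rewrite L'; lra|].
  inversion_clear M. rewrite (maps_unit_inv _ _ _ t H); lra.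
Qed.

Definition descends (f : R -> R) (n : nat) : Prop :=
  exists g m, n = S m /\ ell (fun t => letter_fun g (f t)) m.

(** With a nontrivial pointer tree, [X1inv] saves a caret and this outweighs the change of label,
    except from [(I, R)] to [(R, R)], where the weight rises from zero to two. In that case the next
    column starts at a positive integer in both forests, so its labels are among R and N with weight
    two, and [X0] lowers it to one. *)
Lemma descent_joined f l i j i' j' : state f l i j i' j' ->
  Forall (fun c => joined (ran c)) l -> descends f (total (tl l)).
Proof.
  intros S J.
  destruct (state_x1inv_joined _ _ _ _ _ _ S J) as (a & A & c & B & E & Hc & n & Hn & H1 & H2).
  destruct (last_cases (onran unjoin) l) as [H|H].
  { exists X1inv, n. auto. }
  assert (Jc : joined (ran c)).
  { rewrite E in J. apply Forall_app in J as [_ J]. now inversion J. }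
  specialize (H1 H). destruct (W_x1inv_pointer c Jc Hc) as [W1 W2].
  rewrite W1, W2 in H1.
  (* Depth zero means that the right child of the root is a leaf, whose label goes from I to R; at
     positive depth it is N before and after. *)
  destruct (dep (unjoin (ran c)) =? 0)%nat eqn:D; [destruct (lab (dom c)) eqn:L|].
  - exists X1inv, n. cbn [weight] in H1. split; [lia|auto].
  - exists X1inv, n. cbn [weight] in H1. split; [lia|auto].
  - clear n Hn H1 H2 W1 W2. apply Nat.eqb_eq in D. rewrite D, P_0 in Hc.
    apply lab_RR_iff in L as [L1 L2].
    assert (Rc : ran c = Dint 1 1).
    { rewrite <- (join_unjoin (ran c) Jc). destruct (unjoin (ran c)) as [b m].
      simpl in Hc, D. now subst. }
    (* As the last column, [c] would lose its specialness under [X1inv], a case settled above. *)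
    destruct B as [|c1 B].
    { exfalso. specialize (H _ _ E).
      replace (onran unjoin c) with (unit (num (dom c)) 1) in H.
      - rewrite cspecial_unit in H by lia. discriminate.
      - unfold onran, unit. rewrite Rc. now rewrite (dint_unit _ L1) at 2. }
    pose proof S as (R & _). rewrite E in R.
    apply rep_link in R as R1. rewrite Rc, L1, P_0 in R1. cbn [num dep] in R1.
    change (P 1) with 2%Z in R1. destruct R1 as [D1 R1].
    assert (Hj' : (1 < j')%Z).
    { apply rep_bounds, Forall_app in R as [_ R]. inversion_clear R. inversion_clear H1.
      pose proof (P_pos (dep (ran c1))). nia. }
    destruct (state_x0_mid _ _ _ _ _ _ S Hj') as (a2 & A2 & c2 & B2 & E2 & Hc2 & n & Hn & H1 & H2).
    assert (c2 = c1).
    { destruct S as (R0 & _). eapply (rep_ran_inj _ _ _ _ _ _ 1 _ _ R0); try lia.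
      - rewrite E2. apply in_elt.
      - rewrite E. apply in_or_app. simpl. auto. }
    subst c2. exists X0, n.
    destruct (cspecial (onran (shift (-1)) a2)); [|auto].
    specialize (H1 eq_refl). rewrite (W_whole c1 1), W_x0_pointer in H1 by lia.
    destruct (lab_RR_or_NN (ran c1) 1) as [[_ E1]|[_ E1]]; try lia;
    destruct (lab_RR_or_NN (dom c1) (num (dom c) + 1)) as [[_ E3]|[_ E3]]; try lia;
      rewrite E1, E3 in H1; cbn [weight] in H1; (split; [lia|auto]).
  - exists X1inv, n. cbn [weight] in H1. split; [lia|auto].
  - exists X1inv, n. destruct (lab (dom c)); cbn [weight] in H1; (split; [lia|auto]).
Qed.

Lemma whole_whole_dep d y z : num d = (y * P (dep d))%Z ->
  (num d + 1)%Z = (z * P (dep d))%Z -> dep d = 0%nat.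
Proof.
  intros E E'. destruct (dep d) as [|k]; auto. rewrite P_S in *.
  assert (2 * ((z - y) * P k) = 1)%Z by lia. lia.
Qed.

(** A left child ends at the midpoint of its parent, which is not an integer. *)
Lemma even_not_dr_int d z : Z.even (num d) = true -> (0 < dep d)%nat ->
  (num d + 1)%Z <> (z * P (dep d))%Z.
Proof.
  intros H H1 E. apply (f_equal Z.even) in E. rewrite even_mulP in E by auto.
  rewrite Z.even_add, H in E. discriminate.
Qed.

(* Moving the pointer left leaves a trivial tree, so the space left of it gets label R. *)
Lemma descent_x0inv f A d B i j i' j' : state f (A ++ Col d (Dint 0 0) :: B) i j i' j' ->
  A <> [] -> (lab d = LL \/ lab d = II \/ lab d = RR /\ B = []) ->
  descends f (total (tl (A ++ Col d (Dint 0 0) :: B))).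
Proof.
  intros S HA Hd. set (m := Col d (Dint 0 0)) in *. destruct A as [|a A]; [easy|].
  pose proof S as (R & _). assert (Hj : (j < 0)%Z) by (eapply (rep_before _ _ _ m); [exact R|reflexivity]).
  destruct (state_x0inv_mid _ _ _ _ _ _ S Hj) as (a2 & A2 & c2 & B2 & E2 & Hc2 & n & Hn & H1 & H2).
  assert (c2 = m).
  { eapply (rep_ran_inj _ _ _ _ _ _ 0 _ _ R); try (simpl; lia).
    - rewrite E2. apply in_elt.
    - apply in_elt. }
  subst c2. exists X0inv, n.
  destruct (last_cases (onran (shift 1)) ((a :: A) ++ m :: B)) as [H|H]; auto.
  specialize (H1 H). rewrite (W_whole m 0), W_x0inv_pointer, (lab_LL (ran m) 0) in H1 by easy.
  cbn [dom m ran dep Nat.eqb] in H1.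
  destruct Hd as [Hd|[Hd|[Hd ->]]].
  - rewrite Hd in H1. cbn [weight] in H1. split; [lia|auto].
  - rewrite Hd in H1. cbn [weight] in H1. split; [lia|auto].
  - exfalso. specialize (H _ _ eq_refl). apply lab_RR_iff in Hd as [D1 D2].
    replace (onran (shift 1) m) with (unit (num d) 1) in H.
    + rewrite cspecial_unit in H by lia. discriminate.
    + unfold onran, unit; cbn [dom m ran]. now rewrite (dint_unit _ D1) at 2.
Qed.

(** Let [c1] follow the trivial pointer tree. [X0] lowers the weight at [c1] unless its bottom label
    is L or its labels are [(R, I)]. In these two cases the label of [d] decides: for L or I,
    [X0inv] descends; N only occurs in the second case, where [d] and the domain of [c1] are
    siblings and [X1] cancels their caret. With no column before [d], the first case is covered by
    the shrinking support and the second again by [X1]. *)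
Lemma descent_split f A d B i j i' j' :
  let l := A ++ Col d (Dint 0 0) :: B in
  state f l i j i' j' ->
  (f = (fun t => t) /\ total (tl l) = 0%nat) \/ descends f (total (tl l)).
Proof.
  intros l S. set (m := Col d (Dint 0 0)) in *. pose proof S as (R & _ & _ & Hi & Hj).
  destruct B as [|c1 B].
  { pose proof (rep_last _ _ _ _ _ _ _ R) as [D1 _]. cbn [dom m] in D1.
    destruct A as [|a A].
    - left. pose proof (rep_first _ _ _ _ _ _ _ R) as [F1 F2]. cbn [dom m ran num dep] in F1, F2.
      pose proof (rep_last _ [] _ _ _ _ _ R) as [_ D2]. cbn [ran m num dep] in D2.
      assert (D : dep d = 0%nat).
      { eapply whole_whole_dep; eauto. }
      rewrite D in D1, F1. rewrite P_0 in D1, D2, F1, F2.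
      assert (num d = 0%Z) by lia. assert (i = 0%Z) by lia. assert (i' = 1%Z) by lia.
      assert (j = 0%Z) by lia. assert (j' = 1%Z) by lia. subst i j i' j'.
      split; auto. apply ell_zero_id. unfold l, m in S.
      rewrite (dint_unit _ D), H in S. exact S.
    - right. destruct (lab d) eqn:L.
      + eapply descent_x0inv; eauto. easy.
      + exfalso. apply lab_NN in L as [L1 L2]. eapply even_not_dr_int; eauto.
      + eapply descent_x0inv; eauto. easy.
      + eapply descent_x0inv; eauto. easy. }
  right. pose proof (rep_link _ _ _ _ _ _ _ _ _ R) as [D1 D2].
  cbn [dom ran m num dep] in D1, D2. rewrite P_0 in D2.
  assert (Hj' : (1 < j')%Z).
  { pose proof R as R1. apply rep_bounds, Forall_app in R1 as [_ R1].
    inversion_clear R1. inversion_clear H0. pose proof (P_pos (dep (ran c1))). nia. }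
  destruct (state_x0_mid _ _ _ _ _ _ S Hj') as (a2 & A2 & c2 & B2 & E2 & Hc2 & n & Hn & H1 & H2).
  assert (c2 = c1).
  { eapply (rep_ran_inj _ _ _ _ _ _ 1 _ _ R); try lia.
    - change (In c2 l). rewrite E2. apply in_elt.
    - apply in_or_app. simpl. auto. }
  subst c2. destruct (cspecial (onran (shift (-1)) a2)) eqn:Ha2.
  2:{ exists X0, n. auto. }
  specialize (H1 eq_refl). clear H2. rewrite (W_whole c1 1), W_x0_pointer in H1 by lia.
  assert (Ht : dep (ran c1) = 0%nat /\ lab (ran c1) = RR \/ lab (ran c1) = NN).
  { destruct (lab_RR_or_NN (ran c1) 1) as [H|[_ H]]; auto; lia. }
  destruct (lab (dom c1)) eqn:L1.
  - clear n Hn H1. apply lab_LL_iff in L1 as (z & L1 & Hz).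
    assert (Dz : (num d + 1 = z * P (dep d))%Z).
    { rewrite L1 in D1. pose proof (P_pos (dep (dom c1))).
      apply (Z.mul_reg_r _ _ (P (dep (dom c1)))); lia. }
    destruct A as [|a A].
    (* With nothing before it, [m] would be trivial in both forests and off the bottom pointer, so
       [X0] would have removed it from the support. *)
    + exfalso. assert (a2 = m) by (unfold l in E2; now injection E2).
      pose proof (rep_first _ _ _ _ _ _ _ R) as [F1 _]. cbn [dom m] in F1.
      assert (D : dep d = 0%nat).
      { eapply whole_whole_dep; eauto. }
      rewrite D, P_0 in *. subst a2.
      replace (onran (shift (-1)) m) with (unit (num d) (-1)) in Ha2.
      * rewrite cspecial_unit in Ha2 by lia. discriminate.
      * unfold onran, unit; cbn [dom m ran]. now rewrite (dint_unit _ D) at 2.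
    + destruct (lab d) eqn:L.
      * eapply descent_x0inv; eauto. easy.
      * exfalso. apply lab_NN in L as [L2 L3]. eapply even_not_dr_int; eauto.
      * exfalso. apply lab_RR_iff in L as [L2 L3]. rewrite L2, P_0 in Dz. lia.
      * eapply descent_x0inv; eauto. easy.
  - exists X0, n. destruct Ht as [[_ Ht]|Ht]; rewrite Ht in H1; cbn [weight] in H1;
      (split; [lia|auto]).
  - exists X0, n. destruct Ht as [[_ Ht]|Ht]; rewrite Ht in H1; cbn [weight] in H1;
      (split; [lia|auto]).
  - destruct Ht as [[Dt Ht]|Ht].
    2:{ exists X0, n. rewrite Ht in H1; cbn [weight] in H1. split; [lia|auto]. }
    clear n Hn H1. apply lab_II_iff in L1 as [L1 L1'].
    assert (Dpos : (0 < dep d)%nat).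
    { destruct (dep d) eqn:D; [|lia]. rewrite P_0 in D1.
      rewrite (whole_true _ (num d + 1)) in L1; [discriminate|lia]. }
    (* The common end of the two domain intervals has an odd numerator over either depth, so both
       depths equal that of its lowest terms and the intervals are siblings. *)
    assert (Merge : Z.even (num d) = true -> descends f (total (tl l))).
    { intros He. assert (Dd : dep d = dep (dom c1)).
      { apply Nat.le_antisymm.
        - apply (odd_dep_le (num d + 1) _ (num (dom c1))); auto.
          rewrite Z.odd_add, <- Z.negb_even, He. reflexivity.
        - apply (odd_dep_le (num (dom c1)) _ (num d + 1)); auto. }
      destruct (siblings d (dom c1) D1 He Dpos Dd) as (e & E & E').
      destruct (state_x1_mid _ _ _ _ _ _ S Hj') as [(A1 & e1 & B1 & n & _ & Hn & Hs)|[Hr _]].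
      - exists X1, n. auto.
      - exfalso. eapply (Hr (onran join m) (onran join c1)).
        + exists (map (onran join) A), (map (onran join) B). unfold l. now rewrite map_app.
        + replace m with (Col (half0 e) (Dint 0 0)) by (unfold m; congruence).
          replace c1 with (Col (half1 e) (Dint 1 0)); [apply opp_join_units|].
          destruct c1 as [d1 [b1 m1]]; cbn [dom ran num dep] in *.
          rewrite <- E', Dt in *. rewrite P_0 in *. f_equal. f_equal. lia. }
    destruct A as [|a A].
    + apply Merge. pose proof (rep_first _ _ _ _ _ _ _ R) as [F1 _]. cbn [dom m] in F1.
      rewrite F1. now apply even_mulP.
    + destruct (lab d) eqn:L.
      * eapply descent_x0inv; eauto. easy.
      * apply Merge. now apply lab_NN in L.
      * exfalso. apply lab_RR_iff in L. lia.
      * eapply descent_x0inv; eauto. easy.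
Qed.

Lemma ell_descends f n : ell f n -> (f = (fun t => t) /\ n = 0%nat) \/ descends f n.
Proof.
  intros (l & i & j & i' & j' & S & ->).
  destruct (joined_or_split l) as [J|(A & d & B & ->)].
  - right. eapply descent_joined; eauto.
  - eapply descent_split; eauto.
Qed.

(** Read backwards, the descent spells a word: each descending letter contributes its inverse on the
    left. *)
Lemma ell_word f n : ell f n -> exists w, length w = n /\ eval_word w = f.
Proof.
  revert f. induction n as [|n IH]; intros f H; apply ell_descends in H as [[-> E]|(g & m & E & H)];
    try discriminate.
  - exists []. auto.
  - injection E as <-. apply IH in H as (w & Hw & He). exists (inv g :: w). split.
    + simpl. congruence.
    + simpl. rewrite He. apply functional_extensionality. intros t. apply inv_letter.
Qed.

(** * The identity has length zero *)

Lemma dint_eq d d' : dl d = dl d' -> dr d = dr d' -> d = d'.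
Proof.
  destruct d as [b m], d' as [b' m']. unfold dl, dr; cbn [num dep]. rewrite !frac_eq.
  intros E E'. assert (F : P m = P m') by lia. f_equal.
  - rewrite F in E. pose proof (P_pos m'). apply Z.mul_reg_r in E; lia.
  - unfold P in F. apply Z.pow_inj_r in F; lia.
Qed.

Lemma exists_deepest (l : list col) : l <> [] ->
  exists c, In c l /\ forall e, In e l -> (dep (dom e) <= dep (dom c))%nat.
Proof.
  induction l as [|a l IH]; [easy|]. intros _. destruct l as [|b l].
  - exists a. split; [now left|]. intros e [<-|[]]. lia.
  - destruct IH as (c & Hc & H); [easy|].
    destruct (le_dec (dep (dom c)) (dep (dom a))) as [L|L].
    + exists a. split; [now left|]. intros e [<-|He]; auto. specialize (H e He). lia.
    + exists c. split; [now right|]. intros e [<-|He]; auto. lia.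
Qed.

(** Here both halves of each column coincide. In a column of maximal positive depth, the end at the
    midpoint of its parent forces the neighbour to have the same depth, so the two are siblings in
    both forests, against reducedness. All columns are thus unit columns, and trimming leaves only
    the one over zero. *)
Lemma ell_id n : ell (fun t => t) n -> n = 0%nat.
Proof.
  intros (l & i & j & i' & j' & (R & Hr & (T1 & T2) & Hi & Hj) & ->).
  assert (Hid : forall c, In c l -> ran c = dom c).
  { destruct R as (_ & M & _). rewrite Forall_forall in M. intros c Hc.
    destruct (M c Hc) as (E1 & E2 & _). now apply dint_eq. }
  destruct l as [|a l]; auto.
  destruct (exists_deepest (a :: l)) as (c & Hc & Hmax); [easy|].
  destruct (dep (dom c)) as [|k] eqn:D.
  - assert (Hu : forall e, In e (a :: l) -> e = unit (num (dom e)) (num (dom e))).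
    { intros e He. specialize (Hmax e He). specialize (Hid e He).
      destruct e as [d d']; simpl in *. subst d'. unfold unit.
      now rewrite <- (dint_unit d) by lia. }
    assert (Hs : forall e, In e (a :: l) -> cspecial e = true -> num (dom e) = 0%Z).
    { intros e He Hsp. rewrite (Hu e He) in Hsp. destruct (Z.eq_dec (num (dom e)) 0); auto.
      rewrite cspecial_unit in Hsp by auto. discriminate. }
    destruct (exists_last (l := a :: l)) as (A & e & E); [easy|].
    assert (Ha : num (dom a) = 0%Z) by (apply Hs; [now left|eauto]).
    assert (He : num (dom e) = 0%Z) by (apply Hs; [rewrite E; apply in_elt|eauto]).
    pose proof R as R1. rewrite E, (Hu e), He in R1 by (rewrite E; apply in_elt).
    apply rep_drop_right in R1 as (E1 & _ & _).
    rewrite (Hu a), Ha in R by now left. apply rep_drop_left in R as (E2 & _ & R).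
    destruct l as [|b l]; auto. exfalso. apply rep_bounds in R. inversion_clear R.
    pose proof (P_pos (dep (dom b))). nia.
  - exfalso.
    assert (Hopp : forall c c', In c (a :: l) -> In c' (a :: l) ->
      (exists e, dom c = half0 e /\ dom c' = half1 e) -> opp c c').
    { intros x x' Hx Hx' (e & E1 & E2). exists (Col e e).
      specialize (Hid x Hx) as H1. specialize (Hid x' Hx') as H2.
      destruct x as [d d1], x' as [d' d1']. simpl in *. now subst. }
    apply in_split in Hc as (A & B & E). rewrite E in *.
    destruct (Z.even (num (dom c))) eqn:Ev.
    + destruct B as [|c' B].
      * apply rep_last in R as [R _]. eapply even_not_dr_int; eauto. lia.
      * pose proof (rep_link _ _ _ _ _ _ _ _ _ R) as [L _].
        assert (Hc' : In c' (A ++ c :: c' :: B)) by (apply in_or_app; simpl; auto).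
        apply (Hr c c'); [now exists A, B|]. apply Hopp; auto using in_elt.
        apply siblings; auto; [lia|]. apply Nat.le_antisymm.
        -- apply (odd_dep_le (num (dom c) + 1) _ (num (dom c'))); auto.
           rewrite Z.odd_add, <- Z.negb_even, Ev. reflexivity.
        -- rewrite D. now apply Hmax.
    + destruct A as [|a' A] using rev_ind.
      * apply rep_first in R as [R _]. rewrite R, even_mulP in Ev by lia. discriminate.
      * clear IHA. rewrite <- app_assoc in *. cbn [app] in *. rename a' into c'.
        pose proof (rep_link _ _ _ _ _ _ _ _ _ R) as [L _].
        assert (Hc : In c (A ++ c' :: c :: B)) by (apply in_or_app; simpl; auto).
        assert (Hc' : In c' (A ++ c' :: c :: B)) by apply in_elt.
        assert (Dd : dep (dom c') = dep (dom c)).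
        { apply Nat.le_antisymm; [rewrite D; now apply Hmax|].
          apply (odd_dep_le (num (dom c)) _ (num (dom c') + 1)); auto.
          now rewrite <- Z.negb_even, Ev. }
        apply (Hr c' c); [now exists A, B|]. apply Hopp; auto.
        apply siblings; auto; [|lia].
        rewrite Dd in L. apply Z.mul_reg_r in L; [|pose proof (P_pos (dep (dom c))); lia].
        rewrite <- L, Z.even_add in Ev. now destruct (Z.even (num (dom c'))).
Qed.

(** The inverse of the leftmost letter removes that letter and lowers the length by at most one. *)
Lemma ell_word_lower w n : ell (eval_word w) n -> (n <= length w)%nat.
Proof.
  revert n. induction w as [|g w IH]; intros n H; simpl in *.
  - apply ell_id in H. lia.
  - destruct (ell_letter _ _ (inv g) H) as (n' & H' & L).
    replace (fun t => letter_fun (inv g) (letter_fun g (eval_word w t)))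
      with (eval_word w) in H'.
    + apply IH in H'. lia.
    + apply functional_extensionality. intros t. now rewrite inv_letter.
Qed.

Lemma ell_word_length f n : ell f n -> word_length f n.
Proof.
  intros H. split; [now apply ell_word|]. intros w <-. now apply ell_word_lower.
Qed.

(** * Columns of a forest diagram *)

(** The path read as a binary numeral, most significant digit first. *)
Fixpoint pnum (p : list bool) : Z :=
  match p with
  | [] => 0
  | b :: p => (if b then P (length p) else 0) + pnum p
  end%Z.

Definition dpath (i : Z) (p : list bool) : dint :=
  Dint (i * P (length p) + pnum p) (length p).

Lemma pnum_bounds p : (0 <= pnum p < P (length p))%Z.
Proof.
  induction p as [|b p IH]; cbn [pnum length]; [rewrite P_0; lia|].
  rewrite P_S. pose proof (P_pos (length p)). destruct b; lia.
Qed.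

Lemma path_left_pnum p : path_left p = IZR (pnum p) / 2 ^ length p.
Proof.
  induction p as [|b p IH]; cbn [pnum path_left length pow]; [lra|].
  rewrite IH, plus_IZR. pose proof (pow2_pos (length p)).
  destruct b; [rewrite IZR_P|]; field; lra.
Qed.

Lemma node_left_dl i p : node_left i p = dl (dpath i p).
Proof.
  unfold node_left, dl, dpath, frac; cbn [num dep].
  rewrite path_left_pnum, plus_IZR, mult_IZR, IZR_P.
  pose proof (pow2_pos (length p)). field. lra.
Qed.

Lemma node_right_dr i p : node_right i p = dr (dpath i p).
Proof.
  unfold node_right. rewrite node_left_dl. unfold dl, dr, dpath, frac; cbn [num dep].
  rewrite !plus_IZR. pose proof (pow2_pos (length p)). field. lra.
Qed.

Lemma dpath_bounds i p : IZR i <= dl (dpath i p) /\ dr (dpath i p) <= IZR i + 1.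
Proof.
  pose proof (pnum_bounds p). rewrite <- plus_IZR, int_le_dl, dr_le_int.
  unfold dpath; cbn [num dep]. lia.
Qed.

Lemma pnum_inj p q : length p = length q -> pnum p = pnum q -> p = q.
Proof.
  revert q. induction p as [|b p IH]; intros [|c q] L E; try discriminate; auto.
  injection L as L. cbn [pnum] in E. rewrite L in E.
  pose proof (pnum_bounds p). pose proof (pnum_bounds q). rewrite L in *.
  destruct b, c; try lia; f_equal; apply IH; auto; lia.
Qed.

(** Division with remainder of the numerator by the power of two recovers the tree index and the
    path. *)
Lemma dpath_inj i p k q : dpath i p = dpath k q -> i = k /\ p = q.
Proof.
  unfold dpath. intros E. injection E as E L. pose proof (pnum_bounds p).
  pose proof (pnum_bounds q). pose proof (P_pos (length q)). rewrite L in *.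
  assert (i < k + 1)%Z by (apply (Z.mul_lt_mono_pos_r (P (length q))); lia).
  assert (k < i + 1)%Z by (apply (Z.mul_lt_mono_pos_r (P (length q))); lia).
  assert (i = k) by lia. subst k. split; auto. apply pnum_inj; auto. lia.
Qed.

Lemma pnum_snoc p b : pnum (p ++ [b]) = (2 * pnum p + if b then 1 else 0)%Z.
Proof.
  induction p as [|c p IH]; cbn [app pnum].
  - destruct b; reflexivity.
  - rewrite IH, length_app, Nat.add_1_r, P_S. destruct c; lia.
Qed.

Lemma dpath_snoc_false i p : dpath i (p ++ [false]) = half0 (dpath i p).
Proof.
  unfold dpath, half0; cbn [num dep]. rewrite pnum_snoc, length_app, Nat.add_1_r, P_S.
  f_equal. lia.
Qed.

Lemma dpath_snoc_true i p : dpath i (p ++ [true]) = half1 (dpath i p).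
Proof.
  unfold dpath, half1; cbn [num dep]. rewrite pnum_snoc, length_app, Nat.add_1_r, P_S.
  f_equal. lia.
Qed.

Lemma half0_inj d e : half0 d = half0 e -> d = e.
Proof.
  intros E. pose proof (f_equal num E) as E1. pose proof (f_equal dep E) as E2.
  destruct d as [b m], e as [c k]. unfold half0 in *; cbn [num dep] in *.
  injection E2 as ->. f_equal. lia.
Qed.

Lemma half1_inj d e : half1 d = half1 e -> d = e.
Proof.
  intros E. pose proof (f_equal num E) as E1. pose proof (f_equal dep E) as E2.
  destruct d as [b m], e as [c k]. unfold half1 in *; cbn [num dep] in *.
  injection E2 as ->. f_equal. lia.
Qed.

Lemma dpath_half0 i p e : dpath i p = half0 e ->
  exists q, p = q ++ [false] /\ e = dpath i q.
Proof.
  destruct p as [|b q _] using rev_ind; intros E; [discriminate|].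
  exists q. destruct b.
  - rewrite dpath_snoc_true in E. apply (f_equal num) in E. cbn [half0 half1 num] in E. lia.
  - rewrite dpath_snoc_false in E. apply half0_inj in E. auto.
Qed.

Lemma dpath_half1 i p e : dpath i p = half1 e ->
  exists q, p = q ++ [true] /\ e = dpath i q.
Proof.
  destruct p as [|b q _] using rev_ind; intros E; [discriminate|].
  exists q. destruct b.
  - rewrite dpath_snoc_true in E. apply half1_inj in E. auto.
  - rewrite dpath_snoc_false in E. apply (f_equal num) in E. cbn [half0 half1 num] in E. lia.
Qed.

(** * The leaves of a forest as a tiling *)

Fixpoint dchain (x : R) (l : list dint) (x' : R) : Prop :=
  match l with
  | [] => x = x'
  | d :: l => dl d = x /\ dchain (dr d) l x'
  end.

Lemma chain_dchain x y l x' y' :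
  chain x y l x' y' <-> dchain x (map dom l) x' /\ dchain y (map ran l) y'.
Proof.
  revert x y. induction l as [|c l IH]; intros x y; simpl; [tauto|]. rewrite IH. tauto.
Qed.

Lemma dchain_app x l l' x' :
  dchain x (l ++ l') x' <-> exists u, dchain x l u /\ dchain u l' x'.
Proof.
  revert x. induction l as [|d l IH]; simpl; intros x.
  - split; [eauto|]. intros (u & -> & H). exact H.
  - rewrite IH. split.
    + intros (H & u & H1 & H2). eauto.
    + intros (u & (H & H1) & H2). eauto.
Qed.

Lemma dchain_bounds x l x' : dchain x l x' ->
  x <= x' /\ Forall (fun d => x <= dl d /\ dr d <= x') l.
Proof.
  revert x. induction l as [|d l IH]; simpl; intros x H.
  - subst. split; auto; lra.
  - destruct H as [H1 H]. apply IH in H as [H2 H]. pose proof (dl_lt_dr d).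
    split; [lra|]. constructor; [lra|]. eapply Forall_impl; [|exact H].
    simpl. intros; lra.
Qed.

Lemma dchain_inj x l x' d e : dchain x l x' -> In d l -> In e l -> dl d = dl e -> d = e.
Proof.
  revert x. induction l as [|a l IH]; simpl; intros x H Hd He E; [easy|].
  destruct H as (H1 & H). pose proof (dl_lt_dr a).
  pose proof (dchain_bounds _ _ _ H) as (_ & F). rewrite Forall_forall in F.
  destruct Hd as [<-|Hd], He as [<-|He]; auto.
  - apply F in He. lra.
  - apply F in Hd. lra.
  - eapply IH; eauto.
Qed.

Lemma dchain_NoDup x l x' : dchain x l x' -> NoDup (map dl l).
Proof.
  revert x. induction l as [|a l IH]; simpl; intros x H; constructor.
  - destruct H as [_ H]. apply dchain_bounds in H as (_ & F). rewrite Forall_forall in F.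
    intros Hin. apply in_map_iff in Hin as (e & E & He). apply F in He.
    pose proof (dl_lt_dr a). lra.
  - destruct H as [_ H]. eauto.
Qed.

(** The two tilings are compared from the left: inside [Q] the left end determines the interval, and
    hence where the next one starts. *)
Lemma dchain_unique (Q : dint -> Prop) x l l' x' :
  (forall d e, Q d -> Q e -> dl d = dl e -> d = e) ->
  Forall Q l -> Forall Q l' -> dchain x l x' -> dchain x l' x' -> l = l'.
Proof.
  intros HQ. revert x l'. induction l as [|d l IH]; intros x l' F F' H H'.
  - simpl in H. subst x'. destruct l' as [|e l']; auto. destruct H' as [<- H'].
    apply dchain_bounds in H' as [H' _]. pose proof (dl_lt_dr e). lra.
  - destruct l' as [|e l'].
    + simpl in H'. subst x'. destruct H as [<- H].
      apply dchain_bounds in H as [H _]. pose proof (dl_lt_dr d). lra.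
    + destruct H as [H1 H], H' as [H1' H']. inversion_clear F. inversion_clear F'.
      assert (d = e) by (apply HQ; congruence). subst e. f_equal. eapply IH; eauto.
Qed.

Fixpoint paths (t : tree) : list (list bool) :=
  match t with
  | Leaf => [[]]
  | Node l r => map (cons false) (paths l) ++ map (cons true) (paths r)
  end.

Lemma in_paths t p : In p (paths t) <-> subtree t p = Some Leaf.
Proof.
  revert p. induction t as [|l IHl r IHr]; intros p.
  - destruct p as [|b p]; simpl; intuition discriminate.
  - simpl paths. rewrite in_app_iff, !in_map_iff. split.
    + intros [(q & <- & H)|(q & <- & H)]; simpl; [now apply IHl|now apply IHr].
    + destruct p as [|[] p]; simpl; intros H; [discriminate| |].
      * right. exists p. split; auto. now apply IHr.
      * left. exists p. split; auto. now apply IHl.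
Qed.

(** The children of the root over [[i, i + 1]] become the trees with indices [2 * i] and [2 * i + 1]
    when the axis is doubled. This lets the tiling of a tree be proved by recursion on its
    subtrees. *)
Lemma dpath_cons i b p :
  dpath i (b :: p) = let d := dpath (2 * i + if b then 1 else 0) p in Dint (num d) (S (dep d)).
Proof.
  unfold dpath; cbn [num dep length pnum]. rewrite P_S. f_equal. destruct b; lia.
Qed.

Lemma dchain_deeper x l x' : dchain x l x' ->
  dchain (x / 2) (map (fun d => Dint (num d) (S (dep d))) l) (x' / 2).
Proof.
  revert x. induction l as [|[b m] l IH]; simpl; intros x H; [congruence|].
  destruct H as [<- H]. rewrite dl_deeper, dr_deeper. auto.
Qed.

Lemma dchain_paths i t : dchain (IZR i) (map (dpath i) (paths t)) (IZR i + 1).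
Proof.
  revert i. induction t as [|l IHl r IHr]; intros i.
  - simpl. unfold dpath; simpl. rewrite P_0, Z.mul_1_r, Z.add_0_r, dl_unit, dr_unit. auto.
  - cbn [paths]. rewrite map_app, !map_map, dchain_app. exists (IZR i + / 2). split.
    + specialize (IHl (2 * i + 0)%Z). apply dchain_deeper in IHl. rewrite map_map in IHl.
      erewrite map_ext by (intros p; apply dpath_cons).
      rewrite Z.add_0_r, mult_IZR in IHl. rewrite Z.add_0_r.
      replace (2 * IZR i / 2) with (IZR i) in IHl by field.
      replace ((2 * IZR i + 1) / 2) with (IZR i + / 2) in IHl by field. exact IHl.
    + specialize (IHr (2 * i + 1)%Z). apply dchain_deeper in IHr. rewrite map_map in IHr.
      erewrite map_ext by (intros p; apply dpath_cons).
      rewrite plus_IZR, mult_IZR in IHr.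
      replace ((2 * IZR i + 1) / 2) with (IZR i + / 2) in IHr by field.
      replace ((2 * IZR i + 1 + 1) / 2) with (IZR i + 1) in IHr by field. exact IHr.
Qed.

Fixpoint fleaves (T : forest) (a : Z) (n : nat) : list dint :=
  match n with
  | O => []
  | S n => map (dpath a) (paths (T a)) ++ fleaves T (a + 1) n
  end.

Lemma dchain_fleaves T a n : dchain (IZR a) (fleaves T a n) (IZR (a + Z.of_nat n)).
Proof.
  revert a. induction n as [|n IH]; intros a; cbn [fleaves].
  - simpl. f_equal. lia.
  - apply dchain_app. exists (IZR (a + 1)). split.
    + rewrite plus_IZR. apply dchain_paths.
    + replace (a + Z.of_nat (S n))%Z with (a + 1 + Z.of_nat n)%Z by lia. apply IH.
Qed.

Lemma in_fleaves T a n d : In d (fleaves T a n) <->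
  exists i p, (a <= i < a + Z.of_nat n)%Z /\ leaf_of T i p /\ d = dpath i p.
Proof.
  revert a. induction n as [|n IH]; intros a; cbn [fleaves].
  - split; [easy|]. intros (i & p & H & _). lia.
  - rewrite in_app_iff, IH, in_map_iff. split.
    + intros [(p & <- & H)|(i & p & H & H1 & H2)].
      * exists a, p. split; [lia|]. split; auto. now apply in_paths.
      * exists i, p. split; [lia|auto].
    + intros (i & p & H & H1 & ->). destruct (Z.eq_dec i a) as [->|N].
      * left. exists p. split; auto. now apply in_paths.
      * right. exists i, p. split; [lia|auto].
Qed.

Definition is_leaf (T : forest) (d : dint) : Prop :=
  exists i p, leaf_of T i p /\ d = dpath i p.

(** Both leaves occur in the tiling by the trees between their two indices. *)
Lemma is_leaf_dl_inj T d e : is_leaf T d -> is_leaf T e -> dl d = dl e -> d = e.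
Proof.
  intros (i & p & H & ->) (k & q & H' & ->) E.
  set (a := Z.min i k). set (n := Z.to_nat (Z.max i k - a + 1)).
  apply (dchain_inj _ _ _ _ _ (dchain_fleaves T a n)); auto; apply in_fleaves.
  - exists i, p. split; [lia|auto].
  - exists k, q. split; [lia|auto].
Qed.

Lemma pnum_whole i p : whole (dpath i p) = true <-> pnum p = 0%Z.
Proof.
  pose proof (pnum_bounds p). split.
  - intros H1. apply NNPP. intros N. rewrite (whole_false _ i) in H1; [discriminate|].
    unfold dpath; cbn [num dep]. lia.
  - intros H1. apply (whole_true _ i). unfold dpath; cbn [num dep]. lia.
Qed.

Lemma leftmost_path_snoc l r : exists q, leftmost_path (Node l r) = q ++ [false].
Proof.
  revert r. induction l as [|l IHl l' _]; intros r.
  - exists []. reflexivity.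
  - destruct (IHl l') as [q Hq]. exists (false :: q).
    change (leftmost_path (Node (Node l l') r)) with (false :: leftmost_path (Node l l')).
    now rewrite Hq.
Qed.

Lemma subtree_nil t : subtree t [] = Some t.
Proof. now destruct t. Qed.

Lemma subtree_app t p q : subtree t (p ++ q) =
  match subtree t p with Some t' => subtree t' q | None => None end.
Proof.
  revert t. induction p as [|b p IH]; intros t; [now destruct t|]. destruct t; [reflexivity|apply IH].
Qed.

Lemma subtree_snoc t p b u : subtree t (p ++ [b]) = Some u ->
  exists l r, subtree t p = Some (Node l r) /\ u = if b then r else l.
Proof.
  rewrite subtree_app. destruct (subtree t p) as [[|l r]|]; try discriminate.
  cbn [subtree]. rewrite subtree_nil. intros E. injection E as <-. eauto.
Qed.

(** The leftmost path below a caret ends with a step to the left; conversely, a left child is the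
    leftmost leaf of its parent caret. *)
Lemma leaf_left_of_caret T k r : leaf_of T k r ->
  (exists (k' : Z) c l s, subtree (T k') c = Some (Node l s) /\
     (k', c ++ leftmost_path (Node l s)) = (k, r)) <->
  (0 < dep (dpath k r))%nat /\ Z.even (num (dpath k r)) = true.
Proof.
  intros H. split.
  - intros (k' & c & l & s & _ & E). apply pair_equal_spec in E as [-> <-].
    destruct (leftmost_path_snoc l s) as [q ->]. rewrite app_assoc, dpath_snoc_false.
    unfold half0; cbn [num dep]. split; [lia|]. now rewrite Z.even_mul.
  - destruct r as [|b r _] using rev_ind; [simpl; lia|]. destruct b.
    + rewrite dpath_snoc_true. unfold half1; cbn [num dep]. intros [_ E].
      rewrite Z.add_comm, Z.even_add_mul_2 in E. discriminate.
    + intros _. apply subtree_snoc in H as (l & s & H & E). subst l.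
      exists k, r, Leaf, s. auto.
Qed.

(** Each tree spans a unit interval, so a space is exterior exactly when it sits at an integer; the
    caret condition is the parity of the leaf on its right. *)
Lemma is_label_leaf T d : is_leaf T d -> is_label T (dl d) (lab d).
Proof.
  intros Hd i p k r Hp Ep Hr Er. rewrite node_right_dr in Ep. rewrite node_left_dl in Er.
  assert (d = dpath k r).
  { apply (is_leaf_dl_inj T); auto. exists k, r. auto. }
  subst d. clear Hd Er. pose proof (leaf_left_of_caret T k r Hr) as HC.
  set (C := exists _, _) in *.
  assert (Hext : i <> k <-> whole (dpath k r) = true).
  { rewrite pnum_whole. pose proof (dpath_bounds i p) as [B1 B2].
    pose proof (dpath_bounds k r) as [B3 B4]. pose proof (dl_lt_dr (dpath k r)).
    pose proof (dl_lt_dr (dpath i p)).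
    assert (L1 : (i < k + 1)%Z) by (apply lt_IZR; rewrite plus_IZR; lra).
    split; intros HH.
    - assert (i + 1 <= k)%Z by lia. apply IZR_le in H1. rewrite plus_IZR in H1.
      assert (E : dl (dpath k r) = IZR k) by lra. apply dl_eq_int in E.
      unfold dpath in E; cbn [num dep] in E. lia.
    - intros ->. assert (E : dl (dpath k r) = IZR k).
      { apply dl_eq_int. unfold dpath; cbn [num dep]. lia. }
      lra. }
  assert (Hk : whole (dpath k r) = true -> ((k <= 0)%Z <-> (num (dpath k r) <= 0)%Z)).
  { rewrite pnum_whole. unfold dpath; cbn [num dep]. intros ->.
    pose proof (P_pos (length r)). split; intros; nia. }
  cbv zeta. unfold lab. destruct (whole (dpath k r)) eqn:Ew; cbn [andb].
  - specialize (Hk eq_refl). destruct (Z.leb_spec (num (dpath k r)) 0).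
    { split; [now apply Hext|now apply Hk]. }
    assert (NL : ~ (i <> k /\ (k <= 0)%Z)) by (intros [_ N]; apply Hk in N; lia).
    destruct (dep (dpath k r)) eqn:D; cbn [Nat.eqb].
    + repeat split; auto; [|now apply Hext]. rewrite HC. lia.
    + replace (Z.even (num (dpath k r))) with true.
      * split; auto. apply HC. split; [lia|]. apply whole_iff in Ew as [z Hz].
        rewrite Hz. apply even_mulP. lia.
      * apply whole_iff in Ew as [z Hz]. rewrite Hz, even_mulP; auto. lia.
  - assert (Next : ~ (i <> k)) by (rewrite Hext; discriminate).
    apply inner_dep in Ew. rewrite (proj2 (Nat.eqb_neq _ 0)) by lia.
    destruct (Z.even (num (dpath k r))) eqn:Ev.
    + split; [tauto|]. apply HC. auto.
    + repeat split; [tauto| |tauto]. rewrite HC. intros [_ N]. discriminate.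
Qed.

(** * Counting carets *)

Lemma list_sum_inner_paths i t :
  list_sum (map inner (map (dpath i) (paths t))) = ncarets t.
Proof.
  assert (Hlen : forall t, length (paths t) = S (ncarets t)).
  { induction t0; simpl; auto. rewrite length_app, !length_map. lia. }
  assert (Hin : forall p, inner (dpath i p) = if (pnum p =? 0)%Z then 0%nat else 1%nat).
  { intros p. unfold inner. pose proof (pnum_whole i p).
    destruct (Z.eqb_spec (pnum p) 0) as [E|N].
    - now rewrite (proj2 H E).
    - destruct (whole (dpath i p)); auto. elim N. now apply H. }
  rewrite map_map. erewrite map_ext by exact Hin. clear Hin.
  induction t as [|l IHl r _]; cbn [paths ncarets]; [reflexivity|].
  rewrite map_app, list_sum_app, !map_map. cbn [pnum].
  rewrite (map_ext _ (fun p => if (pnum p =? 0)%Z then 0%nat else 1%nat)), IHl by reflexivity.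
  erewrite (map_ext _ (fun _ => 1%nat)).
  - rewrite Nat.add_comm, <- Nat.add_succ_r, Nat.add_comm. f_equal. rewrite <- Hlen.
    generalize (paths r). induction l0; simpl; auto.
  - intros p. pose proof (pnum_bounds p). pose proof (P_pos (length p)).
    destruct (Z.eqb_spec (P (length p) + pnum p) 0); auto. lia.
Qed.

Definition zsum (g : Z -> nat) (a : Z) (n : nat) : nat :=
  list_sum (map (fun k => g (a + Z.of_nat k)%Z) (seq 0 n)).

Lemma zsum_S g a n : zsum g a (S n) = (g a + zsum g (a + 1) n)%nat.
Proof.
  unfold zsum. cbn [seq map]. rewrite <- seq_shift, map_map. simpl. f_equal.
  - f_equal. lia.
  - f_equal. apply map_ext. intros k. f_equal. lia.
Qed.

Lemma zsum_add g a n m : zsum g a (n + m) = (zsum g a n + zsum g (a + Z.of_nat n) m)%nat.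
Proof.
  revert a. induction n as [|n IH]; intros a; cbn [Nat.add].
  - rewrite Z.add_0_r. reflexivity.
  - rewrite !zsum_S, IH. replace (a + 1 + Z.of_nat n)%Z with (a + Z.of_nat (S n))%Z by lia. lia.
Qed.

Lemma zsum_zero g a n : (forall i, (a <= i < a + Z.of_nat n)%Z -> g i = 0%nat) ->
  zsum g a n = 0%nat.
Proof.
  revert a. induction n as [|n IH]; intros a H; [reflexivity|].
  rewrite zsum_S, IH by (intros; apply H; lia). rewrite H; lia.
Qed.

Lemma zsum_window g a n b m :
  (forall i, (i < a \/ a + Z.of_nat n <= i)%Z -> g i = 0%nat) ->
  (b <= a)%Z -> (a + Z.of_nat n <= b + Z.of_nat m)%Z -> zsum g b m = zsum g a n.
Proof.
  intros H H1 H2.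
  replace m with (Z.to_nat (a - b) + (n + Z.to_nat (b + Z.of_nat m - a - Z.of_nat n)))%nat by lia.
  rewrite !zsum_add, (zsum_zero g b), (zsum_zero g (b + _ + _)) by (intros; apply H; lia).
  replace (b + Z.of_nat (Z.to_nat (a - b)))%Z with a by lia. lia.
Qed.

Lemma zsum_plus g h a n : zsum (fun i => g i + h i)%nat a n = (zsum g a n + zsum h a n)%nat.
Proof.
  revert a. induction n as [|n IH]; intros a; [reflexivity|]. rewrite !zsum_S, IH. lia.
Qed.

Lemma list_sum_inner_fleaves T a n :
  list_sum (map inner (fleaves T a n)) = zsum (fun i => ncarets (T i)) a n.
Proof.
  revert a. induction n as [|n IH]; intros a; [reflexivity|].
  rewrite zsum_S. cbn [fleaves]. now rewrite map_app, list_sum_app, list_sum_inner_paths, IH.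
Qed.

(** [ell1] sums both forests over one symmetric window; trivial trees have no carets, so every
    window beyond the nontrivial trees gives the same sum. *)
Lemma ell1_window d a n b m :
  (forall i, (i < a \/ a + Z.of_nat n <= i)%Z -> bot d i = Leaf) ->
  (forall i, (i < b \/ b + Z.of_nat m <= i)%Z -> top d i = Leaf) ->
  ell1 d (list_sum (map inner (fleaves (bot d) a n)) +
          list_sum (map inner (fleaves (top d) b m))).
Proof.
  intros Hb Ht.
  set (N := Z.to_nat (Z.abs a + Z.abs b + Z.of_nat n + Z.of_nat m + 1)). exists N. split.
  - intros i Hi. split; [apply Ht|apply Hb]; lia.
  - rewrite !list_sum_inner_fleaves.
    rewrite <- (zsum_window (fun i => ncarets (bot d i)) a n (- Z.of_nat N) (2 * N + 1)),
      <- (zsum_window (fun i => ncarets (top d i)) b m (- Z.of_nat N) (2 * N + 1)).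
    + rewrite Nat.add_comm, <- zsum_plus. unfold zsum. f_equal. apply map_ext.
      intros k. cbv zeta. now replace (- Z.of_nat N + Z.of_nat k)%Z with (Z.of_nat k - Z.of_nat N)%Z by lia.
    + intros i Hi. now rewrite Ht.
    + lia.
    + lia.
    + intros i Hi. now rewrite Hb.
    + lia.
    + lia.
Qed.

(** * From a reduced diagram to a state *)

Lemma trim_left f l i j i' j' : rep f l i j i' j' -> (i <= 0)%Z -> (j <= 0)%Z ->
  (exists c, In c l /\ cspecial c = true) ->
  exists A l1 i1 j1, l = A ++ l1 /\ Forall (fun c => cspecial c = false) A /\
    rep f l1 i1 j1 i' j' /\ (i1 <= 0)%Z /\ (j1 <= 0)%Z /\
    exists c B, l1 = c :: B /\ cspecial c = true.
Proof.
  revert i j. induction l as [|c l IH]; intros i j R Hi Hj (e & He & Hs); [easy|].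
  destruct (cspecial c) eqn:Ec.
  - exists [], (c :: l), i, j. repeat split; auto; try apply R. eauto.
  - pose proof Ec as E. apply cspecial_false_unit in E as (E & N1 & N2).
    rewrite E in R. apply rep_drop_left in R as (E1 & E2 & R).
    destruct (IH (i + 1)%Z (j + 1)%Z R) as (A & l1 & i1 & j1 & -> & HA & H); try lia.
    { destruct He as [->|He]; [congruence|eauto]. }
    exists (c :: A), l1, i1, j1. auto.
Qed.

Lemma trim_right f l i j i' j' : rep f l i j i' j' -> (0 < i')%Z -> (0 < j')%Z ->
  (exists c, In c l /\ cspecial c = true) ->
  exists l1 B i1 j1, l = l1 ++ B /\ Forall (fun c => cspecial c = false) B /\
    rep f l1 i j i1 j1 /\ (0 < i1)%Z /\ (0 < j1)%Z /\
    exists A c, l1 = A ++ [c] /\ cspecial c = true.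
Proof.
  revert i' j'. induction l as [|c l IH] using rev_ind; intros i' j' R Hi Hj (e & He & Hs);
    [easy|].
  destruct (cspecial c) eqn:Ec.
  - exists (l ++ [c]), [], i', j'. rewrite app_nil_r. repeat split; auto; try apply R. eauto.
  - pose proof Ec as E. apply cspecial_false_unit in E as (E & N1 & N2).
    rewrite E in R. apply rep_drop_right in R as (E1 & E2 & R).
    destruct (IH (i' - 1)%Z (j' - 1)%Z R) as (l1 & B & i1 & j1 & -> & HB & H); try lia.
    { apply in_app_iff in He as [He|[->|[]]]; [eauto|congruence]. }
    exists l1, (B ++ [c]), i1, j1. rewrite app_assoc. split; auto. split; auto.
    apply Forall_app; auto.
Qed.

Lemma rep_trim f l i j i' j' : rep f l i j i' j' -> red l ->
  (i <= 0 < i')%Z -> (j <= 0 < j')%Z ->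
  exists A l1 B i1 j1 i1' j1', l = A ++ l1 ++ B /\
    Forall (fun c => cspecial c = false) A /\ Forall (fun c => cspecial c = false) B /\
    state f l1 i1 j1 i1' j1'.
Proof.
  intros R Hr Hi Hj.
  assert (Hs : exists c, In c l /\ cspecial c = true).
  { destruct (rep_split _ _ _ _ _ _ 0 R Hj) as (A & c & B & -> & Hc & _).
    exists c. split; [apply in_elt|]. apply cspecial_ran, special_zero. lia. }
  destruct (trim_left _ _ _ _ _ _ R) as (A & l1 & i1 & j1 & -> & HA & R1 & Hi1 & Hj1 & c & B & -> & Hc);
    auto; try lia.
  destruct (trim_right _ _ _ _ _ _ R1) as (l2 & B2 & i2 & j2 & E & HB & R2 & Hi2 & Hj2 & A2 & c2 & El & Hc2);
    try lia.
  { exists c. split; [now left|auto]. }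
  exists A, l2, B2, i1, j1, i2, j2. rewrite <- E. repeat split; auto; try apply R2; try lia.
  - apply red_app_r in Hr. rewrite E in Hr. now apply red_app_l in Hr.
  - intros e B' Ee. rewrite Ee in E. injection E as <- _. auto.
  - intros A' e Ee. rewrite El in Ee. apply app_inj_tail in Ee as [_ <-]. auto.
Qed.

Lemma in_F_translation f : in_F f -> exists a b m n : Z,
  (forall t, t <= IZR a -> f t = t - IZR m) /\ (forall t, IZR b <= t -> f t = t - IZR n).
Proof.
  intros (b0 & bs & m & n & _ & H1 & H2).
  exists (- up (- b0))%Z, (up (last (b0 :: bs) b0)), m, n. split.
  - intros t Ht. apply H1. pose proof (archimed (- b0)) as [L _]. rewrite opp_IZR in Ht. lra.
  - intros t Ht. apply H2. pose proof (archimed (last (b0 :: bs) b0)) as [L _]. lra.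
Qed.

Lemma diagram_leaf f d e : is_diagram_for f d -> is_leaf (bot d) e ->
  exists e', is_leaf (top d) e' /\ maps f (Col e e').
Proof.
  intros (_ & _ & H) (i & p & Hl & ->). specialize (H i p Hl). cbv zeta in H.
  destruct H as ((j & q & Hq & E1 & E2) & Hlin).
  rewrite !node_left_dl, !node_right_dr in *. exists (dpath j q). split; [now exists j, q|].
  repeat split; simpl; auto. intros t Ht. rewrite Hlin by auto. unfold Rdiv. ring.
Qed.

Lemma diagram_columns f d L : is_diagram_for f d -> Forall (is_leaf (bot d)) L ->
  exists l, map dom l = L /\ Forall (maps f) l /\ Forall (fun c => is_leaf (top d) (ran c)) l.
Proof.
  intros Hd. induction L as [|e L IH]; intros F.
  - exists []. auto.
  - inversion_clear F. destruct IH as (l & <- & H1 & H2); auto.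
    destruct (diagram_leaf _ _ _ Hd H) as (e' & He & Hm).
    exists (Col e e' :: l). auto.
Qed.

Lemma chain_maps f x l x' : dchain x (map dom l) x' -> Forall (maps f) l ->
  chain x (f x) l x' (f x').
Proof.
  revert x. induction l as [|c l IH]; simpl; intros x H F.
  - subst. auto.
  - destruct H as [<- H]. inversion_clear F. destruct H0 as (E1 & E2 & _).
    rewrite <- E2. auto.
Qed.

Lemma wide_columns f d : in_F f -> is_diagram_for f d -> exists l i j i' j',
  rep f l i j i' j' /\ (i <= 0 < i')%Z /\ (j <= 0 < j')%Z /\
  map dom l = fleaves (bot d) i (Z.to_nat (i' - i)) /\
  Forall (fun c => is_leaf (top d) (ran c)) l /\
  (forall k, (k < i \/ i' <= k)%Z -> bot d k = Leaf) /\
  (forall k, (k < j \/ j' <= k)%Z -> top d k = Leaf).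
Proof.
  intros Hf Hd. destruct (in_F_translation f Hf) as (a & b & m & n & Ha & Hb).
  pose proof Hd as ([N1 F1] & [N2 F2] & _).
  (* [K] also dominates the translation amounts [m] and [n], because the range window runs from
     [- K - m] to [K - n] and must contain the nontrivial top trees and the pointer. *)
  set (K := (Z.abs a + Z.abs b + Z.abs m + Z.abs n + Z.of_nat N1 + Z.of_nat N2 + 1)%Z).
  set (i := (- K)%Z). set (i' := K).
  assert (Hi : (i <= a)%Z) by lia. assert (Hi' : (b <= i')%Z) by lia.
  apply IZR_le in Hi, Hi'.
  pose proof (dchain_fleaves (bot d) i (Z.to_nat (i' - i))) as C.
  replace (i + Z.of_nat (Z.to_nat (i' - i)))%Z with i' in C by lia.
  destruct (diagram_columns f d (fleaves (bot d) i (Z.to_nat (i' - i))) Hd) as (l & E & M & T).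
  { apply Forall_forall. intros e He. apply in_fleaves in He as (k & p & _ & H & ->).
    now exists k, p. }
  rewrite <- E in C. apply chain_maps with (f := f) in C; auto.
  exists l, i, (i - m)%Z, i', (i' - n)%Z. repeat split; auto; try lia.
  - rewrite !minus_IZR, <- Ha, <- Hb; auto.
  - intros t Ht. rewrite Ha, minus_IZR; lra.
  - intros t Ht. rewrite Hb, minus_IZR; lra.
  - intros k Hk. apply F2. lia.
  - intros k Hk. apply F1. lia.
Qed.

(** If both halves of an interval are leaves of one forest, their paths differ only in the last
    step, so they are the children of one caret. *)
Lemma reducible_opp f d c c' : maps f c -> maps f c' ->
  is_leaf (bot d) (dom c) -> is_leaf (bot d) (dom c') ->
  is_leaf (top d) (ran c) -> is_leaf (top d) (ran c') -> opp c c' -> reducible f d.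
Proof.
  intros M M' B B' T T' ([e g] & -> & ->). cbn [col0 col1 dom ran] in *.
  assert (Hsib : forall F h, is_leaf F (half0 h) -> is_leaf F (half1 h) ->
    exists i p, subtree (F i) p = Some (Node Leaf Leaf) /\
      half0 h = dpath i (p ++ [false]) /\ half1 h = dpath i (p ++ [true])).
  { intros F h (i & p & Hp & E) (k & q & Hq & E'). symmetry in E, E'.
    pose proof E as E0. apply dpath_half0 in E as (p' & -> & Eh).
    pose proof E' as E0'. apply dpath_half1 in E' as (q' & -> & Eh').
    rewrite Eh in Eh'. apply dpath_inj in Eh' as [<- <-].
    exists i, p'. split; auto. apply subtree_snoc in Hp as (l & r & Hp & El).
    apply subtree_snoc in Hq as (l' & r' & Hq & Er). rewrite Hp in Hq.
    injection Hq as <- <-. now subst l r. }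
  destruct (Hsib _ _ B B') as (i & p & Hp & E1 & E2).
  destruct (Hsib _ _ T T') as (j & q & Hq & E3 & E4).
  exists i, p, j, q. unfold matched. rewrite !node_left_dl, !node_right_dr, <- E1, <- E2, <- E3, <- E4.
  destruct M as (M1 & M2 & _), M' as (M1' & M2' & _). auto.
Qed.

Lemma special_leaf T i p : leaf_of T i p ->
  special (dpath i p) = true <-> T i <> Leaf \/ i = 0%Z.
Proof.
  intros H. unfold special, dpath; cbn [num dep]. destruct p as [|b p]; simpl length.
  - unfold leaf_of in H. rewrite subtree_nil in H. injection H as H. cbn [pnum].
    rewrite P_0, Z.mul_1_r, Z.add_0_r. simpl. rewrite Z.eqb_eq. split; [auto|].
    intros [N|N]; [easy|auto].
  - split; auto. intros _. left. intros E. unfold leaf_of in H. now rewrite E in H.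
Qed.

Lemma special_column_col f d c i p : maps f c -> is_leaf (top d) (ran c) ->
  leaf_of (bot d) i p -> dom c = dpath i p ->
  special_column f d i p <-> cspecial c = true.
Proof.
  intros (M1 & M2 & _) (j & q & Hq & Er) Hp Ed.
  unfold special_column, cspecial, matched. rewrite orb_true_iff, Ed, Er.
  rewrite (special_leaf (bot d)), (special_leaf (top d)) by auto.
  rewrite node_left_dl, node_right_dr, <- Ed. split.
  - intros (_ & [H|[H|(j' & q' & Hq' & [H1 _] & H)]]); auto.
    right. rewrite M1, node_left_dl in H1.
    assert (E : ran c = dpath j' q').
    { apply (is_leaf_dl_inj (top d)); auto; [now exists j, q|now exists j', q']. }
    rewrite Er in E. apply dpath_inj in E as [<- _]. exact H.
  - intros [[H|H]|H]; split; auto. right. right. exists j, q.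
    rewrite node_left_dl, node_right_dr, <- Er. auto.
Qed.

Definition wt (c : col) : nat := weight (lab (ran c)) (lab (dom c)).

Lemma total_split l : total l =
  (list_sum (map wt l) + (list_sum (map inner (map dom l)) + list_sum (map inner (map ran l))))%nat.
Proof.
  induction l as [|c l IH]; [reflexivity|]. rewrite total_cons, IH. unfold W.
  unfold list_sum; cbn [map fold_right]. unfold wt at 2. lia.
Qed.

Lemma inner_plain l : Forall (fun c => cspecial c = false) l ->
  list_sum (map inner (map dom l)) = 0%nat /\ list_sum (map inner (map ran l)) = 0%nat.
Proof.
  induction l as [|c l IH]; intros F; [auto|]. inversion_clear F.
  destruct (IH H0) as [E1 E2]. apply cspecial_false_unit in H as (-> & _).
  unfold list_sum in *; cbn [map unit dom ran fold_right]. rewrite E1, E2.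
  unfold inner. now rewrite !whole_dep0.
Qed.

Lemma inner_whole d z : num d = (z * P (dep d))%Z -> inner d = 0%nat.
Proof. intros H. unfold inner. now rewrite (whole_true d z H). Qed.

(** Weights are summed over the support, carets over the whole forests. The two sums agree with one
    sum over the tail of the trimmed list, because the discarded columns are trivial and the first
    column of the support starts at an integer in both forests. *)
Lemma reduced_ell f d : in_F f -> reduced_diagram f d ->
  exists n0 n1, ell0 f d n0 /\ ell1 d n1 /\ ell f (n0 + n1).
Proof.
  intros Hf [Hd Hred]. destruct (wide_columns f d Hf Hd)
    as (l & a & b & a' & b' & R & Ha & Hb & Edom & Ftop & Hbot & Htop).
  assert (Fbot : Forall (fun c => is_leaf (bot d) (dom c)) l).
  { apply Forall_forall. intros c Hc. apply (in_map dom) in Hc. rewrite Edom in Hc.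
    apply in_fleaves in Hc as (k & p & _ & H & ->). now exists k, p. }
  pose proof R as (C & M & Lf & Lf').
  (* The diagram only provides a top leaf for each bottom leaf; that every top leaf of the window is
     hit follows since both lists tile the same interval. *)
  assert (Eran : map ran l = fleaves (top d) b (Z.to_nat (b' - b))).
  { apply chain_dchain in C as [_ C].
    pose proof (dchain_fleaves (top d) b (Z.to_nat (b' - b))) as C'.
    replace (b + Z.of_nat (Z.to_nat (b' - b)))%Z with b' in C' by lia.
    eapply (dchain_unique (is_leaf (top d))); eauto using is_leaf_dl_inj.
    - apply Forall_map. exact Ftop.
    - apply Forall_forall. intros e He. apply in_fleaves in He as (k & p & _ & H & ->).
      now exists k, p. }
  assert (Hr : red l).
  { intros c c' (X & Y & E) Ho. apply Hred. rewrite Forall_forall in Fbot, Ftop, M.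
    assert (In c l) by (rewrite E; apply in_elt).
    assert (In c' l) by (rewrite E; apply in_or_app; simpl; auto).
    eapply (reducible_opp f d c c'); auto. }
  destruct (rep_trim _ _ _ _ _ _ R Hr Ha Hb)
    as (A & l1 & B & i & j & i' & j' & El & HA & HB & S).
  exists (list_sum (map wt (tl l1))),
    (list_sum (map inner (map dom l)) + list_sum (map inner (map ran l)))%nat.
  assert (Hmem : forall i p, leaf_of (bot d) i p -> (a <= i < a')%Z ->
    exists c, In c l /\ dom c = dpath i p).
  { intros k p Hp Hk. assert (Hin : In (dpath k p) (map dom l)).
    { rewrite Edom. apply in_fleaves. exists k, p. split; [lia|auto]. }
    apply in_map_iff in Hin as (c & E & Hc). eauto. }
  split; [|split].
  - pose proof S as (R1 & _ & (T1 & T2) & _).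
    pose proof R1 as (C1 & _). apply chain_dchain in C1 as [C1 _].
    pose proof C as C0. apply chain_dchain in C0 as [C0 _].
    assert (Hl1 : forall c, In c l1 -> In c l).
    { intros c Hc. rewrite El. apply in_or_app. right. apply in_or_app. auto. }
    rewrite Forall_forall in M, Ftop, Fbot, HA, HB.
    (* A column outside the bottom window is translated outside the top window, where the trees are
       trivial and unmarked. *)
    assert (Hspec : forall k p, special_column f d k p ->
      exists c, In c l1 /\ dom c = dpath k p).
    { intros k p Hs.
      assert (Hk : (a <= k < a')%Z).
      { destruct Hs as (Hp & [H|[H|(j0 & q0 & Hq & [H1 H2] & H)]]); [|lia|].
        - destruct (Z_lt_ge_dec k a); [elim H; apply Hbot; lia|].
          destruct (Z_lt_ge_dec k a'); [lia|elim H; apply Hbot; lia].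
        - assert (Hj0 : (b <= j0 < b')%Z).
          { destruct H as [H|H]; [|lia].
            destruct (Z_lt_ge_dec j0 b); [elim H; apply Htop; lia|].
            destruct (Z_lt_ge_dec j0 b'); [lia|elim H; apply Htop; lia]. }
          rewrite !node_left_dl, !node_right_dr in *.
          pose proof (dpath_bounds j0 q0). pose proof (dpath_bounds k p).
          pose proof (dl_lt_dr (dpath j0 q0)).
          assert (L1 : IZR b <= IZR j0) by (apply IZR_le; lia).
          assert (L2 : IZR j0 + 1 <= IZR b') by (rewrite <- plus_IZR; apply IZR_le; lia).
          split.
          + apply Z.nlt_ge. intros N.
            assert (IZR k + 1 <= IZR a) by (rewrite <- plus_IZR; apply IZR_le; lia).
            rewrite Lf in H2; lra.
          + apply Z.nle_gt. intros N. apply IZR_le in N. rewrite Lf' in H1; lra. }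
      destruct (Hmem k p (proj1 Hs) Hk) as (c & Hc & E). exists c. split; auto.
      apply (special_column_col f d c k p) in Hs; auto; [|apply Hs].
      rewrite El in Hc. apply in_app_iff in Hc as [Hc|Hc].
      { apply HA in Hc. congruence. }
      apply in_app_iff in Hc as [Hc|Hc]; auto. apply HB in Hc. congruence. }
    assert (Hspec' : forall c, In c l1 -> cspecial c = true ->
      exists k p, special_column f d k p /\ dom c = dpath k p).
    { intros c Hc Hs. pose proof (Hl1 c Hc) as Hc'. destruct (Fbot c Hc') as (k & p & Hp & E).
      exists k, p. split; auto. apply (special_column_col f d c); auto. }
    (* Each space is represented by the left end of the domain interval on its right. *)
    exists (map (fun c => (dl (dom c), wt c)) (tl l1)). split; [|split; [|split]].
    + rewrite map_map. cbn [fst]. rewrite <- (map_map dom dl). rewrite <- tl_map.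
      destruct l1 as [|h l1]; [constructor|]. destruct C1 as [_ C1].
      eapply dchain_NoDup, C1.
    + intros x. rewrite map_map. cbn [fst]. rewrite in_map_iff. split.
      * intros (c & <- & Hc). destruct l1 as [|h l1]; [easy|]. cbn [tl] in Hc.
        apply in_split in Hc as (X & Y & ->).
        destruct (exists_last (l := h :: X)) as (X' & e & EX); [easy|].
        assert (El1 : h :: X ++ c :: Y = X' ++ e :: c :: Y).
        { rewrite app_comm_cons, EX, <- app_assoc. reflexivity. }
        split; [|split].
        -- assert (He : In e l) by (apply Hl1; rewrite El1; apply in_elt).
           destruct (Fbot e He) as (k & p & Hp & E). exists k, p. split; auto.
           rewrite node_right_dr, <- E. rewrite El1 in R1.
           destruct R1 as (C2 & _). apply chain_app in C2 as (u & v & _ & C2).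
           destruct C2 as (_ & _ & C2 & _). auto.
        -- destruct (Hspec' h) as (k & p & Hs & E); [now left|eauto|].
           exists k, p. split; auto. rewrite node_right_dr, <- E.
           destruct C1 as [_ C1]. apply dchain_bounds in C1 as [_ F].
           rewrite Forall_forall in F. apply F, in_map, in_elt.
        -- destruct (exists_last (l := c :: Y)) as (Y' & g & EY); [easy|].
           destruct (Hspec' g) as (k & p & Hs & E).
           { rewrite EY. right. apply in_or_app. right. apply in_or_app. simpl. auto. }
           { apply (T2 (h :: X ++ Y')). rewrite EY. now rewrite <- app_comm_cons, <- app_assoc. }
           exists k, p. split; auto. rewrite node_left_dl, <- E.
           rewrite app_comm_cons, EY, map_app in C1.
           apply dchain_app in C1 as (u & _ & C1).
           destruct Y' as [|y Y']; injection EY as <- EY; [lra|].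
           cbn [app map dchain] in C1. destruct C1 as (_ & C1).
           pose proof (dl_lt_dr (dom c)).
           apply dchain_bounds in C1 as [_ F]. rewrite Forall_forall in F.
           assert (Hg : In (dom g) (map dom (Y' ++ [g]))) by (apply in_map, in_elt).
           apply F in Hg. lra.
      * intros ((k & p & Hp & Hx) & (k1 & p1 & Hs1 & L1) & (k2 & p2 & Hs2 & L2)).
        rewrite node_right_dr in Hx, L1. rewrite node_left_dl in L2.
        destruct (Hspec _ _ Hs1) as (c1 & Hc1 & E1).
        destruct (Hspec _ _ Hs2) as (c2 & Hc2 & E2). rewrite <- E1 in L1. rewrite <- E2 in L2.
        pose proof (dl_lt_dr (dom c1)). pose proof (dl_lt_dr (dom c2)).
        pose proof (dchain_bounds _ _ _ C0) as [_ F0].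
        pose proof (dchain_bounds _ _ _ C1) as [_ F1].
        rewrite Forall_forall in F0, F1.
        pose proof (F0 _ (in_map dom _ _ (Hl1 _ Hc1))) as B1.
        pose proof (F0 _ (in_map dom _ _ (Hl1 _ Hc2))) as B2.
        assert (Hk : (a <= k < a')%Z).
        { pose proof (dpath_bounds k p). pose proof (dl_lt_dr (dpath k p)). split.
          - apply Z.lt_succ_r, lt_IZR. unfold Z.succ. rewrite plus_IZR. lra.
          - apply lt_IZR. lra. }
        destruct (Hmem k p Hp Hk) as (c & Hc & E). rewrite <- E in Hx.
        apply in_split in Hc as (X & Y & Exy). destruct Y as [|c' Y].
        { rewrite Exy in R. apply rep_last in R as [R _]. apply dr_eq_int in R. lra. }
        assert (Hdl : dl (dom c') = x).
        { rewrite Exy, map_app in C0. apply dchain_app in C0 as (u & _ & C0).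
          destruct C0 as (_ & C0 & _). congruence. }
        assert (Hc' : In c' l) by (rewrite Exy; apply in_or_app; simpl; auto).
        (* The space lies between two columns of the trimmed list, so the column [c'] on its right
           is neither cut off nor the first. *)
        exists c'. split; auto. pose proof (dl_lt_dr (dom c')).
        pose proof (F1 _ (in_map dom _ _ Hc1)). pose proof (F1 _ (in_map dom _ _ Hc2)).
        rewrite El, !map_app in C0. apply dchain_app in C0 as (u & CA & C0).
        apply dchain_app in C0 as (v & CM & CB).
        pose proof (dchain_bounds _ _ _ CM) as [_ FM]. rewrite Forall_forall in FM.
        pose proof (FM _ (in_map dom _ _ Hc1)). pose proof (FM _ (in_map dom _ _ Hc2)).
        rewrite El in Hc'. apply in_app_iff in Hc' as [Hc'|Hc'];
          [|apply in_app_iff in Hc' as [Hc'|Hc']].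
        -- apply dchain_bounds in CA as [_ FA]. rewrite Forall_forall in FA.
           apply (in_map dom), FA in Hc'. lra.
        -- destruct l1 as [|h l1]; [easy|]. destruct Hc' as [->|Hc']; auto.
           destruct CM as [CM _]. lra.
        -- apply dchain_bounds in CB as [_ FB]. rewrite Forall_forall in FB.
           apply (in_map dom), FB in Hc'. lra.
    + apply Forall_map, Forall_forall. intros c Hc. cbn [fst snd].
      assert (Hc' : In c l) by (apply Hl1; destruct l1; [easy|now right]).
      exists (lab (ran c)), (lab (dom c)). split; [|split; auto using is_label_leaf].
      destruct (M c Hc') as (-> & _). auto using is_label_leaf.
    + rewrite map_map. reflexivity.
  - rewrite Edom, Eran. apply ell1_window; intros k Hk; [apply Hbot|apply Htop]; lia.
  - exists l1, i, j, i', j'. split; auto. rewrite total_split. f_equal.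
    rewrite El, !map_app, !list_sum_app.
    destruct (inner_plain A HA) as [-> ->]. destruct (inner_plain B HB) as [-> ->].
    destruct S as (R1 & _). destruct l1 as [|h l1]; [reflexivity|].
    apply rep_first in R1 as [F1 F2]. cbn [map tl].
    apply inner_whole in F1, F2. simpl. rewrite F1, F2. lia.
Qed.

(** * Existence of the reduced diagram *)

Definition half (b : bool) : dint -> dint := if b then half1 else half0.

Fixpoint desc (d : dint) (p : list bool) : dint :=
  match p with [] => d | b :: p => desc (half b d) p end.

Lemma dpath_snoc i p b : dpath i (p ++ [b]) = half b (dpath i p).
Proof. destruct b; [apply dpath_snoc_true|apply dpath_snoc_false]. Qed.

Lemma desc_dpath i p q : desc (dpath i p) q = dpath i (p ++ q).
Proof.
  revert p. induction q as [|b q IH]; intros p; cbn [desc]; [now rewrite app_nil_r|].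
  rewrite <- dpath_snoc, IH, <- app_assoc. reflexivity.
Qed.

Lemma dpath_nil i : dpath i [] = Dint i 0.
Proof. unfold dpath; simpl. rewrite P_0. f_equal. lia. Qed.

Lemma desc_root i p : desc (Dint i 0) p = dpath i p.
Proof. rewrite <- dpath_nil. apply (desc_dpath i [] p). Qed.

Lemma dpath_surj d : exists i p, d = dpath i p.
Proof.
  destruct d as [b m]. revert b. induction m as [|m IH]; intros b.
  - exists b, []. now rewrite dpath_nil.
  - destruct (IH (b / 2)%Z) as (i & p & E). exists i, (p ++ [Z.odd b]).
    rewrite dpath_snoc, <- E. pose proof (Z.div2_odd b) as H. rewrite Z.div2_div in H.
    destruct (Z.odd b); unfold half, half0, half1; cbn [num dep Z.b2z] in *; f_equal; lia.
Qed.

Lemma maps_half f d e b : maps f (Col d e) -> maps f (Col (half b d) (half b e)).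
Proof.
  intros H. apply maps_halves in H as [H0 H1]. destruct b; [exact H1|exact H0].
Qed.

Lemma maps_desc f d e p : maps f (Col d e) -> maps f (Col (desc d p) (desc e p)).
Proof.
  revert d e. induction p as [|b p IH]; intros d e H; simpl; auto.
  now apply IH, maps_half.
Qed.

(** Subdivision stops at the first good interval, with [n] as fuel. If all descendants at depth [n]
    below [d] are good, the fuel never cuts a branch short and the leaves are the maximal good
    intervals. *)
Fixpoint split_tree (G : dint -> Prop) (n : nat) (d : dint) : tree :=
  match n with
  | O => Leaf
  | S n => if excluded_middle_informative (G d) then Leaf
           else Node (split_tree G n (half0 d)) (split_tree G n (half1 d))
  end.

Definition proper_prefix (q p : list bool) : Prop := exists b r, p = q ++ b :: r.

Lemma split_tree_leaf G n d p : (forall q, length q = n -> G (desc d q)) ->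
  subtree (split_tree G n d) p = Some Leaf <->
  G (desc d p) /\ forall q, proper_prefix q p -> ~ G (desc d q).
Proof.
  revert d p. induction n as [|n IH]; intros d p HG; cbn [split_tree].
  - specialize (HG [] eq_refl). destruct p as [|b p].
    + rewrite subtree_nil. split; auto. intros _. split; auto.
      intros q (b & r & E). now destruct q.
    + split; [easy|]. intros [_ H]. elim (H []); auto. exists b, p. reflexivity.
  - destruct (excluded_middle_informative (G d)) as [Gd|Gd].
    + destruct p as [|b p].
      * rewrite subtree_nil. split; auto. intros _. split; auto.
        intros q (b & r & E). now destruct q.
      * split; [easy|]. intros [_ H]. elim (H []); auto. exists b, p. reflexivity.
    + destruct p as [|b p].
      * rewrite subtree_nil. split; [easy|]. intros [H _]. contradiction.
      * assert (E : subtree (Node (split_tree G n (half0 d)) (split_tree G n (half1 d))) (b :: p)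
          = subtree (split_tree G n (half b d)) p) by now destruct b.
        rewrite E, IH.
        -- cbn [desc]. split; intros [H1 H2]; split; auto.
           ++ intros [|c q] (b' & r & Eq); [exact Gd|]. injection Eq as <- Eq.
              apply (H2 q). exists b', r. exact Eq.
           ++ intros q (b' & r & ->). apply (H2 (b :: q)). now exists b', r.
        -- intros q Hq. apply (HG (b :: q)). simpl. congruence.
Qed.

Lemma dyadic_frac x : dyadic x -> exists k0, forall k, (k0 <= k)%nat -> exists a, x = frac a k.
Proof.
  intros (a & k0 & ->). exists k0. intros k Hk. exists (a * P (k - k0))%Z.
  change (frac a k0 = frac (a * P (k - k0)) k). apply frac_eq.
  assert (F : P k = (P (k - k0) * P k0)%Z).
  { unfold P. rewrite <- Z.pow_add_r by lia. f_equal. lia. }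
  rewrite F. ring.
Qed.

Lemma frac_not_inside c d : frac c (dep d) <= dl d \/ dr d <= frac c (dep d).
Proof.
  unfold dl, dr. rewrite !frac_le. pose proof (P_pos (dep d)).
  destruct (Z_le_gt_dec c (num d)); [left|right]; nia.
Qed.

(** A slope of [2 ^ z] lowers the depth by [z]. Since the start [x] of the piece and its image lie
    on the grids of the two depths, the image of a grid interval is a grid interval. *)
Lemma maps_slope f x y z c e M d :
  (forall t, x <= t <= y -> f t = f x + powerRZ 2 z * (t - x)) ->
  x = frac c (dep d) -> f x = frac e M -> (Z.of_nat M = Z.of_nat (dep d) - z)%Z ->
  x <= dl d -> dr d <= y -> maps f (Col d (Dint (e + (num d - c)) M)).
Proof.
  intros H Ex Ef HM H1 H2. pose proof (dl_lt_dr d) as Hd.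
  assert (Hs : powerRZ 2 z <> 0) by (apply powerRZ_NOR; lra).
  pose proof (pow2_pos M) as HpM. pose proof (pow2_pos (dep d)) as Hpd.
  assert (E2 : powerRZ 2 z * / 2 ^ dep d = / 2 ^ M).
  { replace (2 ^ dep d) with (2 ^ M * powerRZ 2 z); [field; split; [lra|auto]|].
    rewrite !pow_powerRZ, <- powerRZ_add by lra. f_equal. lia. }
  assert (Hval : forall b, f x + powerRZ 2 z * (frac b (dep d) - x) = frac (e + (b - c)) M).
  { intros b. rewrite Ef, Ex. unfold frac. rewrite plus_IZR, minus_IZR. unfold Rdiv.
    transitivity (IZR e * / 2 ^ M + (IZR b - IZR c) * (powerRZ 2 z * / 2 ^ dep d)); [ring|].
    rewrite E2. ring. }
  unfold maps; cbn [dom ran]. repeat split.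
  - rewrite H by lra. apply Hval.
  - rewrite H by lra. unfold dr at 1. rewrite Hval. unfold dr; cbn [num dep]. f_equal. lia.
  - apply affine_slope with (powerRZ 2 z); auto. intros t Ht.
    rewrite (H t), (H (dl d)) by lra. ring.
Qed.

(* The depths of the images are bounded as well, which makes the range side uniform too. *)
Lemma pieces_good f x rest : pieces_ok f (x :: rest) ->
  exists N0, forall N, (N0 <= N)%nat ->
    (exists c, x = frac c N) /\ exists M, forall d, dep d = N -> x <= dl d ->
      dr d <= last (x :: rest) x -> exists e, (dep e <= M)%nat /\ maps f (Col d e).
Proof.
  revert x. induction rest as [|y rest IH]; intros x H.
  - destruct H as (H & _). destruct (dyadic_frac x H) as [N0 HN]. exists N0.
    intros N L. split; auto. exists O. intros d _ H1 H2. simpl in H2.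
    pose proof (dl_lt_dr d). lra.
  - destruct H as (Hx & Hfx & (Hxy & z & Hz) & H). apply IH in H as [N1 HN1].
    destruct (dyadic_frac x Hx) as [N2 HN2]. destruct (dyadic_frac _ Hfx) as [N3 HN3].
    exists (N1 + N2 + N3 + Z.to_nat (Z.abs z))%nat. intros N L.
    destruct (HN1 N) as ((c' & Ey) & M & HM); [lia|].
    destruct (HN2 N) as [c Ex]; [lia|]. split; [eauto|].
    set (M' := Z.to_nat (Z.of_nat N - z)). destruct (HN3 M') as [e Ef]; [lia|].
    exists (max M M'). intros d Dd H1 H2.
    destruct (frac_not_inside c' d) as [Hc|Hc]; rewrite Dd, <- Ey in Hc.
    + destruct (HM d) as (g & Hg & Hm); auto.
      * change (last (x :: y :: rest) x) with (last (y :: rest) x) in H2.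
        assert (El : forall u v, last (y :: rest) u = last (y :: rest) v).
        { clear. revert y. induction rest as [|w rest IH]; intros y u v; auto.
          apply (IH w u v). }
        now rewrite (El y x).
      * exists g. split; [lia|auto].
    + exists (Dint (e + (num d - c)) M'). split; [cbn [dep]; lia|].
      apply (maps_slope f x y z); rewrite ?Dd; auto. lia.
Qed.

(** At a depth beyond the denominators of all breakpoints, no breakpoint is interior to an interval,
    so each lies in one linear piece or in one of the two translation rays. *)
Lemma uniform_good f : in_F f ->
  exists N M, forall d, dep d = N -> exists e, (dep e <= M)%nat /\ maps f (Col d e).
Proof.
  intros (b0 & bs & m & n & H & Hm & Hn). destruct (pieces_good _ _ _ H) as [N0 HN].
  assert (Hd : exists N1, forall N, (N1 <= N)%nat -> exists c, last (b0 :: bs) b0 = frac c N).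
  { assert (Hl : dyadic (last (b0 :: bs) b0)).
    { clear HN Hm Hn. assert (G : forall u, dyadic (last (b0 :: bs) u)); [|auto].
      revert b0 H. induction bs as [|y rest IH]; intros x H u.
      - apply H.
      - destruct H as (_ & _ & _ & H). apply (IH y H u). }
    now apply dyadic_frac. }
  destruct Hd as [N1 HN1]. set (N := (N0 + N1)%nat).
  destruct (HN N) as ((c & Ec) & M & HM); [lia|]. destruct (HN1 N) as [c' Ec']; [lia|].
  assert (Hshift : forall d k, dep d = N -> (forall t, dl d <= t <= dr d -> f t = t - IZR k) ->
    exists e, (dep e <= max M N)%nat /\ maps f (Col d e)).
  { intros d k Hd Hk. exists (shift (- k) d). split; [simpl; lia|].
    destruct (follows_shift f (- k) d) as (E1 & E2 & E3).
    - intros t Ht. rewrite opp_IZR, Hk by auto. ring.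
    - repeat split; auto. }
  exists N, (max M N). intros d Hd.
  destruct (frac_not_inside c d) as [H1|H1]; rewrite Hd, <- Ec in H1.
  - destruct (frac_not_inside c' d) as [H2|H2]; rewrite Hd, <- Ec' in H2.
    + apply (Hshift d n); auto. intros t Ht. apply Hn. lra.
    + destruct (HM d) as (e & He & Hme); auto. exists e. split; [lia|auto].
  - apply (Hshift d m); auto. intros t Ht. apply Hm. lra.
Qed.

Lemma maps_increasing f c x y : maps f c ->
  dl (dom c) <= x -> x < y -> y <= dr (dom c) -> f x < f y.
Proof.
  intros (E1 & E2 & E) H1 H2 H3. pose proof (dl_lt_dr (dom c)). pose proof (dl_lt_dr (ran c)).
  rewrite (E x), (E y), E1, E2 by lra. apply Rplus_lt_compat_l, Rmult_lt_compat_r; [|lra].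
  apply Rdiv_lt_0_compat; lra.
Qed.

(** [f] increases on each interval of a fine grid because its image there has positive length; the
    induction counts the grid intervals to be crossed. *)
Lemma in_F_increasing f x y : in_F f -> x < y -> f x < f y.
Proof.
  intros Hf. destruct (uniform_good f Hf) as (N & M & H).
  assert (Hn : forall n k u v, frac k N <= u -> u < v -> v <= frac (k + Z.of_nat n) N ->
    f u < f v).
  { induction n as [|n IH]; intros k u v H1 H2 H3; [rewrite Z.add_0_r in H3; lra|].
    destruct (H (Dint k N) eq_refl) as (e & _ & He).
    assert (Hc : forall u v, frac k N <= u -> u < v -> v <= frac (k + 1) N -> f u < f v).
    { intros u' v'. apply (maps_increasing _ _ _ _ He). }
    replace (k + Z.of_nat (S n))%Z with (k + 1 + Z.of_nat n)%Z in H3 by lia.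
    destruct (Rle_dec v (frac (k + 1) N)); [auto|].
    destruct (Rle_dec (frac (k + 1) N) u); [eauto|].
    transitivity (f (frac (k + 1) N)); [apply Hc; lra|].
    apply (IH (k + 1)%Z); lra. }
  set (K := (1 + Z.abs (up (Rabs x)) + Z.abs (up (Rabs y)))%Z).
  assert (HK : forall b, frac (b * P N) N = IZR b).
  { intros b. rewrite <- frac_0. apply frac_eq. rewrite P_0. ring. }
  intros Hxy. pose proof (P_pos N).
  assert (Bound : forall u, (Z.abs (up (Rabs u)) < K)%Z -> - IZR K <= u <= IZR K).
  { intros u Hu. pose proof (archimed (Rabs u)) as [Hup _].
    assert (IZR (up (Rabs u)) <= IZR K) by (apply IZR_le; lia).
    pose proof (Rle_abs u). pose proof (Rle_abs (- u)). rewrite Rabs_Ropp in *. lra. }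
  pose proof (Bound x ltac:(lia)). pose proof (Bound y ltac:(lia)).
  apply (Hn (Z.to_nat (2 * K * P N)) (- K * P N)%Z); auto.
  - rewrite HK, opp_IZR. lra.
  - replace (- K * P N + Z.of_nat (Z.to_nat (2 * K * P N)))%Z with (K * P N)%Z by nia.
    rewrite HK. lra.
Qed.

Lemma discrete_crossing (Q : Z -> Prop) k n : Q k -> ~ Q (k + Z.of_nat n)%Z ->
  exists i, Q i /\ ~ Q (i + 1)%Z.
Proof.
  revert k. induction n as [|n IH]; intros k H H'.
  - rewrite Z.add_0_r in H'. contradiction.
  - destruct (classic (Q (k + 1)%Z)) as [H1|H1]; [|eauto].
    apply (IH (k + 1)%Z); auto. now replace (k + 1 + Z.of_nat n)%Z with (k + Z.of_nat (S n))%Z by lia.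
Qed.

(** A discrete intermediate value argument between two grid points far out on the translation rays,
    where [f] is below and above [y]. *)
Lemma grid_crossing f N y : in_F f ->
  exists d, dep d = N /\ f (dl d) <= y < f (dr d).
Proof.
  intros Hf. destruct (in_F_translation f Hf) as (a & b & m & n & Ha & Hb).
  assert (HK : forall b, frac (b * P N) N = IZR b).
  { intros c. rewrite <- frac_0. apply frac_eq. rewrite P_0. ring. }
  set (k := Z.min a (m - up (- y))). set (k' := Z.max b (n + up y)).
  assert (H1 : f (frac (k * P N) N) <= y).
  { assert (L1 : IZR k <= IZR a) by (apply IZR_le; lia).
    assert (L2 : IZR k <= IZR (m - up (- y))) by (apply IZR_le; lia).
    rewrite minus_IZR in L2. pose proof (archimed (- y)).
    rewrite HK, Ha; lra. }
  assert (H2 : y < f (frac (k' * P N) N)).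
  { assert (L1 : IZR b <= IZR k') by (apply IZR_le; lia).
    assert (L2 : IZR (n + up y) <= IZR k') by (apply IZR_le; lia).
    rewrite plus_IZR in L2. pose proof (archimed y).
    rewrite HK, Hb; lra. }
  assert (Hlt : (k * P N < k' * P N)%Z).
  { apply Z.nle_gt. intros L.
    assert (Hle : frac (k' * P N) N <= frac (k * P N) N).
    { apply frac_le. pose proof (P_pos N). nia. }
    destruct Hle as [Hle|Hle]; [|rewrite Hle in H2; lra].
    apply (in_F_increasing f) in Hle; auto. lra. }
  destruct (discrete_crossing (fun i => f (frac i N) <= y) (k * P N)
    (Z.to_nat (k' * P N - k * P N))) as (i & Hi & Hi'); auto.
  - replace (k * P N + Z.of_nat (Z.to_nat (k' * P N - k * P N)))%Z with (k' * P N)%Z by lia. lra.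
  - exists (Dint i N). split; auto. unfold dl, dr; simpl. lra.
Qed.

Lemma dint_overlap d e x : dep d = dep e -> dl d <= x < dr d -> dl e <= x < dr e -> d = e.
Proof.
  intros E H H'. destruct d as [b m], e as [c k]; simpl in E; subst k.
  assert (H1 : dl (Dint b m) < dr (Dint c m)) by lra.
  assert (H2 : dl (Dint c m) < dr (Dint b m)) by lra.
  unfold dl, dr in H1, H2; cbn [num dep] in H1, H2. apply frac_lt in H1, H2.
  pose proof (P_pos m). f_equal. nia.
Qed.

Lemma desc_bounds d p : dl d <= dl (desc d p) /\ dr (desc d p) <= dr d.
Proof.
  revert d. induction p as [|b p IH]; intros d; simpl; [lra|].
  destruct (IH (half b d)) as [H1 H2]. pose proof (dl_lt_dr d).
  destruct b; unfold half in *.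
  - rewrite dr_half1 in *. rewrite dl_half1 in *. lra.
  - rewrite dl_half0 in *. rewrite dr_half0_dl_half1, dl_half1 in *. lra.
Qed.

Lemma desc_of_contains d e : (dep d <= dep e)%nat -> dl d <= dl e < dr d ->
  exists p, e = desc d p.
Proof.
  intros L H. destruct (dpath_surj e) as (i & q & ->). cbn [dpath dep] in L.
  exists (skipn (dep d) q).
  assert (E : d = dpath i (firstn (dep d) q)).
  { apply (dint_overlap _ _ (dl (dpath i q))); auto.
    - cbn [dpath dep]. rewrite length_firstn. lia.
    - rewrite <- (firstn_skipn (dep d) q) at 2 3. rewrite <- desc_dpath.
      pose proof (desc_bounds (dpath i (firstn (dep d) q)) (skipn (dep d) q)).
      pose proof (dl_lt_dr (desc (dpath i (firstn (dep d) q)) (skipn (dep d) q))). lra. }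
  rewrite E at 1. now rewrite desc_dpath, firstn_skipn.
Qed.

Definition good_dom (f : R -> R) (d : dint) : Prop := exists e, maps f (Col d e).
Definition good_ran (f : R -> R) (e : dint) : Prop := exists d, maps f (Col d e).

(** The interval [e] starts inside the image [g] of a grid interval [d] and is at least as deep as
    [g], hence is a descendant of [g]. The corresponding descendant of [d] is mapped onto it. *)
Lemma uniform_good_ran f : in_F f -> exists M, forall e, dep e = M -> good_ran f e.
Proof.
  intros Hf. destruct (uniform_good f Hf) as (N & M & H). exists M. intros e He.
  destruct (grid_crossing f N (dl e) Hf) as (d & Hd & Hx).
  destruct (H d Hd) as (g & Hg & Hm). pose proof Hm as (E1 & E2 & _). simpl in E1, E2.
  rewrite E1, E2 in Hx. destruct (desc_of_contains g e) as (p & ->); auto; [lia|].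
  exists (desc d p). now apply maps_desc.
Qed.

Lemma exists_reduced_diagram f : in_F f -> exists d, reduced_diagram f d.
Proof.
  intros Hf.
  destruct (uniform_good f Hf) as (N & M0 & HN). destruct (uniform_good_ran f Hf) as (M & HM).
  destruct (in_F_translation f Hf) as (a & b & m & n & Ha & Hb).
  set (B := fun i => split_tree (good_dom f) N (Dint i 0)).
  set (T := fun j => split_tree (good_ran f) M (Dint j 0)).
  assert (HB : forall i p, leaf_of B i p <->
    good_dom f (dpath i p) /\ forall q, proper_prefix q p -> ~ good_dom f (dpath i q)).
  { intros i p. unfold leaf_of, B. rewrite split_tree_leaf.
    - rewrite desc_root. split; intros [H1 H2]; split; auto; intros q;
        specialize (H2 q); rewrite desc_root in *; auto.
    - intros q Hq. rewrite desc_root. destruct (HN (dpath i q) Hq) as (e & _ & He).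
      now exists e. }
  assert (HT : forall j q, leaf_of T j q <->
    good_ran f (dpath j q) /\ forall r, proper_prefix r q -> ~ good_ran f (dpath j r)).
  { intros i p. unfold leaf_of, T. rewrite split_tree_leaf.
    - rewrite desc_root. split; intros [H1 H2]; split; auto; intros q;
        specialize (H2 q); rewrite desc_root in *; auto.
    - intros q Hq. rewrite desc_root. now apply HM. }
  assert (Inj : forall x y, f x = f y -> x = y).
  { intros x y E. destruct (Rtotal_order x y) as [L|[L|L]]; auto;
      apply (in_F_increasing f) in L; auto; lra. }
  (* A good proper ancestor of the image would be the image of an interval [D]. By injectivity the
     descendant of [D] along the same path is the given leaf, so [D] is a good proper ancestor of
     it, against maximality. *)
  assert (Hmatch : forall i p e, leaf_of B i p -> maps f (Col (dpath i p) e) ->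
    exists j q, leaf_of T j q /\ e = dpath j q).
  { intros i p e Hl Hm. destruct (dpath_surj e) as (j & q & ->). exists j, q. split; auto.
    apply HT. split; [now exists (dpath i p)|]. intros r (c & s & ->) (D & HD).
    pose proof HD as HD0. apply maps_desc with (p := c :: s) in HD. rewrite desc_dpath in HD.
    assert (E : dpath i p = desc D (c :: s)).
    { destruct HD as (E1 & E2 & _), Hm as (E3 & E4 & _). cbn [dom ran] in *.
      apply dint_eq; apply Inj; congruence. }
    destruct (dpath_surj D) as (k & t & ->). rewrite desc_dpath in E.
    apply dpath_inj in E as [<- ->]. apply HB in Hl as [_ Hl]. apply (Hl t).
    - now exists c, s.
    - now exists (dpath j r). }
  exists (Diagram T B). split; [split; [|split]|].
  (* On the translation rays unit intervals correspond to unit intervals, so splitting stops at the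
     root of every far tree. *)
  - exists (Z.to_nat (Z.abs a + Z.abs b + Z.abs m + Z.abs n + 1)). intros j Hj. simpl. unfold T.
    destruct M as [|M]; [reflexivity|]. cbn [split_tree].
    destruct (excluded_middle_informative _) as [G|G]; auto. elim G.
    destruct (Z_lt_ge_dec j 0).
    + exists (Dint (j + m) 0). apply maps_unit. intros t Ht. rewrite plus_IZR in *.
      assert (L : IZR (j + m + 1) <= IZR a) by (apply IZR_le; lia).
      rewrite !plus_IZR in L. rewrite Ha; lra.
    + exists (Dint (j + n) 0). apply maps_unit. intros t Ht. rewrite plus_IZR in *.
      assert (L : IZR b <= IZR (j + n)) by (apply IZR_le; lia).
      rewrite !plus_IZR in L. rewrite Hb; lra.
  - exists (Z.to_nat (Z.abs a + Z.abs b + 1)). intros i Hi. simpl. unfold B.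
    destruct N as [|N]; [reflexivity|]. cbn [split_tree].
    destruct (excluded_middle_informative _) as [G|G]; auto. elim G.
    destruct (Z_lt_ge_dec i 0).
    + exists (Dint (i - m) 0). apply maps_unit. intros t Ht. rewrite minus_IZR.
      assert (L : IZR (i + 1) <= IZR a) by (apply IZR_le; lia).
      rewrite !plus_IZR in L. rewrite Ha; lra.
    + exists (Dint (i - n) 0). apply maps_unit. intros t Ht. rewrite minus_IZR.
      assert (L : IZR b <= IZR i) by (apply IZR_le; lia). rewrite Hb; lra.
  - intros i p Hl. simpl in Hl. cbv zeta. rewrite node_left_dl, node_right_dr.
    pose proof Hl as [(e & Hm) _]%HB. pose proof Hm as (E1 & E2 & E3). cbn [dom ran] in *.
    destruct (Hmatch i p e Hl Hm) as (j & q & Hq & ->). split.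
    + exists j, q. rewrite node_left_dl, node_right_dr. auto.
    + intros t Ht. rewrite E3 by auto. unfold Rdiv. ring.
  (* An opposing pair would make its parent interval good, while its children are maximal good
     intervals. *)
  - intros (i & p & j & q & Hp & Hq & [M1 M2] & [M3 M4]). simpl in Hp, Hq.
    rewrite !node_left_dl, !node_right_dr in *.
    assert (Hleaf : forall c, leaf_of B i (p ++ [c])).
    { intros c. unfold leaf_of. rewrite subtree_app, Hp. now destruct c. }
    assert (Hc : forall c, f (dl (dpath i (p ++ [c]))) = dl (dpath j (q ++ [c])) ->
      f (dr (dpath i (p ++ [c]))) = dr (dpath j (q ++ [c])) ->
      maps f (Col (half c (dpath i p)) (half c (dpath j q)))).
    { intros c F1 F2. rewrite <- !dpath_snoc.
      pose proof (Hleaf c) as [(e & Hm) _]%HB. pose proof Hm as (E1 & E2 & _).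
      cbn [dom ran] in *. replace (dpath j (q ++ [c])) with e; auto.
      apply dint_eq; congruence. }
    apply Hc in M1; auto. apply Hc in M3; auto.
    pose proof (Hleaf false) as [_ Hmax]%HB. apply (Hmax p).
    + exists false, []. reflexivity.
    + exists (dpath j q). apply maps_halves. auto.
Qed.

Theorem theorem4p2p2 (f : R -> R) (Hf : in_F f) :
  (exists d, reduced_diagram f d) /\
  (forall d, reduced_diagram f d ->
     exists n0 n1, ell0 f d n0 /\ ell1 d n1 /\ word_length f (n0 + n1)).
Proof.
  split; [now apply exists_reduced_diagram|].
  intros d Hd. destruct (reduced_ell f d Hf Hd) as (n0 & n1 & H0 & H1 & H).
  exists n0, n1. split; [|split]; auto. now apply ell_word_length.
Qed.
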